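(* Assume: (1) the law of $\epsilon_1$ is absolutely continuous with respect to Lebesgue measure, $F$ is twice continuously differentiable with $\sup_{x\in\mathbb{R}}|F''(x)|<\infty$, $\mathbf{E}\epsilon_1=0$, $\mathbf{E}|\epsilon_1|^4<\infty$, and $y_f=x_f^T\beta+\varepsilon_f$ where $\varepsilon_f$ is independent of $\epsilon$ and has the same distribution as $\epsilon_1$; (2) either (fixed design) $X$ and $x_f$ are non-random, or (random design) $X$ and $x_f$ are random, $x_f$ is independent of $(\epsilon,\varepsilon_f)$, and $X$ is independent of $(\epsilon,\varepsilon_f,x_f)$; (3) $X^TX$ is invertible for all $n\ge p$, $X^TX/n\to A$ and $\overline{x}_n\to b$ as $n\to\infty$, where $A$ is an invertible matrix and $b\in\mathbb{R}^p$, and there is a constant $M>0$ with $\|x_i\|_2\le M$ for $i=1,\dots,n$ and $\|x_f\|_2\le M$; (4) $F'(x)>0$ for all $x\in\mathbb{R}$ and $\mathcal{U}(x)>0$ for all $0<x<\infty$. Then for every $0<\alpha<1$ the residual-based bootstrap prediction interval $\{y_f : |y_f-x_f^T\widehat\beta|\le c^*_{1-\alpha}\}$ has asymptotic guarantee level $50\%$, that is, $$\mathbf{P}\Big(\mathbf{P}^*\big(|y_f-x_f^T\widehat\beta|\le c^*_{1-\alpha}\big)\ge 1-\alpha\Big)\to \tfrac12\quad\text{as } n\to\infty .$$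
   Context: Model. $p$ is fixed. For each $n\ge p$, $X$ is an $n\times p$ full-rank design matrix with $X^T=(x_1,\dots,x_n)$, $x_i\in\mathbb{R}^p$, and $y=X\beta+\epsilon$ with $\beta\in\mathbb{R}^p$ and $\epsilon=(\epsilon_1,\dots,\epsilon_n)^T$ i.i.d. with mean $0$, variance $\sigma^2$ and cumulative distribution function $F$. $x_f\in\mathbb{R}^p$ is a new regressor and $y_f$ the corresponding future observation. $\overline{x}_n=\frac1n\sum_{i=1}^n x_i$, and $\|\cdot\|_2$ is the Euclidean norm. Probability notation. In the fixed design case, $\mathbf{P}$ and $\mathbf{E}$ are ordinary probability and expectation, and $\mathbf{P}^*(\cdot)=Prob(\cdot\mid y)$, $\mathbf{E}^*=E(\cdot\mid y)$. In the random design case, $\mathbf{P}(\cdot)=Prob(\cdot\mid X,x_f)$, $\mathbf{E}=E(\cdot\mid X,x_f)$, $\mathbf{P}^*(\cdot)=Prob(\cdot\mid y,X,x_f)$, $\mathbf{E}^*=E(\cdot\mid y,X,x_f)$; assumptions (3), (4) are then required for almost every $(X,x_f)$ and conclusions hold almost surely in $(X,x_f)$. Quantities. $H(x)=\mathbf{E}\,\epsilon_1\mathbf{1}_{\epsilon_1\le x}$; $$\mathcal{V}(x,z)=\sigma^2F'(x)F'(z)\big(x_f^TA^{-1}x_f+1-2x_f^TA^{-1}b\big)-\big(F'(x)H(z)+F'(z)H(x)\big)\big(x_f^TA^{-1}b-1\big)+F(\min(x,z))-F(x)F(z);$$ $\mathcal{U}(x)=\mathcal{V}(x,x)+\mathcal{V}(-x,-x)-2\mathcal{V}(x,-x)$.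 Residual bootstrap. $\widehat\beta=(X^TX)^{-1}X^Ty$, $\widehat\epsilon_i'=y_i-x_i^T\widehat\beta$, $\widehat\epsilon_i=\widehat\epsilon_i'-\frac1n\sum_{j=1}^n\widehat\epsilon_j'$, $\widehat F(x)=\frac1n\sum_{i=1}^n\mathbf{1}_{\widehat\epsilon_i\le x}$. Conditionally on the data, $\epsilon_1^*,\dots,\epsilon_n^*,\varepsilon_f^*$ are i.i.d. with distribution $\widehat F$; $\epsilon^*=(\epsilon_1^*,\dots,\epsilon_n^* )^T$, $y^*=X\widehat\beta+\epsilon^*$, $y_f^*=x_f^T\widehat\beta+\varepsilon_f^*$, $\widehat\beta^*=(X^TX)^{-1}X^Ty^*$. $c^*_{1-\alpha}=\inf\{x\in\mathbb{R}: \mathbf{P}^*(|y_f^*-x_f^T\widehat\beta^*|\le x)\ge 1-\alpha\}$ is the $1-\alpha$ quantile of the bootstrap distribution. *)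

(* Defs.v *)
From HB Require Import structures.
From mathcomp Require Import all_boot all_order all_algebra.
From mathcomp Require Import all_classical all_reals all_analysis.

Set Implicit Arguments.
Unset Strict Implicit.
Unset Printing Implicit Defensive.

Import Order.TTheory GRing.Theory Num.Theory.
Import numFieldNormedType.Exports.

Local Open Scope ring_scope.
Local Open Scope classical_set_scope.

Section probability.
Context {R : realType} {d : measure_display} {T : measurableType d}.

Definition iid (P : probability T R) (I : finType) (Y : I -> {RV P >-> R})
    (F : R -> R) : Prop :=
  (forall B : I -> set R, (forall i, measurable (B i)) ->
     P (\bigcap_(i in [set: I]) (Y i @^-1` B i)) =
     (\prod_(i : I) P (Y i @^-1` B i))%E) /\
  (forall i x, cdf (Y i) x = (F x)%:E).

(* Finite-dimensional random elements are matrix-valued maps on [T]; the events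
   below generate the sigma-algebra of such an element, and unions of these
   classes generate the joint sigma-algebra of several elements. *)
Definition rv_events (Y : T -> R) : set_system T :=
  preimage_set_system setT Y measurable.

Definition mx_events (m n : nat) (Y : T -> 'M[R]_(m, n)) : set_system T :=
  \bigcup_(ij in [set: 'I_m * 'I_n]) rv_events (fun w => Y w ij.1 ij.2).

Definition random_mx (m n : nat) (Y : T -> 'M[R]_(m, n)) : Prop :=
  forall i j, measurable_fun setT (fun w => Y w i j).

Definition independent (P : probability T R) (G1 G2 : set_system T) : Prop :=
  forall A B, <<s G1 >> A -> <<s G2 >> B -> P (A `&` B) = (P A * P B)%E.

Definition cond_prob_version (P : probability T R) (G : set_system T)
    (E : set T) (g : T -> R) : Prop :=
  [/\ forall B, measurable B -> <<s G >> (g @^-1` B),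
      P.-integrable setT (EFin \o g)
    & forall C, <<s G >> C -> (\int[P]_(w in C) (g w)%:E = P (E `&` C))%E].

(* Prob(E | G) is only defined up to a null set; an arbitrary version is
   selected.  (The default value 0 is used only if there is no version, which
   does not happen when [E] and the members of [G] are measurable.) *)
Definition cond_prob (P : probability T R) (G : set_system T) (E : set T) :
    T -> R :=
  xget (fun=> 0) [set g | cond_prob_version P G E g].

End probability.

Section regression.
Context {R : realType} {p : nat}.
Implicit Types (xf b beta : 'cV[R]_p) (A : 'M[R]_p).

Definition norm2 (v : 'cV[R]_p) : R := Num.sqrt (\sum_i v i ord0 ^+ 2).

Definition dotv (u v : 'cV[R]_p) : R := (u^T *m v) ord0 ord0.

(* x_i is the transpose of the i-th row of X. *)
Definition regressor n (X : 'M[R]_(n, p)) (i : 'I_n) : 'cV[R]_p := (row i X)^T.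

Definition xbar n (X : 'M[R]_(n, p)) : 'cV[R]_p :=
  n%:R^-1 *: \sum_(i < n) regressor X i.

(* The designs of different sizes need not be nested. *)
Definition regular_design (X : forall n, 'M[R]_(n, p)) xf A b : Prop :=
  [/\ forall n, (p <= n)%N -> (X n)^T *m X n \in unitmx,
      A \in unitmx,
      (n%:R^-1 *: ((X n)^T *m X n)) @[n --> \oo] --> A,
      xbar (X n) @[n --> \oo] --> b
    & exists2 M : R, 0 < M &
        (forall n (i : 'I_n), (p <= n)%N -> norm2 (regressor (X n) i) <= M) /\
        norm2 xf <= M].

Definition calV (F H : R -> R) (sigma : R) A b xf (x z : R) : R :=
  sigma ^+ 2 * derive1 F x * derive1 F z *
    (dotv xf (invmx A *m xf) + 1 - 2 * dotv xf (invmx A *m b))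
  - (derive1 F x * H z + derive1 F z * H x) * (dotv xf (invmx A *m b) - 1)
  + F (Num.min x z) - F x * F z.

Definition calU (F H : R -> R) (sigma : R) A b xf (x : R) : R :=
  calV F H sigma A b xf x x + calV F H sigma A b xf (- x) (- x)
  - 2 * calV F H sigma A b xf x (- x).

Definition least_squares n (X : 'M[R]_(n, p)) (y : 'cV[R]_n) : 'cV[R]_p :=
  invmx (X^T *m X) *m X^T *m y.

Definition raw_residual n (X : 'M[R]_(n, p)) (y : 'cV[R]_n) (i : 'I_n) : R :=
  y i ord0 - dotv (regressor X i) (least_squares X y).

Definition residual n (X : 'M[R]_(n, p)) (y : 'cV[R]_n) (i : 'I_n) : R :=
  raw_residual X y i - n%:R^-1 * \sum_(j < n) raw_residual X y j.

Definition Fhat n (X : 'M[R]_(n, p)) (y : 'cV[R]_n) (x : R) : R :=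
  n%:R^-1 * \sum_(i < n) (residual X y i <= x)%R%:R.

Section bootstrap.
Context {d : measure_display} {S : measurableType d} (Q : probability S R).
Context (n : nat) (es : 'I_n -> {RV Q >-> R}) (esf : {RV Q >-> R}).

(* (S, Q) plays the role of the conditional probability space given the data:
   the n + 1 variables es_1, ..., es_n, esf are i.i.d. with distribution Fhat. *)
Definition bootstrap_errors (X : 'M[R]_(n, p)) (y : 'cV[R]_n) : Prop :=
  iid (fun o : option 'I_n => if o is Some i then es i else esf) (Fhat X y).

Definition boot_response (X : 'M[R]_(n, p)) (y : 'cV[R]_n) (v : S) : 'cV[R]_n :=
  X *m least_squares X y + \col_i es i v.

Definition boot_future (X : 'M[R]_(n, p)) (y : 'cV[R]_n) xf (v : S) : R :=
  dotv xf (least_squares X y) + esf v.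

Definition boot_least_squares (X : 'M[R]_(n, p)) (y : 'cV[R]_n) (v : S) :
    'cV[R]_p :=
  least_squares X (boot_response X y v).

Definition boot_quantile (X : 'M[R]_(n, p)) (y : 'cV[R]_n) xf (level : R) : R :=
  inf [set x : R | (level%:E <=
    Q [set v | (`|boot_future X y xf v
                  - dotv xf (boot_least_squares X y v)| <= x)%R])%E].

End bootstrap.

End regression.

Section model.
Context {R : realType} {d : measure_display} {T : measurableType d}.
Context {P : probability T R}.
(* eps 0, eps 1, ... stand for epsilon_1, epsilon_2, ... *)
Context (eps : nat -> {RV P >-> R}) (epsf : {RV P >-> R}).

Definition error_vec n (w : T) : 'cV[R]_n := \col_(i < n) eps i w.

Definition error_model (F : R -> R) (sigma : R) : Prop :=
  [/\ forall n, iid (fun i : 'I_n => eps i) F,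
      forall x, cdf epsf x = (F x)%:E,
      forall n, independent P (rv_events epsf) (mx_events (error_vec n)),
      ('V_P[eps 0%N] = (sigma ^+ 2)%R%:E)%E
    & ('E_P[eps 0%N] = 0)%E].

Definition error_regularity (F : R -> R) : Prop :=
  [/\ distribution P (eps 0%N) `<< lebesgue_measure,
      forall x, derivable F x 1,
      forall x, derivable (derive1 F) x 1,
      continuous (derive1n 2 F)
    & has_ubound (range (fun x => `|derive1n 2 F x|))] /\
  ('E_P[fun w => (`|eps 0%N w| ^+ 4)%R] < +oo)%E.

Definition trunc_mean (x : R) : R :=
  fine ('E_P[fun w => (eps 0%N w * \1_[set w' | eps 0%N w' <= x] w)%R])%E.

Context {p : nat}.

Definition response n (X : 'M[R]_(n, p)) (beta : 'cV[R]_p) (w : T) : 'cV[R]_n :=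
  X *m beta + error_vec n w.

Definition future (xf beta : 'cV[R]_p) (w : T) : R := dotv xf beta + epsf w.

Definition random_design (X : forall n, T -> 'M[R]_(n, p)) (xf : T -> 'cV[R]_p)
    : Prop :=
  [/\ forall n, random_mx (X n),
      random_mx xf,
      forall n, independent P (mx_events xf)
        (mx_events (error_vec n) `|` rv_events epsf)
    & forall n, independent P (mx_events (X n))
        (mx_events (error_vec n) `|` rv_events epsf `|` mx_events xf)].

End model.

(* Main.v *)
Require Import Defs.
From HB Require Import structures.
From mathcomp Require Import all_boot all_order all_algebra.
From mathcomp Require Import all_classical all_reals all_analysis.
From mathcomp Require Import measurable_realfun ring lra.

Set Implicit Arguments.
Unset Strict Implicit.
Unset Printing Implicit Defensive.

Import Order.TTheory GRing.Theory Num.Theory.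
Import numFieldNormedType.Exports.

Local Open Scope ring_scope.
Local Open Scope classical_set_scope.

Section fubini_independent.
Context {R : realType} {d d1 d2 : measure_display} {T : measurableType d}.
Context {T1 : measurableType d1} {T2 : measurableType d2}.
Context (P : probability T R).
Local Open Scope ereal_scope.
Context (X1 : {mfun T >-> T1}) (X2 : {mfun T >-> T2}).
Hypothesis ind : forall A B, measurable A -> measurable B ->
  P (X1 @^-1` A `&` X2 @^-1` B) = P (X1 @^-1` A) * P (X2 @^-1` B).

Let diag (w : T) := (X1 w, X2 w).
Let mdiag : measurable_fun setT diag.
Proof. exact: measurable_fun_pair. Qed.
HB.instance Definition _ := isMeasurableFun.Build _ _ _ _ diag mdiag.

Lemma ge0_integral_independent (f : T1 * T2 -> \bar R) :
  measurable_fun setT f -> (forall x, 0 <= f x) ->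
  \int[P]_w f (X1 w, X2 w) = \int[P]_w \int[P]_w' f (X1 w, X2 w').
Proof.
move=> mf f0.
pose m1 : probability T1 R := distribution P X1.
pose m2 : probability T2 R := distribution P X2.
have E : forall X : set (T1 * T2), measurable X ->
    (m1 \x m2) X = distribution P diag X.
  apply: product_measure_unique => A B mA mB.
  by rewrite /= /distribution /pushforward/= -ind.
rewrite -(@ge0_integral_distribution _ _ _ _ _ P diag _ mf f0).
rewrite (eq_measure_integral (m1 \x m2)); last first.
  by move=> A mA _; exact: esym (E A mA).
rewrite fubini_tonelli1//.
rewrite ge0_integral_distribution; last 2 first.
- exact: measurable_fun_fubini_tonelli_F.
- by move=> y; exact: integral_ge0.
apply: eq_integral => w _ /=.
rewrite /fubini_F.
by rewrite ge0_integral_distribution//; apply: measurableT_comp.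
Qed.

Lemma measurable_integral_frozen (f : T1 * T2 -> \bar R) :
  measurable_fun setT f -> (forall x, 0 <= f x) ->
  measurable_fun [set: T1] (fun w => \int[P]_w' f (w, X2 w')).
Proof.
move=> mf f0; pose m2 : probability T2 R := distribution P X2.
rewrite (_ : (fun _ => _) = fubini_F m2 f).
  exact: measurable_fun_fubini_tonelli_F.
apply/funext => w; rewrite /fubini_F ge0_integral_distribution//.
exact: measurableT_comp.
Qed.

End fubini_independent.

Section generated.
Context {R : realType} {d : measure_display} {T : measurableType d}.

Lemma g_sigma_measurable (G : set_system T) :
  G `<=` measurable -> <<s G >> `<=` measurable.
Proof.
move=> GM; apply: smallest_sub => //; exact: sigma_algebra_measurable.
Qed.

Lemma measurable_id_g_sigma (G : set_system T) : G `<=` measurable ->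
  measurable_fun setT (id : T -> g_sigma_algebraType G).
Proof.
move=> GM _ A mA; rewrite setTI preimage_id.
exact: (g_sigma_measurable GM).
Qed.

Definition g_sigma_id (G : set_system T) (GM : G `<=` measurable) :
    {mfun T >-> g_sigma_algebraType G} :=
  mfun_Sub (mem_set (measurable_id_g_sigma GM)).

(* a function measurable for the generated sigma-algebra *)
Lemma g_sigma_measurableT (G : set_system T) d' (T' : measurableType d')
    (f : T -> T') : G `<=` measurable ->
  measurable_fun setT (f : g_sigma_algebraType G -> T') -> measurable_fun setT f.
Proof.
move=> GM mf _ A mA; rewrite setTI; apply: (g_sigma_measurable GM).
by have := mf measurableT A mA; rewrite setTI.
Qed.

End generated.

Section cond.
Context {R : realType} {d : measure_display} {T : measurableType d}.
Context (P : probability T R) (G1 G2 : set_system T).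
Hypotheses (G1M : G1 `<=` measurable) (G2M : G2 `<=` measurable).
Hypothesis ind : independent P G1 G2.

Lemma cond_prob_version_frozen (b : T -> T -> bool) :
  measurable_fun setT (fun z : g_sigma_algebraType G1 * g_sigma_algebraType G2 =>
     b z.1 z.2) ->
  cond_prob_version P G1 [set w | b w w] (fun w => fine (P [set w' | b w w'])).
Proof.
move=> mb.
pose X1 := g_sigma_id G1M. pose X2 := g_sigma_id G2M.
have ind' : forall A B : set T, measurable (A : set (g_sigma_algebraType G1)) ->
   measurable (B : set (g_sigma_algebraType G2)) ->
  (P (X1 @^-1` A `&` X2 @^-1` B) = P (X1 @^-1` A) * P (X2 @^-1` B))%E.
  by move=> A B mA mB; exact: ind.
have mbw w : measurable [set w' | b w w'].
  apply: (g_sigma_measurable G2M).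
  have := measurableT_comp mb (pair1_measurable (w : g_sigma_algebraType G1)).
  by move=> /(_ measurableT [set true] I); rewrite setTI.
pose f (z : g_sigma_algebraType G1 * g_sigma_algebraType G2) :=
  ((b z.1 z.2 : nat)%:R : R)%:E.
have mf : measurable_fun setT f.
  apply/measurable_EFinP.
  rewrite (_ : (fun _ => _) = (fun z => if b z.1 z.2 then 1 else 0 : R)).
    exact: measurable_fun_ifT.
  by apply/funext => z; case: ifP.
have f0 z : (0 <= f z)%E by rewrite lee_fin.
have fP w : (\int[P]_w' f (w, w') = P [set w' | b w w'])%E.
  rewrite -[[set w' | b w w']]setIT -integral_indic//; apply: eq_integral => w' _.
  rewrite /f/= indicE; congr (_%:R%:E).
  by case: (boolP (b w w')) => h; [rewrite mem_set|rewrite memNset//; exact/negP].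
have mF := measurable_integral_frozen P X2 mf f0.
have mg : measurable_fun setT
    (fun w : g_sigma_algebraType G1 => fine (P [set w' | b w w'])).
  apply: measurableT_comp => //.
  rewrite (_ : (fun _ => _) = fun w => (\int[P]_w' f (w, w'))%E)//.
  by apply/funext => w; rewrite fP.
split.
- by move=> B mB; have := mg measurableT B mB; rewrite setTI.
- apply: (@measurable_bounded_integrable _ _ _ P _ _ measurableT).
  + by rewrite (le_lt_trans (probability_le1 _ _))// ltry.
  + exact: (g_sigma_measurableT G1M).
  + exists 1; split => // x x1 w _ /=.
    rewrite ger0_norm ?fine_ge0// ltW// (le_lt_trans _ x1)//.
    by rewrite -lee_fin fineK ?fin_num_measure// probability_le1.
move=> C GC.
pose fC (z : g_sigma_algebraType G1 * g_sigma_algebraType G2) :=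
  ((b z.1 z.2 && (z.1 \in C) : nat)%:R : R)%:E.
have mC : measurable C by exact: (g_sigma_measurable G1M).
have mfC : measurable_fun setT fC.
  apply/measurable_EFinP.
  rewrite (_ : (fun _ => _) = (fun z => if b z.1 z.2 then
       (if z.1 \in C then 1 else 0) else 0 : R)).
    apply: measurable_fun_ifT => //; apply: measurable_fun_ifT => //.
    apply: (measurableT_comp (f := fun z : g_sigma_algebraType G1 => z \in C)) => //.
    apply: (measurable_fun_bool true) => //; rewrite setTI.
    rewrite (_ : _ @^-1` _ = C)//; apply/seteqP; split => x /=.
      by move/set_mem.
    by move/mem_set.
  by apply/funext => z; case: ifP => //= _; case: ifP.
have fC0 z : (0 <= fC z)%E by rewrite lee_fin.
have := ge0_integral_independent (X1 := X1) (X2 := X2) ind' mfC fC0.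
rewrite /= => H.
transitivity (\int[P]_w fC (w, w))%E; last first.
  rewrite -[[set w | b w w] `&` C]setIT -integral_indic//=; last first.
    apply: measurableI => //.
    have := measurableT_comp mb (measurable_fun_pair
      (measurable_id_g_sigma G1M) (measurable_id_g_sigma G2M)).
    by move=> /(_ measurableT [set true] I); rewrite setTI.
  apply: eq_integral => w _; rewrite /fC/= indicE in_setI; congr (_%:R%:E).
  by case: (boolP (b w w)) => h; [rewrite mem_set|rewrite memNset//; exact/negP].
rewrite H integral_mkcond; apply: eq_integral => w _.
rewrite patchE; case: ifPn => wC.
  rewrite fineK ?fin_num_measure// -fP; apply: eq_integral => w' _.
  by rewrite /f /fC/= wC andbT.
rewrite integral0_eq// => w' _.
by rewrite /fC/= (negbTE wC) andbF.
Qed.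

End cond.

Section cond_prob_unique.
Context {R : realType} {d : measure_display} {T : measurableType d}.
Context (P : probability T R) (G : set_system T).
Hypothesis GM : G `<=` measurable.

Lemma cond_prob_version_ae_le E (g h : T -> R) :
  cond_prob_version P G E g -> cond_prob_version P G E h ->
  {ae P, forall w, g w <= h w}.
Proof.
move=> [mg ig Eg] [mh ih Eh].
have mg' : measurable_fun setT g.
  by move=> _ B mB; rewrite setTI; exact: (g_sigma_measurable GM (mg _ mB)).
have mh' : measurable_fun setT h.
  by move=> _ B mB; rewrite setTI; exact: (g_sigma_measurable GM (mh _ mB)).
pose C := [set w | h w < g w].
have GC : <<s G >> C.
  have mgG : measurable_fun setT (g : g_sigma_algebraType G -> R).
    by move=> _ B mB; rewrite setTI; exact: mg.
  have mhG : measurable_fun setT (h : g_sigma_algebraType G -> R).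
    by move=> _ B mB; rewrite setTI; exact: mh.
  have := measurable_fun_ltr mhG mgG.
  by move=> /(_ measurableT [set true] I); rewrite setTI.
have mC := g_sigma_measurable GM GC.
have igC : P.-integrable C (EFin \o g) by exact: integrableS ig.
have ihC : P.-integrable C (EFin \o h) by exact: integrableS ih.
have E0 : (\int[P]_(w in C) `|((g w - h w)%:E)| = 0)%E.
  rewrite (eq_integral (fun w => (g w)%:E - (h w)%:E)%E); last first.
    move=> w /set_mem wC; rewrite abse_EFin ger0_norm ?EFinB//.
    by rewrite subr_ge0 ltW.
  rewrite integralB_EFin// Eg// Eh// subee//.
  by rewrite -Eg//; exact: integrable_fin_num.
have {E0} := E0.
have mgh : measurable_fun C (fun w => (g w - h w)%:E).
  by apply/measurable_EFinP; apply: measurable_funTS; exact: measurable_funB.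
move/(ae_eq_integral_abs P mC mgh) => Eae.
apply: filterS Eae => w Cw.
rewrite leNgt; apply/negP => wC.
have := Cw wC => /= -[] /eqP; rewrite subr_eq0 => /eqP e.
by move: wC; rewrite e ltxx.
Qed.

Lemma cond_prob_ae E (g : T -> R) : cond_prob_version P G E g ->
  {ae P, forall w, cond_prob P G E w = g w}.
Proof.
move=> vg.
have vc : cond_prob_version P G E (cond_prob P G E).
  by rewrite /cond_prob; case: xgetP => // /(_ g).
have h1 := cond_prob_version_ae_le vg vc.
have h2 := cond_prob_version_ae_le vc vg.
apply: filterS2 h1 h2 => w gc cg.
by apply/eqP; rewrite eq_le gc cg.
Qed.

Lemma cond_probP E (g : T -> R) : cond_prob_version P G E g ->
  cond_prob_version P G E (cond_prob P G E).
Proof. by move=> vg; rewrite /cond_prob; case: xgetP => // /(_ g). Qed.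

Lemma cond_prob_version_congr E E' (g : T -> R) :
  (forall C, <<s G >> C -> P (E `&` C) = P (E' `&` C)) ->
  cond_prob_version P G E g -> cond_prob_version P G E' g.
Proof. by move=> EE' [mg ig Eg]; split=> // C GC; rewrite Eg// EE'. Qed.

End cond_prob_unique.

Section independence.
Context {R : realType} {d : measure_display} {T : measurableType d}.
Context (P : probability T R).
Implicit Types G H : set_system T.

Lemma probability_unique_pi (m1 m2 : {measure set T -> \bar R}) G :
  G `<=` measurable -> setI_closed G -> (m1 setT < +oo)%E ->
  m1 setT = m2 setT -> (forall A, G A -> m1 A = m2 A) ->
  forall A, <<s G >> A -> m1 A = m2 A.
Proof.
move=> GM GI m1oo mT mG A GA.
pose G' := G `|` [set setT].
apply: (@g_sigma_algebra_measure_unique _ _ _ G' _ (fun=> setT)).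
- by move=> B [/GM//|->].
- by move=> _; right.
- by apply/seteqP; split => // x _; exists 0%N.
- move=> B C [GB|->] [GC|->]; rewrite ?setTI ?setIT; [left; exact: GI|left|left|right] => //.
- by move=> B [/mG|->].
- by move=> _.
- by apply: sub_sigma_algebra2 GA; exact: subsetUl.
Qed.

Lemma independent_pi G H : G `<=` measurable -> H `<=` measurable ->
  setI_closed G ->
  (forall A B, G A -> <<s H >> B -> P (A `&` B) = (P A * P B)%E) ->
  independent P G H.
Proof.
move=> GM HM GI GH A B GA HB.
have mB := g_sigma_measurable HM HB.
pose k : {nonneg R} := NngNum (fine_ge0 (measure_ge0 P B)).
have kE : (k%:num%:E = P B)%E by rewrite /= fineK// fin_num_measure.
have := @probability_unique_pi (mrestr P mB) (mscale k P) G GM GI _ _ _ A GA.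
rewrite /= /mrestr /mscale/= kE => -> //.
- by rewrite muleC.
- by rewrite setTI (le_lt_trans (probability_le1 _ _))// ltry.
- by rewrite setTI probability_setT mule1.
- by move=> C GC; rewrite GH// muleC.
Qed.

Lemma independent_sub G H G' H' : G' `<=` <<s G >> -> H' `<=` <<s H >> ->
  independent P G H -> independent P G' H'.
Proof.
move=> GG HH ind A B GA HB; apply: ind.
  by apply: smallest_sub GG _ GA; exact: smallest_sigma_algebra.
by apply: smallest_sub HH _ HB; exact: smallest_sigma_algebra.
Qed.

Lemma independentC G H : independent P G H -> independent P H G.
Proof. by move=> ind A B HA GB; rewrite setIC ind// muleC. Qed.

Lemma independent_setU G1 G2 H :
  G1 `<=` measurable -> G2 `<=` measurable -> H `<=` measurable ->
  (forall A B C, <<s G1 >> A -> <<s G2 >> B -> <<s H >> C ->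
     P (A `&` B `&` C) = (P (A `&` B) * P C)%E) ->
  independent P (G1 `|` G2) H.
Proof.
move=> G1M G2M HM hG.
pose Pi := [set C | exists A B, [/\ <<s G1 >> A, <<s G2 >> B & C = A `&` B]].
have gT G : <<s G >> setT.
  exact: (@measurableT _ (g_sigma_algebraType G)).
apply: (@independent_sub Pi H); last first.
- apply: independent_pi => //.
  + move=> _ [A [B [GA GB ->]]]; apply: measurableI.
      exact: (g_sigma_measurable G1M).
    exact: (g_sigma_measurable G2M).
  + move=> _ _ [A [B [GA GB ->]]] [A' [B' [GA' GB' ->]]].
    exists (A `&` A'), (B `&` B'); split; last by rewrite setIACA.
      exact: (@measurableI _ (g_sigma_algebraType G1)).
    exact: (@measurableI _ (g_sigma_algebraType G2)).
  + by move=> _ C [A [B [GA GB ->]]] HC; exact: hG.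
- exact: sub_sigma_algebra.
- move=> A [GA|GA]; apply: sub_sigma_algebra.
    by exists A, setT; split; [exact: sub_sigma_algebra|exact: gT|rewrite setIT].
  by exists setT, A; split; [exact: gT|exact: sub_sigma_algebra|rewrite setTI].
Qed.

End independence.

Section measurable_bigops.
Context {R : realType} {d : measure_display} {T : measurableType d}.

Lemma measurable_sumr I (r : seq I) (Q : pred I) (h : I -> T -> R) :
  (forall i, measurable_fun setT (h i)) ->
  measurable_fun setT (fun w => \sum_(i <- r | Q i) h i w).
Proof.
move=> mh; elim: r => [|i r ih].
  rewrite [X in measurable_fun _ X](_ : _ = cst 0); first exact: measurable_cst.
  by apply/funext => w; rewrite big_nil.
rewrite [X in measurable_fun _ X](_ : _ = fun w => if Q i then h i w + \sum_(j <- r | Q j) h j w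
  else \sum_(j <- r | Q j) h j w); last by apply/funext => w; rewrite big_cons.
by case: (Q i) => //; exact: measurable_funD.
Qed.

Lemma measurable_prodr I (r : seq I) (Q : pred I) (h : I -> T -> R) :
  (forall i, measurable_fun setT (h i)) ->
  measurable_fun setT (fun w => \prod_(i <- r | Q i) h i w).
Proof.
move=> mh; elim: r => [|i r ih].
  rewrite [X in measurable_fun _ X](_ : _ = cst 1); first exact: measurable_cst.
  by apply/funext => w; rewrite big_nil.
rewrite [X in measurable_fun _ X](_ : _ = fun w => if Q i then h i w * \prod_(j <- r | Q j) h j w
  else \prod_(j <- r | Q j) h j w); last by apply/funext => w; rewrite big_cons.
by case: (Q i) => //; exact: measurable_funM.
Qed.

Lemma measurable_invr : measurable_fun setT (GRing.inv : R -> R).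
Proof.
rewrite (_ : GRing.inv = fun x : R => x * ((x ^+ 2) `^ (-1))); last first.
  apply/funext => x; rewrite powR_inv1 ?sqr_ge0//.
  have [->|x0] := eqVneq x 0; first by rewrite invr0 mul0r.
  by rewrite expr2 invfM mulrA divff// mul1r.
apply: measurable_funM => //.
have m1 : measurable_fun setT (fun y : R => y `^ (-1)) by exact: measurable_powR.
apply: (measurableT_comp m1 (g := fun x : R => x ^+ 2)).
exact: measurable_funX.
Qed.

Lemma measurable_set_bool (b : T -> bool) :
  measurable_fun setT b -> measurable [set w | b w].
Proof. by move=> /(_ measurableT [set true] I); rewrite setTI. Qed.

Lemma measurable_set_le (f g : T -> R) : measurable_fun setT f ->
  measurable_fun setT g -> measurable [set w | f w <= g w].
Proof. by move=> mf mg; apply: measurable_set_bool; exact: measurable_fun_ler. Qed.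

End measurable_bigops.

Section random_matrices.
Context {R : realType} {d : measure_display} {T : measurableType d}.

Lemma random_mx_cst m n (A : 'M[R]_(m, n)) : random_mx (fun _ : T => A).
Proof. by move=> i j; exact: measurable_cst. Qed.

Lemma random_mxD m n (X Y : T -> 'M[R]_(m, n)) :
  random_mx X -> random_mx Y -> random_mx (fun w => X w + Y w).
Proof.
move=> mX mY i j; rewrite [X in measurable_fun _ X](_ : _ = fun w => X w i j + Y w i j); last by apply/funext => w; rewrite mxE.
exact: measurable_funD.
Qed.

Lemma random_mxB m n (X Y : T -> 'M[R]_(m, n)) :
  random_mx X -> random_mx Y -> random_mx (fun w => X w - Y w).
Proof.
move=> mX mY i j; rewrite [X in measurable_fun _ X](_ : _ = fun w => X w i j - Y w i j); last by apply/funext => w; rewrite !mxE.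
exact: measurable_funB.
Qed.

Lemma random_mx_tr m n (X : T -> 'M[R]_(m, n)) :
  random_mx X -> random_mx (fun w => (X w)^T).
Proof.
move=> mX i j.
rewrite [X in measurable_fun _ X](_ : _ = fun w => X w j i); first exact: mX.
by apply/funext => w; rewrite mxE.
Qed.

Lemma random_mx_row m n (X : T -> 'M[R]_(m, n)) k :
  random_mx X -> random_mx (fun w => row k (X w)).
Proof.
move=> mX i j.
rewrite [X in measurable_fun _ X](_ : _ = fun w => X w k j); first exact: mX.
by apply/funext => w; rewrite mxE.
Qed.

Lemma random_mxM m n q (X : T -> 'M[R]_(m, n)) (Y : T -> 'M[R]_(n, q)) :
  random_mx X -> random_mx Y -> random_mx (fun w => X w *m Y w).
Proof.
move=> mX mY i j; rewrite [X in measurable_fun _ X](_ : _ = fun w => \sum_k X w i k * Y w k j); last by apply/funext => w; rewrite mxE.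
apply: measurable_sumr => k; exact: measurable_funM.
Qed.

Lemma random_mx_dotv n (X Y : T -> 'cV[R]_n) :
  random_mx X -> random_mx Y -> measurable_fun setT (fun w => dotv (X w) (Y w)).
Proof. by move=> mX mY; apply: random_mxM => //; exact: random_mx_tr. Qed.

Lemma random_mx_det n (X : T -> 'M[R]_n) :
  random_mx X -> measurable_fun setT (fun w => \det (X w)).
Proof.
move=> mX; rewrite /determinant.
apply: measurable_sumr => s; apply: measurable_funM => //.
exact: measurable_prodr.
Qed.

Lemma random_mx_inv n (X : T -> 'M[R]_n) :
  random_mx X -> random_mx (fun w => invmx (X w)).
Proof.
move=> mX i j; have mdet := random_mx_det mX.
rewrite [X in measurable_fun _ X](_ : _ = (fun w => if \det (X w) == 0 then X w i j
   else (\det (X w))^-1 * \adj (X w) i j)); last first.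
  apply/funext => w; rewrite /invmx unitmxE unitfE.
  by case: eqP => //= _; rewrite mxE.
have mb : measurable_fun setT (fun w => \det (X w) == 0).
  exact: measurable_fun_eqr.
apply: measurable_fun_ifT => //.
apply: measurable_funM.
  exact: (measurableT_comp (@measurable_invr R) mdet).
rewrite [X in measurable_fun _ X](_ : _ = fun w => cofactor (X w) j i); last by apply/funext => w; rewrite mxE.
rewrite /cofactor.
apply: measurable_funM => //; apply: random_mx_det => k l.
by rewrite [X in measurable_fun _ X](_ : _ = fun w => X w (lift j k) (lift i l)); [exact: mX|apply/funext => w; rewrite !mxE].
Qed.

Lemma mx_events_measurable m n (X : T -> 'M[R]_(m, n)) :
  random_mx X -> mx_events X `<=` measurable.
Proof.
move=> mX A [ij _ [B mB <-]]; exact: (mX ij.1 ij.2 measurableT B mB).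
Qed.

Lemma random_mx_events m n (X : T -> 'M[R]_(m, n)) (G : set_system T) :
  mx_events X `<=` <<s G >> -> random_mx (X : g_sigma_algebraType G -> _).
Proof.
move=> XG i j _ B mB; apply: XG; exists (i, j) => //; by exists B.
Qed.

Lemma mx_events_sub m n (X : T -> 'M[R]_(m, n)) (G : set_system T) :
  random_mx (X : g_sigma_algebraType G -> _) -> mx_events X `<=` <<s G >>.
Proof.
move=> mX A [ij _ [B mB <-]]; exact: (mX ij.1 ij.2 measurableT B mB).
Qed.

Lemma rv_events_measurable (Y : T -> R) :
  measurable_fun setT Y -> rv_events Y `<=` measurable.
Proof. by move=> mY A [B mB <-]; exact: mY. Qed.

End random_matrices.

Section same_cdf.
Context {R : realType}.

Lemma measure_unique_cdf (m1 m2 : {measure set R -> \bar R}) :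
  (m1 setT < +oo)%E -> m1 setT = m2 setT ->
  (forall x, m1 `]-oo, x] = m2 `]-oo, x]) ->
  forall A, measurable A -> m1 A = m2 A.
Proof.
move=> m1oo mT h A mA.
pose G : set_system R := [set A | exists x, A = `]x, +oo[%classic].
apply: (@probability_unique_pi _ _ _ m1 m2 G) => //.
- by move=> _ [x ->]; exact: measurable_itv.
- move=> _ _ [x ->] [y ->]; exists (Num.max x y).
  by apply/seteqP; split => z /=; rewrite !in_itv/= !andbT ?gt_max; [case=> -> ->|move/andP].
- move=> _ [x ->]; rewrite -setCitvl -!setTD !measureD//.
  + by rewrite !setTI; congr (_ - _)%E; [exact: mT|exact: h].
  + by move: m1oo; apply: le_lt_trans; rewrite le_eqVlt; apply/orP; left; apply/eqP; exact: esym mT.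
- have : (@ocitv R).-sigma.-measurable A by exact: mA.
  by rewrite RGenOInfty.measurableE.
Qed.

End same_cdf.

Section iid_errors.
Context {R : realType} {d : measure_display} {T : measurableType d}.
Context (P : probability T R) (eps : nat -> {RV P >-> R}) (F : R -> R).
Hypothesis iidE : forall n, iid (fun i : 'I_n => eps i) F.

Lemma random_error_vec n : random_mx (error_vec eps n).
Proof.
move=> i j.
rewrite [X in measurable_fun _ X](_ : _ = fun w => eps i w) //.
by apply/funext => w; rewrite mxE.
Qed.

Lemma error_independent n :
  independent P (mx_events (error_vec eps n)) (rv_events (eps n)).
Proof.
have [prodn _] := iidE n; have [prodS _] := iidE n.+1.
pose G := [set A | exists B : 'I_n -> set R, (forall i, measurable (B i)) /\
  A = \bigcap_(i in [set: 'I_n]) eps i @^-1` B i].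
have GM : G `<=` measurable.
  move=> _ [B [mB ->]]; apply: fin_bigcap_measurable => //.
  by move=> i _; exact: measurable_funPTI.
have fM : rv_events (eps n) `<=` measurable by exact: rv_events_measurable.
apply: (@independent_sub _ _ _ P G (rv_events (eps n))).
- move=> A [[i j] _ [C mC <-]]; apply: sub_sigma_algebra.
  exists (fun k => if k == i then C else setT); split.
    by move=> k; case: ifP.
  apply/seteqP; split => w /=.
    by move=> [_ +] k _ /=; rewrite mxE; case: eqP => [->|].
  by move=> /(_ i I)/=; rewrite eqxx mxE; split.
- exact: sub_sigma_algebra.
apply: independent_pi => //.
- move=> _ _ [B [mB ->]] [B' [mB' ->]].
  exists (fun i => B i `&` B' i); split; first by move=> i; exact: measurableI.
  by rewrite -bigcapI.
move=> _ C [B [mB ->]] sC.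
have [D mD <-] : rv_events (eps n) C.
  have sub : <<s rv_events (eps n) >> `<=` rv_events (eps n).
    apply: smallest_sub => //.
    exact/sigma_algebra_preimage/sigma_algebra_measurable.
  exact: sub.
rewrite setTI.
pose B' (i : 'I_n.+1) := if unlift ord_max i is Some j then B j else D.
have mB' i : measurable (B' i) by rewrite /B'; case: unliftP.
have BE (i : 'I_n) : B' (widen_ord (leqnSn n) i) = B i.
  rewrite /B' (_ : widen_ord _ i = lift ord_max i) ?liftK//.
  by apply: val_inj; rewrite /= /bump leqNgt ltn_ord.
have DE : B' ord_max = D by rewrite /B' unlift_none.
have := prodS B' mB'.
rewrite big_ord_recr/= DE.
rewrite (_ : \bigcap_(i in _) _ = \bigcap_(i in [set: 'I_n]) eps i @^-1` B i
    `&` eps n @^-1` D).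
  move=> ->; rewrite prodn//; congr (_ * _)%E.
  by apply: eq_bigr => i _; rewrite BE.
apply/seteqP; split => w.
  move=> h; split.
    by move=> i _; rewrite -BE; exact: (h (widen_ord (leqnSn n) i) I).
  by have := h ord_max I; rewrite DE.
move=> [h1 h2] i _; rewrite /B'; case: unliftP => [j ->|->//].
have := h1 j I; rewrite /= /bump leqNgt ltn_ord//.
Qed.

Lemma error_distribution n A : measurable A ->
  P (eps n @^-1` A) = P (eps 0%N @^-1` A).
Proof.
move=> mA.
have [_ cS] := iidE n.+1.
apply: (@measure_unique_cdf _ (distribution P (eps n)) (distribution P (eps 0%N))) => //.
- by apply: (le_lt_trans (probability_le1 (distribution P (eps n)) measurableT)); exact: ltry.
- by move=> x; apply: (etrans (cS ord_max x)); exact: esym (cS ord0 x).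
Qed.

Lemma ge0_integral_error n (f : R -> \bar R) : measurable_fun setT f ->
  (forall x, 0 <= f x)%E ->
  (\int[P]_w f (eps n w) = \int[P]_w f (eps 0%N w))%E.
Proof.
move=> mf f0.
rewrite -(@ge0_integral_distribution _ _ _ _ _ P (eps n) _ mf f0).
rewrite -(@ge0_integral_distribution _ _ _ _ _ P (eps 0%N) _ mf f0).
by apply: eq_measure_integral => A mA _; exact: error_distribution.
Qed.

Definition partial_sum (g : nat -> R -> R) n w := \sum_(k < n) g k (eps k w).

Lemma measurable_partial_sum g n : (forall k, measurable_fun setT (g k)) ->
  measurable_fun setT (partial_sum g n : g_sigma_algebraType (mx_events (error_vec eps n)) -> R).
Proof.
move=> mg; apply: measurable_sumr => k; apply: measurableT_comp => //.
have := @random_mx_events _ _ _ _ _ (error_vec eps n) _ (@sub_sigma_algebra _ _ _).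
move=> /(_ k ord0).
rewrite [X in measurable_fun _ X -> _](_ : _ = fun w => eps k w) //.
by apply/funext => w; rewrite mxE.
Qed.

Lemma sum_domination (g : nat -> R -> R) (phi : nat -> R -> R) (e : nat -> R) n :
  (forall k, measurable_fun setT (g k)) ->
  (forall k, measurable_fun setT (phi k)) ->
  (forall k x, 0 <= phi k x) -> (forall k, 0 <= e k) ->
  (forall k a, (k < n)%N ->
    \int[P]_w (phi k.+1 (a + g k (eps k w)))%:E <= (phi k a + e k)%:E)%E ->
  (\int[P]_w (phi n (partial_sum g n w))%:E <=
    (phi 0%N 0 + \sum_(k < n) e k)%:E)%E.
Proof.
move=> mg mphi phi0 e0 step.
elim: {-2}n (leqnn n) => [_|m ih mn].
  rewrite big_ord0 addr0 (eq_integral (cst (phi 0%N 0)%:E)) => [|w _].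
    by rewrite integral_cst//= probability_setT mule1.
  by rewrite /partial_sum big_ord0.
have EM : mx_events (error_vec eps m) `<=` measurable.
  exact/mx_events_measurable/random_error_vec.
have mS := g_sigma_measurableT EM (@measurable_partial_sum g m mg).
pose S : {mfun T >-> R} := mfun_Sub (mem_set mS).
have ind A B : measurable A -> measurable B ->
    (P (S @^-1` A `&` eps m @^-1` B) = P (S @^-1` A) * P (eps m @^-1` B))%E.
  move=> mA mB; apply: error_independent.
    have := @measurable_partial_sum g m mg measurableT _ mA; rewrite setTI; exact.
  by apply: sub_sigma_algebra; exists B => //; rewrite setTI.
pose f (z : R * R) := (phi m.+1 (z.1 + g m z.2))%:E.
have mf : measurable_fun setT f.
  apply/measurable_EFinP; apply: measurableT_comp => //.
  by apply: measurable_funD => //; exact: measurableT_comp.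
have f0 z : (0 <= f z)%E by rewrite lee_fin.
rewrite (eq_integral (fun w => f (S w, eps m w))); last first.
  by move=> w _; rewrite /f /= /partial_sum big_ord_recr.
rewrite (ge0_integral_independent ind mf f0).
apply: (@le_trans _ _ (\int[P]_w ((phi m (S w))%:E + (e m)%:E))%E).
  apply: ge0_le_integral => //.
  - by move=> w _; exact: integral_ge0.
  - exact: (measurableT_comp (measurable_integral_frozen P (eps m) mf f0) mS).
  - by apply/measurable_EFinP; apply: measurable_funD => //; exact: measurableT_comp.
  - by move=> w _; exact: step.
rewrite ge0_integralD//; first last.
- by move=> w _; rewrite lee_fin.
- by apply/measurable_EFinP; apply: measurableT_comp.
- by move=> w _; rewrite lee_fin.
rewrite (@integral_cst _ _ _ P _ measurableT (e m)%:E)//= probability_setT mule1.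
rewrite big_ord_recr/= addrA [X in (_ <= X)%E]EFinD leeD2r//.
exact: (ih (ltnW mn)).
Qed.

End iid_errors.

Section error_moments.
Context {R : realType} {d : measure_display} {T : measurableType d}.
Context (P : probability T R) (eps : nat -> {RV P >-> R}) (epsf : {RV P >-> R}).
Context (F : R -> R) (sigma : R).
Hypothesis iidE : forall n, iid (fun i : 'I_n => eps i) F.
Hypothesis varE : ('V_P[eps 0%N] = (sigma ^+ 2)%R%:E)%E.
Hypothesis meanE : ('E_P[eps 0%N] = 0)%E.
Hypothesis fourthE : ('E_P[fun w => (`|eps 0%N w| ^+ 4)%R] < +oo)%E.

Implicit Types f g : R -> R.

Definition quartic_growth (f : R -> R) :=
  measurable_fun setT f /\ exists C, forall x, `|f x| <= C * (1 + x ^+ 4).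

Definition error_mean (f : R -> R) : R := \int[P]_w f (eps 0%N w).

Lemma quartic_growth_integrable f : quartic_growth f ->
  P.-integrable setT (EFin \o (fun w => f (eps 0%N w))).
Proof.
move=> [mf [C fC]].
have m4 : measurable_fun setT (fun w => `|eps 0%N w| ^+ 4).
  by apply: measurable_funX; exact: measurableT_comp.
have i4 : P.-integrable setT (EFin \o (fun w => `|eps 0%N w| ^+ 4)).
  apply/integrableP; split; first exact/measurable_EFinP.
  move: fourthE; rewrite unlock; apply: le_lt_trans.
  rewrite le_eqVlt; apply/orP; left; apply/eqP; apply: eq_integral => w _ /=.
  by rewrite normrX normr_id.
have iC : P.-integrable setT (EFin \o (fun w => C * (1 + `|eps 0%N w| ^+ 4))).
  rewrite (_ : _ \o _ = fun w => C%:E * (1%:E + (`|eps 0%N w| ^+ 4)%:E))%E //.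
  apply: integrableZl => //; apply: integrableD => //.
  by apply: finite_measure_integrable_cst.
apply: (le_integrable _ _ _ iC) => //.
  by apply/measurable_EFinP; exact: measurableT_comp.
move=> w _ /=; rewrite lee_fin.
apply: (le_trans (fC _)); rewrite -[X in _ * (_ + X) <= _]ger0_norm ?exprn_even_ge0//.
by rewrite normrX ler_norm.
Qed.

Lemma quartic_growthD f g : quartic_growth f -> quartic_growth g ->
  quartic_growth (fun x => f x + g x).
Proof.
move=> [mf [C fC]] [mg [D gD]]; split; first exact: measurable_funD.
exists (C + D) => x; rewrite mulrDl (le_trans (ler_normD _ _))// lerD//.
Qed.

Lemma quartic_growthZ a f : quartic_growth f -> quartic_growth (fun x => a * f x).
Proof.
move=> [mf [C fC]]; split; first exact: measurable_funM.
by exists (`|a| * C) => x; rewrite normrM -mulrA ler_wpM2l.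
Qed.

Lemma quartic_growth_bounded f C : measurable_fun setT f ->
  (forall x, `|f x| <= C) -> quartic_growth f.
Proof.
move=> mf fC; split => //; exists C => x.
have x4 : 0 <= x ^+ 4 by rewrite exprn_even_ge0.
have C0 : 0 <= C by apply: le_trans (fC 0).
by rewrite (le_trans (fC x))// ler_peMr// lerDl.
Qed.

Lemma quartic_growth_cst a : quartic_growth (fun=> a).
Proof. by apply: (@quartic_growth_bounded _ `|a|) => //; exact: measurable_cst. Qed.

Lemma quartic_growth_le f g : measurable_fun setT f -> quartic_growth g ->
  (forall x, `|f x| <= `|g x|) -> quartic_growth f.
Proof.
move=> mf [_ [C gC]] fg; split => //; exists C => x.
exact: le_trans (fg x) (gC x).
Qed.

Lemma norm_le_sqr1 (x : R) : `|x| <= 1 + x ^+ 2.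
Proof.
rewrite ler_norml; apply/andP; split.
  by have := sqr_ge0 (x + 1); nra.
by have := sqr_ge0 (x - 1); nra.
Qed.

Lemma quartic_growth_sqr : quartic_growth (fun x => x ^+ 2).
Proof.
split; first by apply: measurable_funX.
exists 1 => x; rewrite mul1r ger0_norm ?sqr_ge0//.
have := norm_le_sqr1 (x ^+ 2); rewrite ger0_norm ?sqr_ge0//.
by rewrite -exprM.
Qed.

Lemma quartic_growth_id : quartic_growth id.
Proof.
apply: (@quartic_growth_le _ (fun x => 1 + x ^+ 2)); first exact: measurable_id.
  exact: quartic_growthD (quartic_growth_cst _) quartic_growth_sqr.
by move=> x; rewrite (le_trans (norm_le_sqr1 x))// ler_norm.
Qed.

Lemma quartic_growth_cube : quartic_growth (fun x => `|x| ^+ 3).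
Proof.
split; first by apply: measurable_funX; exact: normr_measurable.
exists 1 => x; rewrite mul1r normrX normr_id.
have -> : x ^+ 4 = `|x| ^+ 4 by rewrite -normrX ger0_norm// exprn_even_ge0.
have : 0 <= `|x| by [].
set y := `|x| => y0.
have [y1|/ltW y1] := leP y 1.
  apply: (@le_trans _ _ 1); first exact: exprn_ile1.
  by rewrite lerDl exprn_ge0.
by apply: (@le_trans _ _ (y ^+ 4)); [exact: ler_weXn2l|rewrite lerDr].
Qed.

Lemma measurable_ind_le (c : R) : measurable_fun setT (fun x : R => (x <= c)%R%:R : R).
Proof.
rewrite [X in measurable_fun _ X](_ : _ = fun x => if x <= c then 1 else 0).
  by apply: measurable_fun_ifT => //; exact: measurable_fun_ler.
by apply/funext => x; case: ifP.
Qed.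

Lemma quartic_growth_ind c : quartic_growth (fun x : R => (x <= c)%R%:R : R).
Proof.
apply: (@quartic_growth_bounded _ 1); first exact: measurable_ind_le.
by move=> x; case: (x <= c); rewrite ?normr1 ?normr0.
Qed.

Lemma quartic_growth_mulind c : quartic_growth (fun x : R => x * (x <= c)%R%:R).
Proof.
apply: (quartic_growth_le _ quartic_growth_id).
  by apply: measurable_funM => //; exact: measurable_ind_le.
by move=> x; case: (x <= c); rewrite ?mulr1 ?mulr0 ?normr0.
Qed.

Lemma error_meanD f g : quartic_growth f -> quartic_growth g ->
  error_mean (fun x => f x + g x) = error_mean f + error_mean g.
Proof.
by move=> hf hg; rewrite /error_mean RintegralD//; exact: quartic_growth_integrable.
Qed.

Lemma error_meanZ a f : quartic_growth f ->
  error_mean (fun x => a * f x) = a * error_mean f.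
Proof.
by move=> hf; rewrite /error_mean RintegralZl//; exact: quartic_growth_integrable.
Qed.

Lemma error_mean_cst a : error_mean (fun=> a) = a.
Proof.
by rewrite /error_mean Rintegral_cst//= probability_setT mulr1.
Qed.

Lemma error_mean_le f g : quartic_growth f -> quartic_growth g ->
  (forall x, f x <= g x) -> error_mean f <= error_mean g.
Proof.
by move=> hf hg fg; apply: le_Rintegral => //; exact: quartic_growth_integrable.
Qed.

Lemma error_mean_ge0 f : (forall x, 0 <= f x) -> 0 <= error_mean f.
Proof. by move=> f0; apply: Rintegral_ge0. Qed.

Lemma error_mean_id : error_mean id = 0.
Proof.
rewrite /error_mean /Rintegral; have := meanE; rewrite unlock.
by move=> ->.
Qed.

Lemma error_mean_sqr : error_mean (fun x => x ^+ 2) = sigma ^+ 2.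
Proof.
rewrite /error_mean /Rintegral; have := varE; rewrite /variance unlock meanE/=.
rewrite unlock => E.
rewrite (_ : (\int[P]_x _)%E = (sigma ^+ 2)%:E)// -E.
by apply: eq_integral => w _ /=; rewrite !fctE/= !subr0 expr2.
Qed.

Lemma error_mean_ind c : error_mean (fun x : R => (x <= c)%R%:R) = F c.
Proof.
rewrite /error_mean /Rintegral.
have [_ /(_ ord0 c)] := iidE 1; rewrite /cdf /= => E.
rewrite (_ : (\int[P]_x _)%E = (F c)%:E)// -E.
rewrite /distribution /pushforward -[X in P X]setIT -integral_indic//=; last first.
  exact: measurable_funPTI.
apply: eq_integral => w _ /=; rewrite indicE; congr (_%:R)%:E.
case: (boolP (eps 0%N w <= c)) => h; first by rewrite mem_set//= in_itv.
by rewrite memNset//= in_itv/=; exact/negP.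
Qed.

Lemma error_mean_mulind c :
  error_mean (fun x : R => x * (x <= c)%R%:R) = trunc_mean eps c.
Proof.
rewrite /error_mean /Rintegral /trunc_mean unlock; congr fine.
apply: eq_integral => w _; congr (_ * _)%:E; rewrite indicE; congr (_%:R).
by case: (boolP (eps 0%N w <= c)) => h; [rewrite mem_set|rewrite memNset//=; exact/negP].
Qed.

Lemma error_integral_le k f g r : measurable_fun setT f ->
  (forall x, 0 <= f x) -> quartic_growth g -> (forall x, f x <= g x) ->
  error_mean g <= r -> (\int[P]_w (f (eps k w))%:E <= r%:E)%E.
Proof.
move=> mf f0 hg fg gr.
rewrite (ge0_integral_error iidE k (f := EFin \o f)); last 2 first.
- exact/measurable_EFinP.
- by move=> x; rewrite lee_fin.
have hf : quartic_growth f.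
  apply: quartic_growth_le hg _ => // x; rewrite ger0_norm//.
  by rewrite (le_trans (fg x))// ler_norm.
rewrite -[leLHS]fineK; last first.
  exact: integrable_fin_num (quartic_growth_integrable hf).
by rewrite lee_fin (le_trans _ gr)//; exact: error_mean_le.
Qed.

Lemma cdfF_ge0 x : 0 <= F x.
Proof. by rewrite -error_mean_ind; exact: error_mean_ge0. Qed.

Lemma cdfF_le1 x : F x <= 1.
Proof.
rewrite -error_mean_ind -[leRHS](error_mean_cst 1).
apply: error_mean_le => [||y]; [exact: quartic_growth_ind|exact: quartic_growth_cst|].
by case: (y <= x).
Qed.

Lemma cdfF_nondecreasing x y : x <= y -> F x <= F y.
Proof.
move=> xy; rewrite -!error_mean_ind.
apply: error_mean_le => [||z]; [exact: quartic_growth_ind..|].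
by case: (leP z x) => // zx; rewrite (le_trans zx xy).
Qed.

End error_moments.

Section taylor.
Context {R : realType}.
Implicit Types (f df ddf : R -> R) (x y : R).

Lemma mvt_between f df x y : (forall z, `|z - x| <= `|y - x| -> is_derive z 1 f (df z)) ->
  exists2 c, `|c - x| <= `|y - x| & f y - f x = df c * (y - x).
Proof.
move=> fd.
have der z : `|z - x| <= `|y - x| -> {for z, continuous f}.
  by move=> /fd h; apply/differentiable_continuous/derivable1_diffP; case: h.
have [xy|yx|->] := ltgtP x y; last first.
- by exists y => //; rewrite !subrr mulr0.
- have ok z : z \in `[y, x]%R -> `|z - x| <= `|y - x|.
    rewrite in_itv/= => /andP[yz zx].
    by rewrite !ler0_norm ?subr_le0 ?(ltW yx)// lerN2 lerB.
  have [||c cyx E] := @MVT _ f df y x yx.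
  + by move=> z zI; apply: fd; apply: ok; exact: subset_itv_oo_cc.
  + apply: continuous_in_subspaceT => z /set_mem zI; exact/der/ok.
  exists c; first by apply: ok; exact: subset_itv_oo_cc.
  by rewrite -opprB E -mulrN opprB.
- have ok z : z \in `[x, y]%R -> `|z - x| <= `|y - x|.
    rewrite in_itv/= => /andP[yz zx].
    by rewrite !ger0_norm ?subr_ge0 ?(ltW xy)// lerB.
  have [||c cyx E] := @MVT _ f df x y xy.
  + by move=> z zI; apply: fd; apply: ok; exact: subset_itv_oo_cc.
  + apply: continuous_in_subspaceT => z /set_mem zI; exact/der/ok.
  by exists c => //; apply: ok; exact: subset_itv_oo_cc.
Qed.

Lemma lipschitz_of_derive f df x y K :
  (forall z, `|z - x| <= `|y - x| -> is_derive z 1 f (df z)) ->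
  (forall z, `|z - x| <= `|y - x| -> `|df z| <= K) ->
  `|f y - f x| <= K * `|y - x|.
Proof.
move=> fd dfK; have [c cx ->] := mvt_between fd.
by rewrite normrM ler_wpM2r// dfK.
Qed.

Lemma taylor_order1 f df x y K :
  (forall z, `|z - x| <= `|y - x| -> is_derive z 1 f (df z)) ->
  (forall z, `|z - x| <= `|y - x| -> `|df z - df x| <= K * `|z - x|) ->
  `|f y - f x - df x * (y - x)| <= K * `|y - x| ^+ 2.
Proof.
move=> fd dfK; have [c cx ->] := mvt_between fd.
have K0 : 0 <= K * `|y - x| by apply: le_trans (dfK y (lexx _)).
rewrite -mulrBl normrM expr2 mulrA ler_wpM2r// (le_trans (dfK _ cx))//.
have [e|yx] := eqVneq y x.
  by move: cx; rewrite e subrr normr0 normr_le0 => /eqP ->; rewrite normr0.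
by rewrite ler_wpM2l//; move: K0; rewrite pmulr_lge0// normr_gt0 subr_eq0.
Qed.

Lemma taylor_order2 f df ddf x y K :
  (forall z, `|z - x| <= `|y - x| -> is_derive z 1 f (df z)) ->
  (forall z, `|z - x| <= `|y - x| -> is_derive z 1 df (ddf z)) ->
  (forall z, `|z - x| <= `|y - x| -> `|ddf z - ddf x| <= K * `|z - x|) ->
  `|f y - f x - df x * (y - x) - ddf x / 2 * (y - x) ^+ 2| <= K * `|y - x| ^+ 3.
Proof.
move=> fd dfd ddfK.
pose h z := f z - df x * (z - x) - ddf x / 2 * (z - x) ^+ 2.
pose dh z := df z - df x - ddf x * (z - x).
have hd z : `|z - x| <= `|y - x| -> is_derive z 1 h (dh z).
  move=> zx; have fdz := fd z zx; rewrite /h /dh.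
  apply: is_derive_eq.
  by rewrite /GRing.scale/=; field.
have K0 : 0 <= K * `|y - x| by apply: le_trans (ddfK y (lexx _)).
have dhK z : `|z - x| <= `|y - x| -> `|dh z| <= K * `|y - x| ^+ 2.
  move=> zx.
  apply: (@le_trans _ _ (K * `|z - x| ^+ 2)).
    apply: taylor_order1 => t tz; [apply: dfd|apply: ddfK]; exact: le_trans tz zx.
  have [e|yx] := eqVneq y x.
    by move: zx; rewrite e subrr normr0 normr_le0 => /eqP ->; rewrite normr0.
  have K0' : 0 <= K by move: K0; rewrite pmulr_lge0// normr_gt0 subr_eq0.
  by rewrite ler_wpM2l// ler_pXn2r// nnegrE.
have := lipschitz_of_derive hd dhK.
rewrite (_ : h y - h x = f y - f x - df x * (y - x) - ddf x / 2 * (y - x) ^+ 2).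
  by rewrite (_ : K * _ * _ = K * `|y - x| ^+ 3)//; ring.
rewrite /h; ring.
Qed.

End taylor.

Section gauss_primitive.
Context {R : realType}.
Local Notation mu := (@lebesgue_measure R).
Implicit Types z k m : R.

Definition gauss_primitive z : R := \int[mu]_(t in `]-oo, z]) gauss_fun t.

Lemma gauss_fun_N z : gauss_fun (- z) = gauss_fun z.
Proof. by rewrite /gauss_fun sqrrN. Qed.

Lemma integrable_gauss (i : interval R) : mu.-integrable [set` i] (EFin \o gauss_fun).
Proof. by apply: integrableS integrableT_gauss. Qed.

Lemma is_derive_gauss_primitive z : is_derive z 1 gauss_primitive (gauss_fun z).
Proof.
have [dP PE] : derivable gauss_primitive z 1 /\ gauss_primitive^`() z = gauss_fun z.
  apply: (@continuous_FTC1 R gauss_fun -oo%O z (z + 1)).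
  - by rewrite ltrDl.
  - exact: integrable_gauss.
  - by rewrite ltNyr.
  - exact: continuous_gauss_fun.
by apply: DeriveDef; [exact: dP|rewrite -derive1E; exact: PE].
Qed.

Lemma is_derive_gauss_fun z : is_derive z 1 gauss_fun (- (2 * z * gauss_fun z)).
Proof.
rewrite /gauss_fun; apply: is_derive_eq.
by rewrite /GRing.scale/=; ring.
Qed.

Lemma gauss_primitive0 : gauss_primitive 0 = Num.sqrt pi / 2.
Proof.
rewrite /gauss_primitive /Rintegral.
have := @integralT_gauss R.
rewrite -(setUv (`]-oo, 0%R] : set R)) setCitvl integral_setU//=; last 2 first.
- by apply/measurable_EFinP/measurable_funTS; exact: measurable_gauss_fun.
- exact: disjoint_rays.
rewrite integral_itv_obnd_cbnd; last first.
  by apply/measurable_EFinP/measurable_funTS; exact: measurable_gauss_fun.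
rewrite integral0y_gauss.
have fn : ((\int[mu]_(x in `]-oo, 0%R]) (gauss_fun x)%:E)%E) \is a fin_num.
  by apply: integrable_fin_num; [exact: measurable_itv|exact: integrable_gauss].
move: fn.
by case: (integral _ _ _) => //= r _ [] E; lra.
Qed.

Lemma gauss_primitive_refl z : gauss_primitive z + gauss_primitive (- z) = Num.sqrt pi.
Proof.
pose f z := gauss_primitive z + gauss_primitive (- z).
have fd x : is_derive x (1 : R) f 0.
  have d1 := is_derive_gauss_primitive x.
  have d2 := is_derive_gauss_primitive (- x).
  have d3 : is_derive x (1 : R) (fun y : R => gauss_primitive (- y)) (- gauss_fun x).
    have d4 : is_derive x (1 : R) (fun y : R => - y) (-1) by apply: is_derive_eq.
    have h := @is_derive1_comp R gauss_primitive (fun y : R => - y) x _ _ d2 d4.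
    by apply: is_derive_eq h _; rewrite gauss_fun_N mulrN1.
  apply: is_derive_eq; exact: subrr.
have := is_derive_0_is_cst z 0 fd.
by rewrite /f oppr0 gauss_primitive0 -splitr.
Qed.

Lemma gauss_primitive_ge0 z : 0 <= gauss_primitive z.
Proof. by apply: Rintegral_ge0 => t _; exact: gauss_fun_ge0. Qed.

Lemma gauss_primitive_le z : gauss_primitive z <= Num.sqrt pi.
Proof. by rewrite -(gauss_primitive_refl z) lerDl gauss_primitive_ge0. Qed.

Lemma gauss_primitive_nondecreasing x y : x <= y -> gauss_primitive x <= gauss_primitive y.
Proof.
move=> xy.
have [||c _ E] := @MVT_segment R gauss_primitive gauss_fun x y xy.
- by move=> z _; exact: is_derive_gauss_primitive.
- apply: continuous_subspaceT => z.
  by apply/differentiable_continuous/derivable1_diffP; have [] := is_derive_gauss_primitive z.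
- by rewrite -subr_ge0 E mulr_ge0 ?gauss_fun_ge0// subr_ge0.
Qed.

Lemma gauss_primitive_near_total (e : R) : 0 < e ->
  exists2 z, 0 < z & Num.sqrt pi - e <= gauss_primitive z.
Proof.
move=> e0.
have : (\int[mu]_(x in `]-oo, n%:R]) (gauss_fun x)%:E @[n --> \oo] -->
   (Num.sqrt (pi : R))%:E)%E.
  rewrite -integralT_gauss (_ : [set: R] = \bigcup_n `]-oo, n%:R]%classic); last first.
    apply/seteqP; split => // x _; exists (Num.truncn x).+1 => //=.
    by rewrite in_itv/= ltW// truncnS_gt.
  apply: ge0_nondecreasing_set_cvg_integral => //.
  - move=> n m nm; apply/subsetPset; apply: subset_itvl.
    by rewrite bnd_simp ler_nat.
  - by move=> n; apply/measurable_EFinP/measurable_funTS; exact: measurable_gauss_fun.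
  - by move=> n x _; rewrite lee_fin gauss_fun_ge0.
move=> /fine_cvg /cvgrPdist_le /(_ e e0) [N _ /(_ N.+1 (leqnSn N))] /=.
rewrite -/(Rintegral _ _ _) -/(gauss_primitive _) => /ler_distlBl h.
by exists N.+1%:R => //; rewrite lerBlDr.
Qed.

End gauss_primitive.

Section heat_step.
Context {R : realType}.
Implicit Types z k m x : R.
Local Notation Psi := (@gauss_primitive R).
Local Notation phi := (@gauss_fun R).

Lemma gauss_fun_decay z : (1 + z ^+ 2 + z ^+ 4 / 4) * phi z <= 1.
Proof.
have E : phi z = (expR (z ^+ 2 / 2) ^+ 2)^-1.
  by rewrite /gauss_fun expRN -expRM_natr; congr (expR _)^-1; field.
have h : 1 + z ^+ 2 / 2 <= expR (z ^+ 2 / 2) by exact: expR_ge1Dx.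
have z2 := sqr_ge0 z.
have p : 0 < expR (z ^+ 2 / 2) ^+ 2 by rewrite exprn_gt0// expR_gt0.
rewrite E ler_pdivrMr// mul1r.
rewrite (_ : _ + _ = (1 + z ^+ 2 / 2) ^+ 2); last by field.
by rewrite ler_pXn2r// nnegrE ?expR_ge0//; lra.
Qed.

Lemma norm_mul_gauss_le z : `|z * phi z| <= 1.
Proof.
have := gauss_fun_decay z; have p := gauss_fun_ge0 z.
rewrite normrM (ger0_norm p) => h.
apply: le_trans h; rewrite ler_wpM2r//.
by apply: (le_trans (norm_le_sqr1 z)); rewrite lerDl mulr_ge0// exprn_even_ge0.
Qed.

Lemma norm_sqr_gauss_le z : z ^+ 2 * phi z <= 1.
Proof.
have := gauss_fun_decay z; have p := gauss_fun_ge0 z; move=> h.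
apply: le_trans h; rewrite ler_wpM2r//.
have : 0 <= z ^+ 4 by rewrite exprn_even_ge0.
have := sqr_ge0 z; lra.
Qed.

Lemma norm_cube_gauss_le z : `|z ^+ 3 * phi z| <= 4.
Proof.
have := gauss_fun_decay z; have p := gauss_fun_ge0 z.
rewrite normrM (ger0_norm p) => h.
apply: (@le_trans _ _ (4 * ((1 + z ^+ 2 + z ^+ 4 / 4) * phi z))); last by lra.
rewrite mulrA ler_wpM2r// normrX.
have -> : z ^+ 4 = `|z| ^+ 4 by rewrite -normrX ger0_norm// exprn_even_ge0.
have -> : z ^+ 2 = `|z| ^+ 2 by rewrite -normrX ger0_norm// sqr_ge0.
have y0 : 0 <= `|z| by []; set y := `|z| in y0 *.
have := sqr_ge0 (y ^+ 2 - y); have := sqr_ge0 y.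
rewrite (_ : y ^+ 2 - y = y * (y - 1)); last by ring.
rewrite exprMn; nra.
Qed.

Lemma is_derive_mul_gauss z :
  is_derive z 1 (fun z => - (2 * z * phi z)) ((4 * z ^+ 2 - 2) * phi z).
Proof.
have h := is_derive_gauss_fun z.
apply: is_derive_eq; rewrite /GRing.scale/=; ring.
Qed.

Lemma gauss_primitive_taylor z k :
  `|Psi (z + k) - Psi z - phi z * k + z * phi z * k ^+ 2| <= 6 * `|k| ^+ 3.
Proof.
have := @taylor_order2 R Psi phi (fun z => - (2 * z * phi z)) z (z + k) 6.
rewrite (_ : z + k - z = k); last by ring.
rewrite (_ : _ - - (2 * z * phi z) / 2 * k ^+ 2 =
  Psi (z + k) - Psi z - phi z * k + z * phi z * k ^+ 2); last by field.
apply=> [t _|t _|t tk]; [exact: is_derive_gauss_primitive|exact: is_derive_gauss_fun|].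
apply: (@lipschitz_of_derive R (fun z => - (2 * z * phi z))
  (fun z => (4 * z ^+ 2 - 2) * phi z)) => [u _|u _].
  exact: is_derive_mul_gauss.
have := norm_sqr_gauss_le u; have := gauss_fun_ge0 u; have := gauss_fun_le1 u.
have := sqr_ge0 u.
rewrite ler_norml => *; apply/andP; split; nra.
Qed.

(** time step of the heat flow *)
Lemma gauss_primitive_dilate z m (r : R) : 0 <= m <= 1 -> 0 < r ->
  r ^+ 2 * (1 + m) = 1 ->
  `|Psi (z * r) - Psi z + z * phi z * (m / 2)| <= 5 * m ^+ 2.
Proof.
move=> /andP[m0 m1] r0 rm.
have r1 : r <= 1.
  by rewrite -(@ler_pXn2r _ 2)// ?nnegrE ?(ltW r0)// expr1n; nra.
have rl : 1 - m / 2 <= r.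
  rewrite leNgt; apply/negP => h.
  have : r ^+ 2 < (1 - m / 2) ^+ 2 by rewrite ltr_pXn2r// nnegrE ?(ltW r0)//; lra.
  move=> h2.
  have : (1 - m / 2) ^+ 2 * (1 + m) <= 1 by rewrite -subr_ge0 (_ : _ - _ = m ^+ 2 * (3 - m) / 4); [rewrite divr_ge0// mulr_ge0 ?sqr_ge0//; lra|field].
  nra.
have ru : r <= 1 - m / 2 + m ^+ 2 / 2.
  rewrite leNgt; apply/negP => h.
  set q := (X in X < r) in h.
  have q0 : 0 <= q by rewrite /q; have := sqr_ge0 m; lra.
  have h2 : q ^+ 2 < r ^+ 2 by rewrite ltr_pXn2r// nnegrE ?(ltW r0).
  have : 1 <= q ^+ 2 * (1 + m).
    rewrite -subr_ge0 (_ : _ - _ = m ^+ 2 * (1 + 3 * m - m ^+ 2 + m ^+ 3) / 4); last by rewrite /q; field.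
    rewrite divr_ge0// mulr_ge0 ?sqr_ge0//.
    have : 0 <= m ^+ 3 by rewrite exprn_ge0.
    nra.
  nra.
have t1 : `|Psi (z * r) - Psi z - z * phi z * (r - 1)| <= 16 * `|r - 1| ^+ 2.
  have := @taylor_order1 R (fun s => Psi (z * s)) (fun s => z * phi (z * s)) 1 r 16.
  rewrite !mulr1; apply.
    move=> s _.
    have d1 : is_derive s (1 : R) (fun s => z * s) z.
      by apply: is_derive_eq; rewrite /GRing.scale/= mulr1.
    have h := is_derive1_comp (is_derive_gauss_primitive (z * s)) d1.
    by apply: is_derive_eq h _; rewrite mulrC.
  move=> t tr.
  have := @lipschitz_of_derive R (fun s => z * phi (z * s)) (fun s => - (2 * z ^+ 3 * s * phi (z * s))) 1 t 16.
  rewrite !mulr1; apply.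
    move=> s _.
    have d1 : is_derive s (1 : R) (fun s => z * s) z.
      by apply: is_derive_eq; rewrite /GRing.scale/= mulr1.
    have h := is_derive1_comp (is_derive_gauss_fun (z * s)) d1.
    have h2 : is_derive s 1 (fun s => z * phi (z * s)) (z * (- (2 * (z * s) * phi (z * s)) * z)).
      by apply: is_derive_eq.
    by apply: is_derive_eq h2 _; ring.
  move=> s st.
  have s2 : r <= s.
    have : `|s - 1| <= 1 - r.
      by rewrite (le_trans st)// (le_trans tr)// ler0_norm ?opprB// subr_le0.
    rewrite ler_norml => /andP[? ?]; lra.
  have sp : 0 < s by lra.
  rewrite (_ : - _ = - (2 / s ^+ 2) * ((z * s) ^+ 3 * phi (z * s))); last first.
    by field; rewrite gt_eqF.
  have s20 : 0 <= 2 / s ^+ 2 by rewrite divr_ge0 ?sqr_ge0.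
  rewrite normrM normrN (ger0_norm s20).
  apply: (@le_trans _ _ (2 / s ^+ 2 * 4)).
    by apply: ler_wpM2l => //; exact: norm_cube_gauss_le.
  rewrite mulrAC ler_pdivrMr ?exprn_gt0//.
  have : r ^+ 2 <= s ^+ 2 by rewrite ler_pXn2r// nnegrE ltW.
  by have := sqr_ge0 r; nra.
have rr : `|r - 1| <= m / 2 by rewrite ler0_norm ?subr_le0//; lra.
have t2 : 16 * `|r - 1| ^+ 2 <= 4 * m ^+ 2.
  have : `|r - 1| ^+ 2 <= (m / 2) ^+ 2 by rewrite ler_pXn2r// nnegrE//; lra.
  by rewrite expr_div_n; lra.
rewrite (_ : _ + _ = (Psi (z * r) - Psi z - z * phi z * (r - 1)) + z * phi z * (r - 1 + m / 2)); last by ring.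
apply: (le_trans (ler_normD _ _)).
apply: (@le_trans _ _ (4 * m ^+ 2 + 1 * (m ^+ 2 / 2))).
  rewrite lerD ?(le_trans t1 t2)// normrM ler_pM ?norm_mul_gauss_le//.
  by rewrite ger0_norm; lra.
have := sqr_ge0 m; lra.
Qed.

End heat_step.

Section central_limit.
Context {R : realType} {d : measure_display} {T : measurableType d}.
Context (P : probability T R) (eps : nat -> {RV P >-> R}) (F : R -> R).
Hypothesis iidE : forall n, iid (fun i : 'I_n => eps i) F.
Hypothesis fourthE : ('E_P[fun w => (`|eps 0%N w| ^+ 4)%R] < +oo)%E.
Local Notation Psi := (@gauss_primitive R).
Local Notation phi := (@gauss_fun R).

Definition standardized_summand (g : R -> R) (v m3 : R) :=
  [/\ quartic_growth g, quartic_growth (fun x => g x ^+ 2),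
      quartic_growth (fun x => `|g x| ^+ 3) &
      [/\ error_mean eps g = 0, error_mean eps (fun x => g x ^+ 2) = v &
      error_mean eps (fun x => `|g x| ^+ 3) <= m3]].

Lemma measurable_gauss_primitive : measurable_fun setT Psi.
Proof.
apply: nondecreasing_measurable => //.
by move=> x y; exact: gauss_primitive_nondecreasing.
Qed.

Lemma lindeberg_step (g : R -> R) (v m3 tau y : R) (k : nat) :
  standardized_summand g v m3 -> 0 < tau -> 0 <= v -> v <= tau ->
  (\int[P]_w (Psi ((y + g (eps k w)) / Num.sqrt (2 * tau)))%:E <=
   (Psi (y / Num.sqrt (2 * (tau + v))) + (5 * (v / tau) ^+ 2
     + 6 * m3 / Num.sqrt (2 * tau) ^+ 3))%:E)%E.
Proof.
move=> [gq gq2 gq3 [g1 g2 g3]] tau0 v0 vtau.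
set s1 := Num.sqrt (2 * tau); set s0 := Num.sqrt (2 * (tau + v)).
have s1p : 0 < s1 by rewrite sqrtr_gt0; lra.
have s0p : 0 < s0 by rewrite sqrtr_gt0; lra.
have s1E : s1 ^+ 2 = 2 * tau by rewrite sqr_sqrtr//; lra.
have s0E : s0 ^+ 2 = 2 * (tau + v) by rewrite sqr_sqrtr//; lra.
pose z := y / s1; pose r := s1 / s0.
have zr : z * r = y / s0 by rewrite /z /r; field; rewrite !gt_eqF.
pose G x := (Psi z + (phi z / s1) * g x) + ((- (z * phi z) / s1 ^+ 2) * g x ^+ 2
  + (6 / s1 ^+ 3) * `|g x| ^+ 3).
have Gq1 : quartic_growth (fun x => Psi z + (phi z / s1) * g x).
  by apply: quartic_growthD; [exact: quartic_growth_cst|exact: quartic_growthZ].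
have Gq2 : quartic_growth (fun x => (- (z * phi z) / s1 ^+ 2) * g x ^+ 2
  + (6 / s1 ^+ 3) * `|g x| ^+ 3).
  by apply: quartic_growthD; exact: quartic_growthZ.
apply: (@error_integral_le _ _ _ P eps F iidE fourthE k (fun x => Psi ((y + g x) / s1)) G).
- apply: measurableT_comp; first exact: measurable_gauss_primitive.
  apply: measurable_funM => //; apply: measurable_funD => //.
  by case: gq.
- by move=> x; exact: gauss_primitive_ge0.
- exact: quartic_growthD.
- move=> x; rewrite mulrDl -/z.
  have := le_trans (ler_norm _) (gauss_primitive_taylor z (g x / s1)).
  rewrite normf_div (gtr0_norm s1p) !expr_div_n => h.
  rewrite (_ : G x = Psi z + phi z * (g x / s1) - z * phi z * (g x ^+ 2 / s1 ^+ 2)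
     + 6 * (`|g x| ^+ 3 / s1 ^+ 3)); last by rewrite /G; field; rewrite gt_eqF.
  move: h.
  set A := Psi _; set B := Psi _; set D := phi z * _; set E := z * phi z * _.
  by set H := 6 * _; lra.
- rewrite /G error_meanD// error_meanD//; first last.
  + exact: quartic_growthZ.
  + exact: quartic_growth_cst.
  rewrite error_meanD//; first last.
  + exact: quartic_growthZ.
  + exact: quartic_growthZ.
  rewrite !error_meanZ// error_mean_cst g1 g2 mulr0 addr0.
  have m01 : 0 <= v / tau <= 1.
    by rewrite divr_ge0 ?(ltW tau0)//= ler_pdivrMr// mul1r.
  have rm : r ^+ 2 * (1 + v / tau) = 1.
    rewrite /r expr_div_n s1E s0E; field.
    by rewrite gt_eqF//= gt_eqF//; lra.
  have := gauss_primitive_dilate z m01 (divr_gt0 s1p s0p) rm.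
  rewrite -/r zr ler_norml => /andP[h _].
  have h3 : 6 / s1 ^+ 3 * error_mean eps (fun x => `|g x| ^+ 3) <= 6 * m3 / s1 ^+ 3.
    by rewrite mulrAC ler_wpM2r ?invr_ge0 ?exprn_ge0 ?(ltW s1p)// ler_wpM2l.
  have e : z * phi z * (v / tau / 2) = z * phi z / s1 ^+ 2 * v.
    by rewrite s1E; field; rewrite gt_eqF.
  rewrite e in h; rewrite mulNr mulNr; lra.
Qed.

Lemma clt_bound n (g : nat -> R -> R) (v : nat -> R) (m3 vm a h : R) :
  (forall k, measurable_fun setT (g k)) ->
  (forall k, (k < n)%N -> standardized_summand (g k) (v k) m3) ->
  (forall k, (k < n)%N -> 0 <= v k <= vm) ->
  0 <= m3 -> 0 < h -> vm <= h ->
  (\int[P]_w (Psi ((partial_sum eps g n w + a) / Num.sqrt (2 * h)))%:E <=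
   (Psi (a / Num.sqrt (2 * (h + \sum_(k < n) v k))) +
     n%:R * (5 * (vm / h) ^+ 2 + 6 * m3 / Num.sqrt (2 * h) ^+ 3))%:E)%E.
Proof.
move=> mg sg v0 m30 h0 vmh.
pose tau k := h + \sum_(k <= j < n) v j.
have tauh k : h <= tau k.
  rewrite /tau lerDl big_nat; apply: sumr_ge0 => j /andP[_ jn].
  by have /andP[] := v0 _ jn.
pose f k x := Psi ((x + a) / Num.sqrt (2 * tau k)).
have := @sum_domination _ _ _ P eps F iidE g f
  (fun=> 5 * (vm / h) ^+ 2 + 6 * m3 / Num.sqrt (2 * h) ^+ 3) n.
rewrite sumr_const card_ord /f /tau big_geq// addr0 add0r.
rewrite big_mkord -[_ *+ n]mulr_natl; apply => //.
- move=> k; apply: measurableT_comp; first exact: measurable_gauss_primitive.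
  by apply: measurable_funM => //; apply: measurable_funD.
- by move=> k x; exact: gauss_primitive_ge0.
- move=> _; apply: addr_ge0; first by rewrite mulr_ge0 ?sqr_ge0.
  by rewrite divr_ge0 ?mulr_ge0 ?exprn_ge0 ?sqrtr_ge0.
- move=> k y kn; have /andP[vk0 vkm] := v0 _ kn.
  rewrite (eq_integral (fun w => (Psi (((y + a) + g k (eps k w)) / Num.sqrt (2 * tau k.+1)))%:E)); last first.
    by move=> w _; rewrite addrAC.
  have tauS : tau k = tau k.+1 + v k by rewrite /tau (big_ltn kn) addrA addrAC.
  apply: (le_trans (@lindeberg_step _ _ _ (tau k.+1) (y + a) k (sg _ kn) _ vk0 _)).
  + exact: lt_le_trans (tauh _).
  + by rewrite (le_trans vkm)// (le_trans vmh).
  have tp : 0 < tau k.+1 by exact: lt_le_trans (tauh _).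
  have ratio : v k / tau k.+1 <= vm / h.
    by rewrite ler_pM ?invr_ge0 ?(ltW tp)// lef_pV2.
  have A1 : 5 * (v k / tau k.+1) ^+ 2 <= 5 * (vm / h) ^+ 2.
    have q0 : 0 <= v k / tau k.+1 by rewrite divr_ge0 ?(ltW tp).
    by rewrite ler_pM2l// ler_pXn2r// nnegrE (le_trans q0).
  have A2 : 6 * m3 / Num.sqrt (2 * tau k.+1) ^+ 3 <= 6 * m3 / Num.sqrt (2 * h) ^+ 3.
    apply: ler_wpM2l; first by rewrite mulr_ge0.
    have sh : 0 < Num.sqrt (2 * h) by rewrite sqrtr_gt0 mulr_gt0.
    have st : 0 < Num.sqrt (2 * tau k.+1) by rewrite sqrtr_gt0 mulr_gt0.
    rewrite lef_pV2 ?posrE ?exprn_gt0// ler_pXn2r ?nnegrE ?(ltW sh) ?(ltW st)//.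
    by rewrite ler_wsqrtr// ler_pM2l.
  by rewrite lee_fin -tauS lerD2l lerD.
Qed.

End central_limit.

Section markov.
Context {R : realType} {d : measure_display} {T : measurableType d}.
Context (P : probability T R).

Lemma markov_event (A : set T) (f : T -> R) (c r : R) : measurable A ->
  measurable_fun setT f -> (forall w, 0 <= f w) -> 0 < c ->
  (forall w, A w -> c <= f w) -> (\int[P]_w (f w)%:E <= r%:E)%E ->
  (P A <= (r / c)%:E)%E.
Proof.
move=> mA mf f0 c0 cf fr.
have cP : (c%:E * P A <= r%:E)%E.
  apply: le_trans fr.
  rewrite -[A in P A]setIT -integral_indic//.
  rewrite -ge0_integralZl_EFin//; last 2 first.
  - by apply/measurable_EFinP; exact: measurable_indic.
  - exact: ltW.
  apply: ge0_le_integral => //.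
  - by move=> w _; rewrite mule_ge0// lee_fin ltW.
  - by apply/measurable_EFinP; apply: measurable_funM => //; exact: measurable_indic.
  - exact/measurable_EFinP.
  move=> w _; rewrite -EFinM lee_fin indicE.
  by case: (boolP (w \in A)) => wA; rewrite ?mulr1 ?mulr0 ?cf//; exact: set_mem.
rewrite -(@fineK _ (P A)) ?fin_num_measure// in cP *.
by rewrite -EFinM !lee_fin in cP *; rewrite ler_pdivlMr// mulrC.
Qed.
End markov.

Section clt_upper.
Context {R : realType} {d : measure_display} {T : measurableType d}.
Context (P : probability T R) (eps : nat -> {RV P >-> R}) (F : R -> R).
Hypothesis iidE : forall n, iid (fun i : 'I_n => eps i) F.
Hypothesis fourthE : ('E_P[fun w => (`|eps 0%N w| ^+ 4)%R] < +oo)%E.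
Local Notation Psi := (@gauss_primitive R).

Lemma measurable_partial_sumT (g : nat -> R -> R) n :
  (forall k, measurable_fun setT (g k)) -> measurable_fun setT (partial_sum eps g n).
Proof.
by move=> mg; apply: measurable_sumr => k; apply: measurableT_comp.
Qed.

Lemma clt_upper (C u0 eta : R) : 0 < C -> 0 < u0 -> 0 < eta ->
  exists2 a, 0 < a & exists N, forall n, (N <= n)%N ->
  forall (g : nat -> R -> R) (v : nat -> R),
  (forall k, measurable_fun setT (g k)) ->
  (forall k, (k < n)%N ->
     standardized_summand eps (g k) (v k) (C / (n%:R * Num.sqrt n%:R))) ->
  (forall k, (k < n)%N -> 0 <= v k <= C / n%:R) ->
  u0 <= \sum_(k < n) v k ->
  (P [set w | (- a <= partial_sum eps g n w)%R] <= (1 / 2 + eta)%:E)%E.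
Proof.
move=> C0 u00 eta0.
pose s : R := Num.sqrt pi.
have s0 : 0 < s by rewrite sqrtr_gt0 pi_gt0.
pose e := s * Num.min eta 1 / 4.
have m0 : 0 < Num.min eta 1 by rewrite lt_min eta0 ltr01.
have e0 : 0 < e by rewrite /e divr_gt0// mulr_gt0.
have e1 : e <= s / 4.
  by rewrite /e ler_pM2r// -[leRHS]mulr1 ler_pM2l// ge_min lexx orbT.
have e2 : e <= s * eta / 4.
  by rewrite /e ler_pM2r// ler_pM2l// ge_min lexx.
have [z z0 zE] := gauss_primitive_near_total e0; rewrite -/s in zE.
pose su := Num.sqrt (2 * u0).
have su0 : 0 < su by rewrite sqrtr_gt0 mulr_gt0.
pose a := eta * s * su / 8.
have a0 : 0 < a by rewrite divr_gt0// !mulr_gt0.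
exists a => //.
pose h := (a / z) ^+ 2 / 2.
have az0 : 0 < a / z by rewrite divr_gt0.
have h0 : 0 < h by rewrite divr_gt0// exprn_gt0.
have sh : Num.sqrt (2 * h) = a / z.
  by rewrite /h mulrCA divff// mulr1 sqrtr_sqr gtr0_norm.
pose K := 5 * C ^+ 2 / h ^+ 2 + 6 * C / (a / z) ^+ 3.
have K0 : 0 < K.
  by rewrite /K; apply: addr_gt0; apply: divr_gt0; rewrite ?exprn_gt0//;
    rewrite mulr_gt0 ?exprn_gt0.
pose X := (4 * K / (eta * s)) ^+ 2 + C / h + 1.
exists (Num.truncn X).+1 => n nN g v mg sg v0 vu.
have nX : X < n%:R.
  by apply: (lt_le_trans (truncnS_gt X)); rewrite ler_nat.
have X1 : 1 <= X.
  by rewrite /X lerDr addr_ge0 ?sqr_ge0// divr_ge0 ?ltW.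
have n1 : 1 <= n%:R :> R by rewrite (le_trans X1)// ltW.
have n0 : 0 < n%:R :> R by rewrite (lt_le_trans ltr01).
pose q : R := Num.sqrt n%:R.
have q2 : q ^+ 2 = n%:R by rewrite sqr_sqrtr// ltW.
have q0 : 0 < q by rewrite sqrtr_gt0.
have q1 : 1 <= q by rewrite -sqrtr1 ler_wsqrtr.
have Kq : K / q <= eta * s / 4.
  rewrite ler_pdivrMr// -ler_pdivrMl; last by rewrite divr_gt0// mulr_gt0.
  rewrite -(@ler_pXn2r _ 2)//; last 2 first.
  - by rewrite nnegrE mulr_ge0// ?invr_ge0 ?divr_ge0 ?mulr_ge0// ltW.
  - by rewrite nnegrE ltW.
  rewrite q2 (le_trans _ (ltW nX))// /X -addrA [leLHS](_ : _ = (4 * K / (eta * s)) ^+ 2).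
    by rewrite lerDl addr_ge0// divr_ge0 ?ltW.
  by congr (_ ^+ 2); field; rewrite !gt_eqF.
have Ch : C / n%:R <= h.
  rewrite ler_pdivrMr// -ler_pdivrMl// (le_trans _ (ltW nX))// /X.
  by rewrite mulrC [leRHS]addrAC lerDr addr_ge0 ?sqr_ge0.
have m30 : 0 <= C / (n%:R * q) by rewrite divr_ge0 ?mulr_ge0 ?ltW.
have bound := clt_bound iidE fourthE (2 * a) mg sg v0 m30 h0 Ch.
have mS := measurable_partial_sumT n mg.
have Psiz0 : 0 < Psi z by rewrite (lt_le_trans _ zE)//; lra.
have := @markov_event _ _ _ P [set w | - a <= partial_sum eps g n w]
  (fun w => Psi ((partial_sum eps g n w + 2 * a) / Num.sqrt (2 * h))) (Psi z) _ _ _ _ Psiz0 _ bound.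
move=> mk; apply: (le_trans (mk _ _ _ _)) => {mk}.
- exact: measurable_set_le.
- apply: measurableT_comp; first exact: measurable_gauss_primitive.
  by apply: measurable_funM => //; apply: measurable_funD.
- by move=> w; exact: gauss_primitive_ge0.
- move=> w /= wa; apply: gauss_primitive_nondecreasing.
  rewrite sh ler_pdivlMr//  mulrCA divff ?gt_eqF// mulr1; lra.
rewrite lee_fin ler_pdivrMr//.
set V := \sum_(k < n) v k in vu *.
have P1 : Psi (2 * a / Num.sqrt (2 * (h + V))) <= s / 2 + eta * s / 4.
  apply: (@le_trans _ _ (Psi (eta * s / 4))).
    apply: gauss_primitive_nondecreasing.
    have suV : su <= Num.sqrt (2 * (h + V)) by rewrite ler_wsqrtr// ler_pM2l//; lra.
    rewrite ler_pdivrMr ?(lt_le_trans su0)//.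
    rewrite (_ : 2 * a = eta * s / 4 * su); last by rewrite /a; field.
    by rewrite ler_pM2l// divr_gt0// mulr_gt0.
  have := @lipschitz_of_derive R Psi gauss_fun 0 (eta * s / 4) 1.
  rewrite subr0 gauss_primitive0 mul1r => L.
  have := le_trans (ler_norm _) (L _ _); rewrite lerBlDl => L2.
  rewrite -/s in L2; apply: (le_trans (L2 _ _)).
  - by move=> *; exact: is_derive_gauss_primitive.
  - by move=> t _; rewrite ger0_norm ?gauss_fun_ge0 ?gauss_fun_le1.
  by rewrite gtr0_norm// divr_gt0// mulr_gt0.
have P2 : n%:R * (5 * (C / n%:R / h) ^+ 2 + 6 * (C / (n%:R * Num.sqrt n%:R)) / Num.sqrt (2 * h) ^+ 3) <= K / q.
  have A0 : 0 <= 5 * C ^+ 2 / h ^+ 2 / q.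
    by apply: divr_ge0 (ltW q0); apply: divr_ge0 (sqr_ge0 _); rewrite mulr_ge0 ?sqr_ge0.
  have -> : K / q = 5 * C ^+ 2 / h ^+ 2 / q + 6 * C / (a / z) ^+ 3 / q.
    by rewrite /K mulrDl.
  rewrite sh -/q -q2 [leLHS](_ : _ =
    5 * C ^+ 2 / h ^+ 2 / q / q + 6 * C / (a / z) ^+ 3 / q); last first.
    by field; rewrite !gt_eqF.
  by rewrite lerD2r ler_pdivrMr// ler_peMr.
apply: (@le_trans _ _ ((1 / 2 + eta) * (s - e))); last first.
  by rewrite ler_pM2l//; lra.
have : eta * e <= eta * (s / 4) by rewrite ler_pM2l.
nra.
Qed.

End clt_upper.

Section tails.
Context {R : realType} {d : measure_display} {T : measurableType d}.
Context (P : probability T R) (eps : nat -> {RV P >-> R}).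
Context (F : R -> R) (sigma : R).
Hypothesis iidE : forall n, iid (fun i : 'I_n => eps i) F.
Hypothesis varE : ('V_P[eps 0%N] = (sigma ^+ 2)%R%:E)%E.
Hypothesis meanE : ('E_P[eps 0%N] = 0)%E.
Hypothesis fourthE : ('E_P[fun w => (`|eps 0%N w| ^+ 4)%R] < +oo)%E.

Lemma weighted_sum_tail n (a : nat -> R) (c t : R) : 0 < t ->
  (forall k, (k < n)%N -> a k ^+ 2 <= c) ->
  (P [set w | (t <= `|partial_sum eps (fun k x => a k * x) n w|)%R]
    <= (n%:R * (c * sigma ^+ 2) / t ^+ 2)%:E)%E.
Proof.
move=> t0 ac.
pose a' k := if (k < n)%N then a k else 0.
have S w : partial_sum eps (fun k x => a k * x) n w =
    partial_sum eps (fun k x => a' k * x) n w.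
  by apply: eq_bigr => k _; rewrite /a' ltn_ord.
have c0 : (0 < n)%N -> 0 <= c by move=> n0; apply: le_trans (ac 0%N n0); exact: sqr_ge0.
have mg k : measurable_fun setT (fun x : R => a' k * x).
  by apply: measurable_funM.
have mS := measurable_partial_sumT eps n mg.
apply: (markov_event (f := fun w => (partial_sum eps (fun k x => a' k * x) n w) ^+ 2)).
- rewrite (_ : [set _ | _] = [set w | t <= `|partial_sum eps (fun k x => a' k * x) n w|]).
    by apply: measurable_set_le => //; exact: measurableT_comp.
  by apply/seteqP; split => w /=; rewrite S.
- exact: measurable_funX.
- by move=> w; exact: sqr_ge0.
- by rewrite exprn_gt0.
- move=> w /=; rewrite S => h.
  by rewrite -[leRHS]real_normK ?num_real// ler_pXn2r// nnegrE ltW.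
have := @sum_domination _ _ _ P eps F iidE (fun k x => a' k * x) (fun _ x => x ^+ 2)
  (fun k => a' k ^+ 2 * sigma ^+ 2) n mg.
move=> h; apply: (le_trans (h _ _ _ _)) => {h}.
- by move=> k; exact: measurable_funX.
- by move=> k x; exact: sqr_ge0.
- by move=> k; rewrite mulr_ge0 ?sqr_ge0.
- move=> k b kn.
  have q1 : quartic_growth (fun x : R => x) by exact: quartic_growth_id.
  have q2 : quartic_growth (fun x : R => x ^+ 2) by exact: quartic_growth_sqr.
  have q3 : quartic_growth (fun x : R => b ^+ 2 + 2 * b * a' k * x).
    by apply: quartic_growthD; [exact: quartic_growth_cst|exact: quartic_growthZ].
  have q4 : quartic_growth (fun x : R => a' k ^+ 2 * x ^+ 2) by exact: quartic_growthZ.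
  apply: (@error_integral_le _ _ _ P eps F iidE fourthE k (fun x => (b + a' k * x) ^+ 2)
    (fun x => (b ^+ 2 + 2 * b * a' k * x) + a' k ^+ 2 * x ^+ 2)).
  + by apply: measurable_funX; apply: measurable_funD => //; exact: mg.
  + by move=> x; exact: sqr_ge0.
  + exact: quartic_growthD.
  + by move=> x; rewrite le_eqVlt; apply/orP; left; apply/eqP; ring.
  rewrite error_meanD// error_meanD ?error_mean_cst//; last 2 first.
  + exact: quartic_growth_cst.
  + exact: quartic_growthZ.
  by rewrite !error_meanZ// (error_mean_id meanE) (error_mean_sqr varE meanE) mulr0 addr0.
rewrite lee_fin expr0n/= add0r.
apply: (@le_trans _ _ (\sum_(k < n) c * sigma ^+ 2)).
  by apply: ler_sum => k _; rewrite /a' ltn_ord ler_wpM2r ?sqr_ge0// ac.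
by rewrite sumr_const card_ord mulr_natl.
Qed.

Lemma mean_square_tail n (t : R) : 0 < t ->
  (P [set w | (t <= partial_sum eps (fun _ x => x ^+ 2) n w)%R]
    <= (n%:R * sigma ^+ 2 / t)%:E)%E.
Proof.
move=> t0.
have mg (k : nat) : measurable_fun setT (fun x : R => x ^+ 2) by exact: measurable_funX.
have mS := measurable_partial_sumT eps n mg.
have S0 m w : 0 <= partial_sum eps (fun _ x => x ^+ 2) m w.
  by apply: sumr_ge0 => k _; exact: sqr_ge0.
apply: (markov_event (f := fun w => `|partial_sum eps (fun _ x => x ^+ 2) n w|)) => //.
- exact: measurable_set_le.
- exact: measurableT_comp.
- by move=> w /= h; rewrite ger0_norm.
have := @sum_domination _ _ _ P eps F iidE (fun _ x => x ^+ 2) (fun _ x => `|x|)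
  (fun k => sigma ^+ 2) n mg.
move=> h; apply: (le_trans (h _ _ _ _)) => {h}.
- by move=> k; exact: normr_measurable.
- by [].
- by move=> k; rewrite sqr_ge0.
- move=> k b kn.
  have q2 : quartic_growth (fun x : R => x ^+ 2) by exact: quartic_growth_sqr.
  have q1 : quartic_growth (fun _ : R => `|b|) by exact: quartic_growth_cst.
  apply: (@error_integral_le _ _ _ P eps F iidE fourthE k (fun x => `|b + x ^+ 2|)
    (fun x => `|b| + x ^+ 2)).
  + by apply: measurableT_comp => //; apply: measurable_funD => //; exact: mg.
  + by [].
  + exact: quartic_growthD.
  + by move=> x; rewrite (le_trans (ler_normD _ _))// (ger0_norm (sqr_ge0 x)).
  by rewrite error_meanD// error_mean_cst (error_mean_sqr varE meanE).
by rewrite lee_fin normr0 add0r sumr_const card_ord mulr_natl.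
Qed.

Definition centered_indicator y tau (x : R) : R :=
  (x <= tau)%R%:R - (x <= y)%R%:R - (F tau - F y).

Lemma quartic_growth_centered y tau : quartic_growth (centered_indicator y tau).
Proof.
apply: quartic_growthD; last exact: quartic_growth_cst.
apply: quartic_growthD; first exact: quartic_growth_ind.
rewrite (_ : (fun _ => _) = (fun x : R => -1 * (x <= y)%R%:R)); last first.
  by apply/funext => x; rewrite mulN1r.
by apply: quartic_growthZ; exact: quartic_growth_ind.
Qed.

Lemma error_mean_diff_ind a b y tau :
  error_mean eps (fun x : R => a + b * ((x <= tau)%R%:R - (x <= y)%R%:R)) =
  a + b * (F tau - F y).
Proof.
have q1 := quartic_growth_ind tau; have q2 := quartic_growth_ind y.
have q3 : quartic_growth (fun x : R => -1 * (x <= y)%R%:R) by exact: quartic_growthZ.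
have q4 : quartic_growth (fun x : R => (x <= tau)%R%:R + -1 * (x <= y)%R%:R) by exact: quartic_growthD.
have q5 : quartic_growth (fun x : R => b * ((x <= tau)%R%:R + -1 * (x <= y)%R%:R)) by exact: quartic_growthZ.
rewrite (_ : (fun _ => _) = (fun x : R => a + b * ((x <= tau)%R%:R + -1 * (x <= y)%R%:R))); last first.
  by apply/funext => x; rewrite mulN1r.
rewrite error_meanD//; last exact: quartic_growth_cst.
rewrite error_mean_cst error_meanZ// error_meanD// error_meanZ//.
by rewrite !(error_mean_ind iidE) mulN1r.
Qed.

Lemma bernoulli_sum_tail n y (tau : nat -> R) (v t : R) : 0 < t -> 0 <= v ->
  (forall k, (k < n)%N -> `|F (tau k) - F y| <= v) ->
  (P [set w | (t <= `|partial_sum eps (fun k => centered_indicator y (tau k)) n w|)%R]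
    <= (n%:R * (3 * v + 8 * n%:R * v ^+ 2) / t ^+ 4)%:E)%E.
Proof.
move=> t0 v0 Fv.
have mg k : measurable_fun setT (centered_indicator y (tau k)).
  by case: (quartic_growth_centered y (tau k)).
have mS := measurable_partial_sumT eps n mg.
pose g k := centered_indicator y (tau k).
have even4 (x : R) : x ^+ 4 = (x ^+ 2) ^+ 2 by rewrite -exprM.
apply: (markov_event (f := fun w => (partial_sum eps g n w) ^+ 4)).
- by apply: measurable_set_le => //; exact: measurableT_comp.
- exact: measurable_funX.
- by move=> w; rewrite even4 sqr_ge0.
- by rewrite exprn_gt0.
- move=> w /= h.
  have -> : partial_sum eps g n w ^+ 4 = `|partial_sum eps g n w| ^+ 4.
    by rewrite -normrX ger0_norm// even4 sqr_ge0.
  rewrite ler_pXn2r ?nnegrE ?(ltW t0)//; exact: h.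
have pos (m : nat) (x : R) : 0 <= x ^+ 4 + 8 * m%:R * v * x ^+ 2.
  apply: addr_ge0; first by rewrite even4 sqr_ge0.
  by apply: mulr_ge0 (sqr_ge0 _); apply: mulr_ge0 => //; exact: mulr_ge0.
pose e (k : nat) := 3 * v + 8 * n%:R * v ^+ 2.
have := @sum_domination _ _ _ P eps F iidE g (fun k x => x ^+ 4 + 8 * (n - k)%:R * v * x ^+ 2) e n mg.
have E w : partial_sum eps g n w ^+ 4 + 8 * (n - n)%:R * v * partial_sum eps g n w ^+ 2
   = partial_sum eps g n w ^+ 4 by rewrite subnn mulr0 !mul0r addr0.
under eq_integral do rewrite E.
move=> h; apply: (le_trans (h _ _ _ _)) => {h E}.
- by move=> k; apply: measurable_funD; [exact: measurable_funX|apply: measurable_funM => //; exact: measurable_funX].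
- by move=> k x; exact: pos.
- by move=> k; rewrite /e addr_ge0 ?mulr_ge0 ?sqr_ge0.
- move=> k b kn.
  pose m : R := (n - k.+1)%:R.
  have mE : (n - k)%:R = m + 1 :> R by rewrite /m natr1 subnS prednK// subn_gt0.
  have m0 : 0 <= m by [].
  have mn : m <= n%:R by rewrite /m ler_nat leq_subr.
  pose p := F (tau k) - F y.
  have pv : `|p| <= v by exact: Fv.
  pose s : R := if y <= tau k then 1 else -1.
  pose D (x : R) : R := (x <= tau k)%R%:R - (x <= y)%R%:R.
  have D2 x : D x ^+ 2 = s * D x.
    have [yt|ty] := leP y (tau k).
      rewrite /s yt mul1r /D; case: (leP x y) => [xy|_].
        by rewrite (le_trans xy yt) subrr expr0n.
      by case: (x <= tau k); rewrite subr0 ?expr1n ?expr0n.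
    rewrite /s leNgt ty/= mulN1r /D; case: (leP x (tau k)) => [xt|_].
      by rewrite (le_trans xt (ltW ty)) subrr expr0n oppr0.
    by case: (x <= y); rewrite ?subr0 ?sub0r ?sqrrN ?expr1n ?opprK ?expr0n ?oppr0.
  have sp : s * p <= v.
    apply: le_trans pv; rewrite /s; case: ifP => _; rewrite ?mul1r ?mulN1r ?ler_norm//.
    by rewrite -normrN ler_norm.
  have D1 x : -1 <= D x - p <= 1.
    have q0 := cdfF_ge0 iidE; have q1 := cdfF_le1 iidE fourthE.
    have := q0 (tau k); have := q1 (tau k); have := q0 y; have := q1 y.
    have := cdfF_nondecreasing iidE fourthE.
    have [yt /(_ _ _ yt)|ty /(_ _ _ (ltW ty))] := leP y (tau k); rewrite /D /p.
      case: (leP x y) => [xy|_]; first by rewrite (le_trans xy yt)/= => *; lra.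
      by case: (x <= tau k) => /= *; lra.
    case: (leP x (tau k)) => [xt|_]; first by rewrite (le_trans xt (ltW ty))/= => *; lra.
    by case: (x <= y) => /= *; lra.
  pose c1 := 4 * b ^+ 3 + 16 * m * v * b.
  pose c2 := 8 * b ^+ 2 + 3 + 8 * m * v.
  have c20 : 0 <= c2.
    have h1 : 0 <= 8 * b ^+ 2 by rewrite mulr_ge0 ?sqr_ge0.
    have h2 : 0 <= 8 * m * v by rewrite !mulr_ge0.
    by rewrite /c2; lra.
  (* the second order coefficient multiplies (D - p)^2 = s D - 2 p D + p^2 *)
  pose G x := (b ^+ 4 + 8 * m * v * b ^+ 2 - c1 * p + c2 * p ^+ 2)
      + (c1 + c2 * (s - 2 * p)) * D x.
  apply: (@error_integral_le _ _ _ P eps F iidE fourthE k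
    (fun x => (b + g k x) ^+ 4 + 8 * (n - k.+1)%:R * v * (b + g k x) ^+ 2) G).
  + apply: measurable_funD; first by apply: measurable_funX; apply: measurable_funD => //; exact: mg.
    by apply: measurable_funM => //; apply: measurable_funX; apply: measurable_funD => //; exact: mg.
  + by move=> x; exact: pos.
  + apply: quartic_growthD; first exact: quartic_growth_cst.
    apply: quartic_growthZ.
    rewrite (_ : D = fun x => centered_indicator y (tau k) x + p); last first.
      by apply/funext => x; rewrite /centered_indicator /p subrK.
    by apply: quartic_growthD; [exact: quartic_growth_centered|exact: quartic_growth_cst].
  + move=> x; rewrite -/m.
    have -> : g k x = D x - p by [].
    have D2x := D2 x; have := D1 x.
    set xi := D x - p => xi1.
    have -> : G x = b ^+ 4 + 8 * m * v * b ^+ 2 + c1 * xi + c2 * xi ^+ 2.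
      rewrite /G /xi (_ : (D x - p) ^+ 2 = s * D x - 2 * p * D x + p ^+ 2); last by rewrite -D2x; ring.
      ring.
    have h1 : xi ^+ 2 <= 1 by nra.
    have h2 : xi ^+ 4 <= xi ^+ 2 by rewrite even4; have := sqr_ge0 xi; nra.
    have h3 : 4 * b * xi ^+ 3 <= 2 * (b ^+ 2 + 1) * xi ^+ 2.
      rewrite -subr_ge0 (_ : _ - _ = 2 * xi ^+ 2 * (b ^+ 2 + 1 - 2 * b * xi)); last by ring.
      apply: mulr_ge0; first by rewrite mulr_ge0 ?sqr_ge0.
      have : 0 <= b ^+ 2 - 2 * b * xi + xi ^+ 2.
        by rewrite (_ : _ + _ = (b - xi) ^+ 2) ?sqr_ge0//; ring.
      lra.
    rewrite (_ : (b + xi) ^+ 4 = b ^+ 4 + 4 * b ^+ 3 * xi + 6 * b ^+ 2 * xi ^+ 2 + 4 * b * xi ^+ 3 + xi ^+ 4); last by ring.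
    rewrite /c1 /c2; lra.
  rewrite /G error_mean_diff_ind -/p mE.
  rewrite [leLHS](_ : _ = b ^+ 4 + 8 * m * v * b ^+ 2 + c2 * (s * p - p ^+ 2)); last by ring.
  have h1 : c2 * (s * p - p ^+ 2) <= c2 * v.
    by rewrite ler_wpM2l//; have := sqr_ge0 p; lra.
  have h2 : 8 * m * v * v <= 8 * n%:R * v ^+ 2 by rewrite -mulrA -expr2 ler_wpM2r ?sqr_ge0// ler_pM2l.
  rewrite /e /c2 in h1 *; lra.
rewrite lee_fin !expr0n/= mulr0 add0r add0r /e sumr_const card_ord.
by rewrite -[leLHS]mulr_natl.
Qed.

End tails.

Section empirical_sampling.
Context {R : realType} {d : measure_display} {S : measurableType d}.
Context (Q : probability S R) (n : nat) (r : 'I_n -> R).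
Hypothesis n0 : (0 < n)%N.

Definition multiplicity (z : R) : R := \sum_(k < n) (r k == z)%:R.

Let r' (k : nat) : R := oapp r 0 (insub k).
Let r'E (k : 'I_n) : r' k = r k. Proof. by rewrite /r' valK. Qed.

Lemma empirical_law (Y : {RV Q >-> R}) :
  (forall x, cdf Y x = (n%:R^-1 * \sum_(k < n) (r k <= x)%R%:R)%:E) ->
  forall A, measurable A ->
    Q (Y @^-1` A) = (n%:R^-1 * \sum_(k < n) \1_A (r k))%:E.
Proof.
move=> cY A mA.
have invn0 : (0 : R) <= n%:R^-1 by rewrite invr_ge0.
pose m1 := distribution Q Y.
pose m2 := mscale (NngNum invn0) (msum (fun k => dirac (r' k)) n).
have m2E B : m2 B = (n%:R^-1 * \sum_(k < n) \1_B (r k))%:E.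
  rewrite /m2 /mscale /msum EFinM -sumEFin; congr (_ * _)%E.
  by apply: eq_bigr => k _; rewrite r'E.
rewrite -m2E; apply: (@measure_unique_cdf _ m1 m2) => //.
- by apply: (le_lt_trans (probability_le1 m1 measurableT)); exact: ltry.
- rewrite [RHS](m2E setT) (eq_bigr (fun=> 1)).
    rewrite sumr_const card_ord mulVf ?pnatr_eq0 -?lt0n//.
    exact: (probability_setT m1).
  by move=> k _; rewrite indicE mem_set.
- move=> x; rewrite [RHS](m2E _); apply: (etrans (cY x)); congr (_ * _)%:E.
  apply: eq_bigr => k _; rewrite indicE; congr (_%:R).
  case: (leP (r k) x) => h; first by rewrite mem_set//= in_itv.
  by rewrite memNset//= in_itv/= leNgt h.
Qed.

Lemma empirical_prob (J : finType) (Y : J -> {RV Q >-> R}) (h : (J -> R) -> bool) :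
  iid Y (fun x => n%:R^-1 * \sum_(k < n) (r k <= x)%R%:R) ->
  measurable [set v | h (fun j => Y j v)] ->
  Q [set v | h (fun j => Y j v)] =
    (n%:R^-1 ^+ #|J| * \sum_(f : {ffun J -> 'I_n}) (h (fun j => r (f j)))%:R)%:E.
Proof.
move=> [prodY cdfY] mh.
have mult_gt0 k : 0 < multiplicity (r k).
  rewrite /multiplicity (bigD1 k)//= eqxx ltr_pwDl// sumr_ge0//.
pose A (f : {ffun J -> 'I_n}) := \bigcap_(j in [set: J]) Y j @^-1` [set r (f j)].
have mA f : measurable (A f).
  by apply: fin_bigcap_measurable => // j _; exact: measurable_funPTI.
pose c (f : {ffun J -> 'I_n}) : R := \prod_j (multiplicity (r (f j)))^-1.
have c0 f : 0 <= c f by apply: prodr_ge0 => j _; rewrite invr_ge0 ltW.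
have QA f : Q (A f) = (n%:R^-1 ^+ #|J| * (c f)^-1)%:E.
  rewrite prodY// (eq_bigr (fun j => (n%:R^-1 * multiplicity (r (f j)))%:E)); last first.
    move=> j _; rewrite (empirical_law (cdfY j))//; congr (_ * _)%:E.
    by apply: eq_bigr => k _; rewrite indicE in_set1.
  rewrite prodEFin big_split/= prodr_const cardT -cardE.
  by congr (_ * _)%:E; rewrite /c prodfV; rewrite invrK.
pose range := \bigcap_(j in [set: J]) Y j @^-1` (r @` setT).
have mr : measurable (r @` setT).
  by apply: countable_measurable => //; apply: finite_set_countable; apply: finite_image.
have Qr : Q range = 1%E.
  rewrite prodY//; apply: big1 => j _.
  rewrite (empirical_law (cdfY j))// (eq_bigr (fun=> 1)).
    by rewrite sumr_const card_ord mulVf// pnatr_eq0 -lt0n.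
  by move=> k _; rewrite indicE mem_set//; exists k.
have mrange : measurable range.
  by apply: fin_bigcap_measurable => // j _; exact: measurable_funPTI.
set E := [set v | _] in mh *.
have pointwise v : range v -> \1_E v = \sum_(f : {ffun J -> 'I_n}) (h (fun j => r (f j)))%:R * (c f * \1_(A f) v) :> R.
  move=> rv.
  have rest (f : {ffun J -> 'I_n}) : (h (fun j => r (f j)))%:R * (c f * \1_(A f) v) = \1_E v * (c f * \1_(A f) v) :> R.
    have [vA|vA] := boolP (v \in A f); last first.
      by rewrite (_ : \1_(A f) v = 0) ?mulr0// indicE (negbTE vA).
    congr (_ * _); rewrite indicE; congr (_%:R).
    have Yv : (fun j => Y j v) = (fun j => r (f j)).
      by apply/funext => j; have := set_mem vA; apply.
    have [hr|hr] := boolP (h (fun j => r (f j))).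
      by rewrite mem_set// /E /= Yv.
    by rewrite memNset// /E /= Yv; exact/negP.
  under eq_bigr do rewrite rest.
  rewrite -mulr_sumr.
  rewrite (eq_bigr (fun f : {ffun J -> 'I_n} => \prod_j ((multiplicity (r (f j)))^-1 * (r (f j) == Y j v)%:R))); last first.
    move=> f _; rewrite big_split/= -/(c f); congr (_ * _).
    rewrite indicE; case: (boolP (v \in A f)) => vA.
      rewrite big1// => j _; have := set_mem vA j I; rewrite /= => ->.
      by rewrite eqxx.
    have [j jA] : exists j, r (f j) != Y j v.
      apply: contrapT => /forallNP H; move/negP: vA; apply; apply/mem_set => j _ /=.
      by apply/esym/eqP; move: (H j) => /negP; rewrite negbK.
    by rewrite (bigD1 j)//= (negbTE jA) mul0r.
  rewrite -(bigA_distr_bigA (fun j k => (multiplicity (r k))^-1 * (r k == Y j v)%:R))/=.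
  rewrite big1 ?mulr1// => j _.
  have [k _ kY] := rv j I.
  rewrite (eq_bigr (fun i => (multiplicity (Y j v))^-1 * (r i == Y j v)%:R)); last first.
    by move=> i _; case: eqP => [->//|_]; rewrite !mulr0.
  by rewrite -mulr_sumr -/(multiplicity _) mulVf// -kY gt_eqF.
rewrite -[E in LHS]setIT -integral_indic//.
have rnull : Q (~` range) = 0%E by rewrite probability_setC// Qr subee.
transitivity (\int[Q]_v (\sum_(f : {ffun J -> 'I_n}) ((h (fun j => r (f j)))%:R * (c f * \1_(A f) v))%R%:E)%E)%E.
  apply: ge0_ae_eq_integral => //.
  - by apply/measurable_EFinP; exact: measurable_indic.
  - apply: emeasurable_sum => f; apply/measurable_EFinP.
    by do 2 apply: measurable_funM => //; exact: measurable_indic.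
  - by move=> v _; apply: sume_ge0 => f _; rewrite lee_fin !mulr_ge0.
  exists (~` range); split => //; first exact: measurableC.
  move=> v /= nv rv; apply: nv => _; rewrite sumEFin; congr (_%:E); exact: pointwise.
rewrite ge0_integral_sum//; last 2 first.
- move=> f; apply/measurable_EFinP.
  by do 2 apply: measurable_funM => //; exact: measurable_indic.
- by move=> f v _; rewrite lee_fin !mulr_ge0.
rewrite mulr_sumr -sumEFin; apply: eq_bigr => f _.
under eq_integral do rewrite mulrA EFinM.
rewrite ge0_integralZl_EFin//; last 2 first.
- by apply/measurable_EFinP; exact: measurable_indic.
- by rewrite mulr_ge0.
rewrite integral_indic// setIT/= QA -EFinM; congr (_%:E).
have cf0 : c f != 0 by rewrite gt_eqF// /c prodr_gt0// => j _; rewrite invr_gt0.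
by rewrite -mulrA [c f * _]mulrCA divff// mulr1 mulrC.
Qed.

End empirical_sampling.

Section bootstrap_law.
Context {R : realType} {p n : nat}.
Implicit Types (X : 'M[R]_(n, p)) (xf : 'cV[R]_p) (y : 'cV[R]_n).

Definition boot_root X xf y (r : option 'I_n -> R) : R :=
  dotv xf (least_squares X y) + r None -
  dotv xf (least_squares X (X *m least_squares X y + \col_i r (Some i))).

Definition boot_dist X xf y (x : R) : R :=
  n%:R^-1 ^+ n.+1 * \sum_(f : {ffun option 'I_n -> 'I_n})
    (`|boot_root X xf y (fun o => residual X y (f o))| <= x)%R%:R.

Definition boot_critical X xf y (level : R) : R :=
  inf [set x | level <= boot_dist X xf y x].

Lemma boot_dist_nondecreasing X xf y : {homo boot_dist X xf y : a b / a <= b}.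
Proof.
move=> a b ab; rewrite ler_wpM2l ?exprn_ge0 ?invr_ge0//.
apply: ler_sum => f _; set z := `|_|.
by case: (leP z a) => // za; rewrite (le_trans za ab).
Qed.

Lemma boot_dist_lt0 X xf y x : x < 0 -> boot_dist X xf y x = 0.
Proof.
move=> x0; rewrite /boot_dist big1 ?mulr0// => f _.
by rewrite leNgt (lt_le_trans x0).
Qed.

Lemma boot_dist_eq1 X xf y : (0 < n)%N -> exists x, boot_dist X xf y x = 1.
Proof.
move=> n0.
exists (\sum_(f : {ffun option 'I_n -> 'I_n})
    `|boot_root X xf y (fun o => residual X y (f o))|).
rewrite /boot_dist (eq_bigr (fun=> 1)); last first.
  by move=> f _; rewrite (bigD1 f)//= lerDl sumr_ge0.
rewrite sumr_const card_ffun card_option card_ord natrX -exprMn mulVf ?expr1n//.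
by rewrite pnatr_eq0 -lt0n.
Qed.

Lemma boot_critical_le X xf y level x : 0 < level ->
  level <= boot_dist X xf y x -> boot_critical X xf y level <= x.
Proof.
move=> l0 lx; apply: ge_inf => //; exists 0 => z /= lz.
by rewrite leNgt; apply/negP => z0; move: lz; rewrite boot_dist_lt0// leNgt l0.
Qed.

Lemma boot_critical_ge X xf y level x : (0 < n)%N -> level <= 1 ->
  boot_dist X xf y x < level -> x <= boot_critical X xf y level.
Proof.
move=> n0 l1 xl; apply: lb_le_inf.
  by have [z z1] := boot_dist_eq1 X xf y n0; exists z; rewrite /= z1.
move=> z /= lz; rewrite leNgt; apply/negP => zx.
by move: (le_trans lz (boot_dist_nondecreasing X xf y (ltW zx))); rewrite leNgt xl.
Qed.

Lemma boot_critical_ge0 X xf y level : (0 < n)%N -> 0 < level <= 1 ->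
  0 <= boot_critical X xf y level.
Proof.
move=> n0 /andP[l0 l1]; apply: lb_le_inf.
  by have [z z1] := boot_dist_eq1 X xf y n0; exists z; rewrite /= z1.
move=> z /= lz.
by rewrite leNgt; apply/negP => z0; move: lz; rewrite boot_dist_lt0// leNgt l0.
Qed.

Lemma boot_critical_ltP X xf y level x : (0 < n)%N -> 0 < level <= 1 ->
  boot_critical X xf y level < x <->
  exists q : rat, ratr q < x /\ level <= boot_dist X xf y (ratr q).
Proof.
move=> n0 /andP[l0 l1]; split; last first.
  by move=> [q [qx lq]]; apply: le_lt_trans qx; exact: boot_critical_le.
move=> cx; have [z [/= lz zx]] : exists z, level <= boot_dist X xf y z /\ z < x.
  apply: contrapT => /forallNP H; move: cx; rewrite ltNge => /negP; apply.
  apply: lb_le_inf.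
    by have [z z1] := boot_dist_eq1 X xf y n0; exists z; rewrite /= z1.
  by move=> z /= lz; rewrite leNgt; apply/negP => zx; apply: (H z).
have [q] := rat_in_itvoo zx; rewrite in_itv/= => /andP[zq qx].
by exists q; split=> //; rewrite (le_trans lz)// boot_dist_nondecreasing// ltW.
Qed.

Section law.
Context {d : measure_display} {S : measurableType d} (Q : probability S R).
Context (es : 'I_n -> {RV Q >-> R}) (esf : {RV Q >-> R}).

Lemma boot_distE X xf y x : (0 < n)%N -> bootstrap_errors es esf X y ->
  Q [set v | `|boot_future esf X y xf v
      - dotv xf (boot_least_squares es X y v)| <= x] = (boot_dist X xf y x)%:E.
Proof.
move=> n0 boot.
have E v : boot_future esf X y xf v - dotv xf (boot_least_squares es X y v) =
    boot_root X xf y (fun o : option 'I_n => (if o is Some i then es i else esf) v) by [].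
pose h (r : option 'I_n -> R) := `|boot_root X xf y r| <= x.
have := @empirical_prob R _ S Q n (residual X y) n0 (option 'I_n) _ h boot.
rewrite card_option card_ord => -> //.
apply: measurable_set_le => //.
apply: measurableT_comp => //.
apply: measurable_funB; first exact: measurable_funD.
apply: random_mx_dotv; first exact: random_mx_cst.
apply: random_mxM; first exact: random_mx_cst.
apply: random_mxD; first exact: random_mx_cst.
move=> i j; rewrite [X in measurable_fun _ X](_ : _ = fun v => es i v)//.
by apply/funext => v; rewrite mxE.
Qed.

Lemma boot_quantileE X xf y level : (0 < n)%N -> bootstrap_errors es esf X y ->
  boot_quantile es esf X y xf level = boot_critical X xf y level.
Proof.
move=> n0 boot; rewrite /boot_quantile /boot_critical; congr inf.
by apply/funext => x /=; rewrite boot_distE// lee_fin.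
Qed.

End law.

Section measurability.
Context {d : measure_display} {T : measurableType d}.
Context (X : T -> 'M[R]_(n, p)) (xf : T -> 'cV[R]_p) (y : T -> 'cV[R]_n).
Hypotheses (mX : random_mx X) (mxf : random_mx xf) (my : random_mx y).

Lemma random_mx_least_squares : random_mx (fun w => least_squares (X w) (y w)).
Proof.
apply: random_mxM => //; apply: random_mxM; last exact: random_mx_tr.
by apply: random_mx_inv; apply: random_mxM => //; exact: random_mx_tr.
Qed.

Lemma measurable_residual i : measurable_fun setT (fun w => residual (X w) (y w) i).
Proof.
have mraw k : measurable_fun setT (fun w => raw_residual (X w) (y w) k).
  apply: measurable_funB; first exact: my.
  apply: random_mx_dotv; last exact: random_mx_least_squares.
  by apply: random_mx_tr; exact: random_mx_row.
apply: measurable_funB => //; apply: measurable_funM => //.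
exact: measurable_sumr.
Qed.

Lemma measurable_boot_dist x :
  measurable_fun setT (fun w => boot_dist (X w) (xf w) (y w) x).
Proof.
apply: measurable_funM => //; apply: measurable_sumr => f.
have mi (g : T -> R) : measurable_fun setT g ->
    measurable_fun setT (fun w => (g w <= x)%R%:R : R).
  by move=> mg; apply: (measurableT_comp (@measurable_ind_le R x) mg).
apply: mi; apply: measurableT_comp => //.
apply: measurable_funB.
  apply: measurable_funD; last exact: measurable_residual.
  by apply: random_mx_dotv => //; exact: random_mx_least_squares.
apply: random_mx_dotv => //.
apply: random_mxM; last first.
  apply: random_mxD; first by apply: random_mxM => //; exact: random_mx_least_squares.
  move=> i j; rewrite [Z in measurable_fun _ Z](_ : _ = fun w => residual (X w) (y w) (f (Some i))).
    exact: measurable_residual.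
  by apply/funext => v; rewrite mxE.
apply: random_mxM; last exact: random_mx_tr.
by apply: random_mx_inv; apply: random_mxM => //; exact: random_mx_tr.
Qed.

Lemma measurable_boot_critical level : (0 < n)%N -> 0 < level <= 1 ->
  measurable_fun setT (fun w => boot_critical (X w) (xf w) (y w) level).
Proof.
move=> n0 l01.
move=> mT; apply: (measurability _ (RGenInftyO.measurableE R)) => // _ [_ [x ->] <-].
rewrite setTI [Z in measurable Z](_ : _ = \bigcup_(q : rat)
   ([set w : T | ratr q < x] `&` [set w | level <= boot_dist (X w) (xf w) (y w) (ratr q)])).
  apply: countable_bigcupT_measurable => // q; apply: measurableI.
    by apply: measurable_set_bool; exact: measurable_cst.
  by apply: measurable_set_le => //; exact: measurable_boot_dist.
apply/seteqP; split => w /=; rewrite in_itv/=.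
  by move=> /(boot_critical_ltP _ _ _ _ n0 l01) [q [qx lq]]; exists q.
by move=> [q _ [qx lq]]; apply/(boot_critical_ltP _ _ _ _ n0 l01); exists q.
Qed.

End measurability.

End bootstrap_law.

Section residual_algebra.
Context {R : realType} {p n : nat} (X : 'M[R]_(n, p)).
Hypothesis Xunit : X^T *m X \in unitmx.
Implicit Types (xf beta : 'cV[R]_p) (e : 'cV[R]_n).

Definition leverage xf (i : 'I_n) : R :=
  dotv xf (invmx (X^T *m X) *m regressor X i).

Definition estimator_weight (j : 'I_p) (i : 'I_n) : R :=
  (invmx (X^T *m X) *m regressor X i) j ord0.

Definition vmean (e : 'cV[R]_n) : R := n%:R^-1 * \sum_(i < n) e i ord0.

Definition perturbation e (i : 'I_n) : R :=
  vmean e + dotv (regressor X i - xbar X) (least_squares X e).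

Lemma dotvDr (m : nat) (u v w : 'cV[R]_m) : dotv u (v + w) = dotv u v + dotv u w.
Proof. by rewrite /dotv mulmxDr mxE. Qed.

Lemma dotvBl (m : nat) (u v w : 'cV[R]_m) : dotv (u - v) w = dotv u w - dotv v w.
Proof. by rewrite /dotv linearB/= mulmxBl !mxE. Qed.

Lemma dotvZl (m : nat) a (v w : 'cV[R]_m) : dotv (a *: v) w = a * dotv v w.
Proof. by rewrite /dotv linearZ/= -scalemxAl mxE. Qed.

Lemma dotv_suml (m : nat) I (r : seq I) (f : I -> 'cV[R]_m) w :
  dotv (\sum_(i <- r) f i) w = \sum_(i <- r) dotv (f i) w.
Proof. by rewrite /dotv linear_sum/= mulmx_suml summxE. Qed.

Lemma dotvE (m : nat) (u v : 'cV[R]_m) : dotv u v = \sum_j u j ord0 * v j ord0.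
Proof. by rewrite /dotv mxE; apply: eq_bigr => j _; rewrite mxE. Qed.

Lemma least_squares_model beta e :
  least_squares X (X *m beta + e) = beta + least_squares X e.
Proof.
by rewrite /least_squares mulmxDr -!mulmxA [X^T *m (X *m beta)]mulmxA mulKmx.
Qed.

Lemma mul_design_entry beta (i : 'I_n) : (X *m beta) i ord0 = dotv (regressor X i) beta.
Proof. by rewrite dotvE mxE; apply: eq_bigr => j _; rewrite !mxE. Qed.

Lemma trmx_mul_sum e : X^T *m e = \sum_i e i ord0 *: regressor X i.
Proof.
apply/colP => j; rewrite mxE summxE; apply: eq_bigr => i _.
by rewrite !mxE mulrC.
Qed.

Lemma least_squares_sum e (j : 'I_p) :
  least_squares X e j ord0 = \sum_i estimator_weight j i * e i ord0.
Proof.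
rewrite /least_squares -mulmxA trmx_mul_sum linear_sum/= summxE.
by apply: eq_bigr => i _; rewrite -scalemxAr mxE mulrC.
Qed.

Lemma dotv_least_squares xf e :
  dotv xf (least_squares X e) = \sum_i leverage xf i * e i ord0.
Proof.
rewrite /least_squares -mulmxA trmx_mul_sum linear_sum/=.
rewrite /dotv mulmx_sumr summxE; apply: eq_bigr => i _.
by rewrite -!scalemxAr mxE mulrC.
Qed.

Lemma residual_model beta e (i : 'I_n) :
  residual X (X *m beta + e) i = e i ord0 - perturbation e i.
Proof.
have raw k : raw_residual X (X *m beta + e) k =
    e k ord0 - dotv (regressor X k) (least_squares X e).
  rewrite /raw_residual least_squares_model dotvDr mxE mul_design_entry; ring.
rewrite /residual raw (eq_bigr _ (fun k _ => raw k)) sumrB.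
rewrite /perturbation /vmean dotvBl /xbar dotvZl dotv_suml; ring.
Qed.

Lemma mean_perturbation e : (0 < n)%N ->
  n%:R^-1 * \sum_i perturbation e i = vmean e.
Proof.
move=> n0; have nn : n%:R != 0 :> R by rewrite pnatr_eq0 -lt0n.
rewrite /perturbation big_split/= sumr_const card_ord -[vmean e *+ n]mulr_natl.
have E : \sum_i (regressor X i - xbar X) = 0.
  rewrite sumrB sumr_const card_ord -scaler_nat [X in _ - _ *: X]/xbar.
  by rewrite scalerA divff// scale1r subrr.
rewrite -dotv_suml E.
by rewrite /dotv linear0 mul0mx mxE addr0 mulrA mulVf// mul1r.
Qed.

Lemma sum_residual beta e : (0 < n)%N ->
  \sum_i residual X (X *m beta + e) i = 0.
Proof.
move=> n0; have nn : n%:R != 0 :> R by rewrite pnatr_eq0 -lt0n.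
rewrite (eq_bigr _ (fun k _ => residual_model beta e k)) sumrB.
apply/eqP; rewrite subr_eq0; apply/eqP; apply: (@mulfI _ n%:R^-1).
  by rewrite invr_eq0.
by rewrite mean_perturbation.
Qed.

Lemma boot_root_model xf beta e (r : option 'I_n -> R) :
  boot_root X xf (X *m beta + e) r = r None - \sum_i leverage xf i * r (Some i).
Proof.
rewrite /boot_root (least_squares_model (least_squares X (X *m beta + e)) (\col_i r (Some i))).
rewrite dotvDr (dotv_least_squares _ (\col_i r (Some i))).
rewrite [X in _ - (_ + X)](eq_bigr (fun i => leverage xf i * r (Some i))); last first.
  by move=> i _; rewrite mxE.
by ring.
Qed.

End residual_algebra.

Section resampling_average.
Context {R : realType} {n : nat}.
Hypothesis n0 : (0 < n)%N.
Let nn : n%:R != 0 :> R. Proof. by rewrite pnatr_eq0 -lt0n. Qed.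

Definition resample_mean (phi : {ffun 'I_n -> 'I_n} -> R) : R :=
  n%:R^-1 ^+ n * \sum_g phi g.

Lemma resample_meanD phi psi :
  resample_mean (fun g => phi g + psi g) = resample_mean phi + resample_mean psi.
Proof. by rewrite /resample_mean big_split/= mulrDr. Qed.

Lemma resample_meanZ a phi :
  resample_mean (fun g => a * phi g) = a * resample_mean phi.
Proof. by rewrite /resample_mean -mulr_sumr mulrCA. Qed.

Lemma resample_mean_cst a : resample_mean (fun=> a) = a.
Proof.
rewrite /resample_mean sumr_const card_ffun !card_ord -[a *+ _]mulr_natl natrX.
by rewrite mulrA -exprMn mulVf// expr1n mul1r.
Qed.

Lemma resample_mean_le phi psi : (forall g, phi g <= psi g) ->
  resample_mean phi <= resample_mean psi.
Proof.
by move=> h; rewrite ler_wpM2l ?exprn_ge0 ?invr_ge0//; exact: ler_sum.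
Qed.

Lemma resample_mean_norm phi : `|resample_mean phi| <= resample_mean (fun g => `|phi g|).
Proof.
rewrite ler_norml; apply/andP; split; last first.
  by apply: resample_mean_le => g; exact: ler_norm.
rewrite lerNl -mulN1r -resample_meanZ; apply: resample_mean_le => g.
by rewrite mulN1r -normrN ler_norm.
Qed.

Lemma resample_mean_prod (phi : 'I_n -> 'I_n -> R) :
  resample_mean (fun g => \prod_k phi k (g k)) = \prod_k (n%:R^-1 * \sum_m phi k m).
Proof.
rewrite /resample_mean big_split/= prodr_const card_ord; congr (_ * _).
by rewrite bigA_distr_bigA.
Qed.

Context (r v : 'I_n -> R).
Hypothesis r0 : \sum_i r i = 0.

Definition boot_noise (g : {ffun 'I_n -> 'I_n}) : R := \sum_i v i * r (g i).

Lemma resample_mean_coord (i : 'I_n) (f : 'I_n -> R) :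
  resample_mean (fun g => f (g i)) = n%:R^-1 * \sum_m f m.
Proof.
have -> : resample_mean (fun g => f (g i)) =
    resample_mean (fun g => \prod_k (if k == i then f (g k) else 1)).
  congr (_ * _); apply: eq_bigr => g _.
  by rewrite (bigD1 i)//= eqxx big1 ?mulr1// => k /negbTE ->.
rewrite (resample_mean_prod (fun k m => if k == i then f m else 1)).
rewrite (bigD1 i)//= eqxx [X in _ * X]big1 ?mulr1// => k /negbTE ->.
by rewrite sumr_const card_ord mulVf.
Qed.

Lemma resample_mean_coord2 (i j : 'I_n) : i != j ->
  resample_mean (fun g => r (g i) * r (g j)) = 0.
Proof.
move=> ij.
have -> : resample_mean (fun g => r (g i) * r (g j)) =
    resample_mean (fun g => \prod_k (if (k == i) || (k == j) then r (g k) else 1)).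
  congr (_ * _); apply: eq_bigr => g _.
  rewrite (bigD1 i)//= eqxx/= (bigD1 j) 1?eq_sym//= eqxx orbT mulrA.
  by rewrite big1 ?mulr1// => k /andP[/negbTE -> /negbTE ->].
rewrite (resample_mean_prod (fun k m => if (k == i) || (k == j) then r m else 1)).
by rewrite (bigD1 i)//= eqxx/= r0 mulr0 mul0r.
Qed.

Lemma resample_mean_sum I (s : seq I) (f : I -> {ffun 'I_n -> 'I_n} -> R) :
  resample_mean (fun g => \sum_(i <- s) f i g) = \sum_(i <- s) resample_mean (f i).
Proof. by rewrite /resample_mean exchange_big/= mulr_sumr. Qed.

Lemma resample_mean_noise : resample_mean boot_noise = 0.
Proof.
rewrite resample_mean_sum big1// => i _.
by rewrite resample_meanZ resample_mean_coord r0 !mulr0.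
Qed.

Lemma resample_mean_noise_sqr :
  resample_mean (fun g => boot_noise g ^+ 2) = (\sum_i v i ^+ 2) * (n%:R^-1 * \sum_i r i ^+ 2).
Proof.
have -> : resample_mean (fun g => boot_noise g ^+ 2) =
    resample_mean (fun g => \sum_i \sum_j v i * v j * (r (g i) * r (g j))).
  congr (_ * _); apply: eq_bigr => g _.
  rewrite expr2 /boot_noise mulr_suml; apply: eq_bigr => i _.
  by rewrite mulr_sumr; apply: eq_bigr => j _; ring.
rewrite resample_mean_sum mulr_suml; apply: eq_bigr => i _.
rewrite resample_mean_sum (bigD1 i)//= big1 ?addr0.
  by rewrite resample_meanZ -expr2 (resample_mean_coord i (fun m => r m * r m)).
move=> j ji; rewrite resample_meanZ resample_mean_coord2 ?mulr0//.
by rewrite eq_sym.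
Qed.

End resampling_average.

Section boot_dist_average.
Context {R : realType} {p n : nat} (X : 'M[R]_(n, p)).
Hypothesis Xunit : X^T *m X \in unitmx.
Implicit Types (xf beta : 'cV[R]_p) (e : 'cV[R]_n).

Lemma boot_dist_model xf beta e x :
  let r i := residual X (X *m beta + e) i in
  boot_dist X xf (X *m beta + e) x =
  resample_mean (fun g => n%:R^-1 * \sum_(k < n)
    (`|r k - boot_noise r (leverage X xf) g| <= x)%R%:R).
Proof.
move=> r; rewrite /boot_dist /resample_mean exprSr -mulrA; congr (_ * _).
rewrite mulr_sumr; under [RHS]eq_bigr do rewrite mulr_sumr.
rewrite pair_big/=.
pose ext (gk : {ffun 'I_n -> 'I_n} * 'I_n) : {ffun option 'I_n -> 'I_n} :=
  [ffun o => if o is Some i then gk.1 i else gk.2].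
pose res (f : {ffun option 'I_n -> 'I_n}) : {ffun 'I_n -> 'I_n} * 'I_n :=
  ([ffun i => f (Some i)], f None).
rewrite (reindex ext) /=; last first.
  exists res => [[g k] _|f _].
    by rewrite /res /ext/= ffunE; congr pair; apply/ffunP => i; rewrite !ffunE.
  by apply/ffunP => -[i|]; rewrite /res /ext !ffunE/= ?ffunE.
apply: eq_bigr => -[g k] _ /=.
rewrite boot_root_model// ffunE/=; congr (_ * (`|_ - _| <= _)%R%:R).
by apply: eq_bigr => i _; rewrite ffunE.
Qed.

End boot_dist_average.

Section smooth_cdf.
Context {R : realType} (F f : R -> R) (KF : R).

Definition smooth_cdf := [/\ 1 <= KF,
  forall a b, `|F b - F a - f a * (b - a)| <= KF * (b - a) ^+ 2,
  forall a b, `|f b - f a| <= KF * `|b - a|,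
  forall a b, `|F b - F a| <= KF * `|b - a| &
  [/\ forall a, 0 <= F a <= 1, {homo F : a b / a <= b} & forall a, `|f a| <= KF]].

Hypothesis HF : smooth_cdf.

Definition avg (n : nat) (g : 'I_n -> R) : R := n%:R^-1 * \sum_(i < n) g i.

Lemma avg_le n (g h : 'I_n -> R) : (forall i, g i <= h i) -> avg g <= avg h.
Proof. by move=> gh; rewrite ler_wpM2l ?invr_ge0// ler_sum. Qed.

Lemma avgD n (g h : 'I_n -> R) : avg (fun i => g i + h i) = avg g + avg h.
Proof. by rewrite /avg big_split/= mulrDr. Qed.

Lemma avgB n (g h : 'I_n -> R) : avg (fun i => g i - h i) = avg g - avg h.
Proof. by rewrite /avg sumrB mulrBr. Qed.

Lemma avgZ n a (g : 'I_n -> R) : avg (fun i => a * g i) = a * avg g.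
Proof. by rewrite /avg -mulr_sumr mulrCA. Qed.

Lemma avg_cst n a : (0 < n)%N -> avg (fun _ : 'I_n => a) = a.
Proof.
move=> n0; rewrite /avg sumr_const card_ord -[a *+ _]mulr_natl mulrA mulVf ?mul1r//.
by rewrite pnatr_eq0 -lt0n.
Qed.

Lemma edf_expansion n (e h tlo thi b : 'I_n -> R) (x yc s m H delta : R) :
  (0 < n)%N -> 0 <= s ->
  (forall i, (e i <= tlo i)%R%:R <= b i <= (e i <= thi i)%R%:R) ->
  (forall i, `|tlo i - (x + h i)| <= 5 * s) ->
  (forall i, `|thi i - (x + h i)| <= 5 * s) ->
  `|avg (fun i => (e i <= tlo i)%R%:R - (e i <= yc)%R%:R - (F (tlo i) - F yc))| <= s ->
  `|avg (fun i => (e i <= thi i)%R%:R - (e i <= yc)%R%:R - (F (thi i) - F yc))| <= s ->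
  avg h = m -> (forall i, `|h i| <= H) -> `|x - yc| <= delta ->
  `|avg b - (F x + (avg (fun i => (e i <= yc)%R%:R) - F yc) + f yc * m)|
    <= KF * (6 * s + H ^+ 2 + delta * `|m|).
Proof.
move=> n0 s0 eb tlo5 thi5 olo ohi hm hH xyc.
have [K1 T1 T2 T3 [F01 Fmono fK]] := HF.
have K0 : 0 <= KF by lra.
have core (t : 'I_n -> R) : (forall i, `|t i - (x + h i)| <= 5 * s) ->
    `|avg (F \o t) - (F x + f yc * m)| <= KF * (5 * s + H ^+ 2 + delta * `|m|).
  move=> t5.
  have pt i : `|F (t i) - (F x + f x * h i)| <= KF * (5 * s + H ^+ 2).
    have -> : F (t i) - (F x + f x * h i) =
      (F (t i) - F (x + h i)) + (F (x + h i) - F x - f x * (x + h i - x)) by ring.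
    apply: (le_trans (ler_normD _ _)); rewrite [leRHS]mulrDr; apply: lerD.
      by apply: (le_trans (T3 _ _)); rewrite ler_wpM2l.
    apply: (le_trans (T1 _ _)); rewrite ler_wpM2l//.
    rewrite (_ : x + h i - x = h i); last by ring.
    rewrite -real_normK ?num_real// ler_pXn2r ?nnegrE//.
    exact: le_trans (hH i).
  have av : `|avg (F \o t) - (F x + f x * m)| <= KF * (5 * s + H ^+ 2).
    have -> : avg (F \o t) - (F x + f x * m) = avg (fun i => F (t i) - (F x + f x * h i)).
      by rewrite avgB avgD avg_cst// avgZ hm.
    rewrite ler_norml; apply/andP; split.
      rewrite -(avg_cst (- _) n0); apply: avg_le => i.
      by have := pt i; rewrite ler_norml => /andP[].
    rewrite -[leRHS](avg_cst _ n0); apply: avg_le => i.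
    by have := pt i; rewrite ler_norml => /andP[].
  have -> : avg (F \o t) - (F x + f yc * m) =
    (avg (F \o t) - (F x + f x * m)) + (f x - f yc) * m by ring.
  apply: (le_trans (ler_normD _ _)); rewrite [leRHS]mulrDr; apply: lerD => //.
  rewrite normrM mulrA ler_wpM2r//.
  by apply: (le_trans (T2 _ _)); rewrite ler_wpM2l.
have lo : avg (fun i => (e i <= tlo i)%R%:R) <= avg b.
  by apply: avg_le => i; have /andP[] := eb i.
have hi : avg b <= avg (fun i => (e i <= thi i)%R%:R).
  by apply: avg_le => i; have /andP[] := eb i.
have clo := core tlo tlo5; have chi := core thi thi5.
move: olo ohi; rewrite !avgB !avg_cst//.
rewrite -[avg (fun i => F (tlo i))]/(avg (F \o tlo)) -[avg (fun i => F (thi i))]/(avg (F \o thi)).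
move: lo hi clo chi.
set a1 := avg (fun i => (e i <= tlo i)%R%:R); set a2 := avg (fun i => (e i <= thi i)%R%:R).
set a3 := avg (fun i => (e i <= yc)%R%:R); set a4 := avg b.
set b1 := avg (F \o tlo); set b2 := avg (F \o thi).
have sK : s <= KF * s by rewrite ler_peMl.
have -> : KF * (6 * s + H ^+ 2 + delta * `|m|) = KF * s + KF * (5 * s + H ^+ 2 + delta * `|m|) by ring.
set E := KF * (5 * s + _ + _).
rewrite !ler_norml => h1 h2 /andP[h3 h4] /andP[h5 h6] /andP[h7 h8] /andP[h9 h10].
apply/andP; split; lra.
Qed.

Lemma boot_expansion n (r v : 'I_n -> R) (c x delta err W1 W2 : R) :
  (0 < n)%N -> \sum_i r i = 0 -> 0 < x -> 0 < delta -> `|x - c| <= delta / 2 ->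
  0 <= err -> `|W1 - W2| <= 3 ->
  (forall z, `|z - c| <= delta ->
     `|avg (fun k => (r k <= z)%R%:R) - (F z + W1)| <= err) ->
  (forall z, `|z + c| <= delta ->
     `|avg (fun k => (r k < z)%R%:R) - (F z + W2)| <= err) ->
  `|resample_mean (fun g => avg (fun k => (`|r k - boot_noise r v g| <= x)%R%:R))
     - (F x - F (- x) + (W1 - W2))|
   <= 2 * err + (20 / delta ^+ 2 + 2 * KF) * resample_mean (fun g => boot_noise r v g ^+ 2).
Proof.
move=> n0 r0 x0 d0 xc err0 W3 E1 E2.
set eta := boot_noise r v.
have [K1 T1 T2 T3 [F01 Fmono fK]] := HF.
have K0 : 0 <= KF by lra.
pose kap := f x - f (- x).
pose B g := avg (fun k => (`|r k - eta g| <= x)%R%:R : R).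
have BE g : B g = avg (fun k => (r k <= eta g + x)%R%:R) - avg (fun k => (r k < eta g - x)%R%:R).
  rewrite -avgB; congr (_ * _); apply: eq_bigr => k _.
  rewrite ler_distl.
  case: (ltP (r k) (eta g - x)) => /= h; last by rewrite subr0.
  by rewrite (_ : _ <= _) ?subrr//; lra.
have avg01 (b : 'I_n -> bool) : 0 <= avg (fun k => (b k)%:R) <= 1.
  apply/andP; split; first by rewrite mulr_ge0 ?invr_ge0 ?sumr_ge0.
  by apply: (@le_trans _ _ (avg (fun _ : 'I_n => 1))); [apply: avg_le => k; case: (b k)|rewrite avg_cst].
have d20 : 0 < delta ^+ 2 by rewrite exprn_gt0.
have pt g : `|B g - (F x - F (- x) + (W1 - W2)) - kap * eta g| <=
    2 * err + (20 / delta ^+ 2 + 2 * KF) * eta g ^+ 2.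
  have S1 := T1 x (x + eta g); have S2 := T1 (- x) (- x + eta g).
  rewrite (_ : x + eta g - x = eta g) in S1; last by ring.
  rewrite (_ : - x + eta g - - x = eta g) in S2; last by ring.
  have q0 := sqr_ge0 (eta g).
  have main : `|B g - (F (x + eta g) - F (- x + eta g) + (W1 - W2))| <= 2 * err + 20 / delta ^+ 2 * eta g ^+ 2.
    have [small|large] := leP `|eta g| (delta / 2).
      have e1 := E1 (x + eta g); have e2 := E2 (- x + eta g).
      have c1 : `|x + eta g - c| <= delta.
        rewrite (_ : x + eta g - c = (x - c) + eta g); last by ring.
        by apply: (le_trans (ler_normD _ _)); lra.
      have c2 : `|- x + eta g + c| <= delta.
        rewrite (_ : - x + eta g + c = - (x - c) + eta g); last by ring.
        by apply: (le_trans (ler_normD _ _)); rewrite normrN; lra.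
      move: (e1 c1) (e2 c2); rewrite BE [eta g + x]addrC [eta g - x]addrC.
      have z0 : 0 <= 20 / delta ^+ 2 * eta g ^+ 2 by rewrite mulr_ge0// divr_ge0// ltW.
      rewrite !ler_norml => /andP[? ?] /andP[? ?]; apply/andP; split; lra.
    have l1 : 5 <= 20 / delta ^+ 2 * eta g ^+ 2.
      rewrite mulrAC ler_pdivlMr//.
      have : (delta / 2) ^+ 2 <= `|eta g| ^+ 2 by rewrite ler_pXn2r ?nnegrE// ?ltW// divr_gt0.
      by rewrite real_normK ?num_real// expr_div_n; lra.
    have := avg01 (fun k => `|r k - eta g| <= x); rewrite -/(B g) => /andP[b0 b1].
    have /andP[f1 f2] := F01 (x + eta g); have /andP[f3 f4] := F01 (- x + eta g).
    move: W3; rewrite !ler_norml => /andP[w1 w2]; apply/andP; split; lra.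
  rewrite [leRHS](_ : _ = 2 * err + 20 / delta ^+ 2 * eta g ^+ 2 + 2 * KF * eta g ^+ 2); last by ring.
  rewrite (_ : B g - _ - _ = (B g - (F (x + eta g) - F (- x + eta g) + (W1 - W2)))
     + ((F (x + eta g) - F x - f x * eta g) - (F (- x + eta g) - F (- x) - f (- x) * eta g))); last first.
    by rewrite /kap; ring.
  apply: (le_trans (ler_normD _ _)); apply: lerD => //.
  by apply: (le_trans (ler_normB _ _)); lra.
have -> : resample_mean B - (F x - F (- x) + (W1 - W2)) =
    resample_mean (fun g => B g - (F x - F (- x) + (W1 - W2)) - kap * eta g).
  rewrite (_ : (fun g => _ - _ - _) = (fun g => (B g + - (F x - F (- x) + (W1 - W2))) + (- kap) * eta g)); last first.
    by apply/funext => g; ring.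
  have mean0 : resample_mean eta = 0 by exact: resample_mean_noise.
  rewrite (resample_meanD (fun g => B g + _) (fun g => - kap * eta g)).
  rewrite (resample_meanD B (fun=> _)) (resample_meanZ (- kap) eta).
  rewrite (resample_mean_cst n0) mean0.
  by rewrite mulr0 addr0.
apply: (le_trans (resample_mean_norm _)).
apply: (le_trans (resample_mean_le pt)).
by rewrite (resample_meanD (fun=> _) (fun g => _ * _)) (resample_mean_cst n0) resample_meanZ.
Qed.

Lemma coverage_above (c level fp kap t b delta E W crit : R) (G : R -> R) :
  let q := c - kap * t / fp + b in
  F c - F (- c) = level -> fp = f c + f (- c) -> kap = f c - f (- c) -> 0 < fp ->
  (forall x, G x < level -> x <= crit) ->
  (forall x, `|x - c| <= delta -> `|G x - (F x - F (- x) + W)| <= E) ->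
  `|q - c| <= delta -> 2 * KF * (`|q - c| + `|t|) ^+ 2 <= fp * b ->
  W - kap * t < - (E + 2 * (fp * b)) ->
  level <= F (t + crit) - F (t - crit).
Proof.
move=> q Fc fpE kapE fp0 Gcrit GW qd small WE.
have [K1 T1 T2 T3 [F01 Fmono fK]] := HF.
have K0 : 0 <= KF by lra.
have qc : fp * (q - c) = - (kap * t) + fp * b by rewrite /q; field; rewrite gt_eqF.
have big (u : R) : `|u| <= `|q - c| + `|t| -> 2 * KF * u ^+ 2 <= fp * b.
  move=> h; apply: le_trans small; rewrite ler_wpM2l ?mulr_ge0//.
  by rewrite -real_normK ?num_real// ler_pXn2r ?nnegrE ?addr_ge0.
have Gq : q <= crit.
  apply: Gcrit.
  have := GW q qd; have := T1 c q; have := T1 (- c) (- q).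
  have := big (q - c); rewrite lerDl normr_ge0 => /(_ isT).
  rewrite (_ : - q - - c = - (q - c)); last by ring.
  rewrite sqrrN !ler_norml => h /andP[? ?] /andP[? ?] /andP[? ?].
  have : f (- c) * - (q - c) = - (f (- c) * (q - c)) by ring.
  have : fp * (q - c) = f c * (q - c) + f (- c) * (q - c) by rewrite fpE; ring.
  lra.
apply: (@le_trans _ _ (F (t + q) - F (t - q))); last first.
  by apply: lerB; apply: Fmono; lra.
have := T1 c (t + q); have := T1 (- c) (t - q).
have := big (t + q - c); have := big (t - q - - c).
have n1 : `|t - q - - c| <= `|q - c| + `|t|.
  rewrite (_ : t - q - - c = - (q - c) + t); last by ring.
  by rewrite -[`|q - c|]normrN ler_normD.
have n2 : `|t + q - c| <= `|q - c| + `|t|.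
  by rewrite (_ : t + q - c = (q - c) + t) ?ler_normD//; ring.
move=> /(_ n1) h1 /(_ n2) h2.
rewrite !ler_norml => /andP[? ?] /andP[? ?].
have : f c * (t + q - c) - f (- c) * (t - q - - c) = fp * (q - c) + kap * t.
  by rewrite fpE kapE; ring.
lra.
Qed.

Lemma coverage_below (c level fp kap t b delta E W crit : R) (G : R -> R) :
  let q := c - kap * t / fp - b in
  F c - F (- c) = level -> fp = f c + f (- c) -> kap = f c - f (- c) -> 0 < fp ->
  (forall x, level <= G x -> crit <= x) ->
  (forall x, `|x - c| <= delta -> `|G x - (F x - F (- x) + W)| <= E) ->
  `|q - c| <= delta -> 2 * KF * (`|q - c| + `|t|) ^+ 2 < fp * b ->
  E + 2 * (fp * b) < W - kap * t ->
  F (t + crit) - F (t - crit) < level.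
Proof.
move=> q Fc fpE kapE fp0 Gcrit GW qd small WE.
have [K1 T1 T2 T3 [F01 Fmono fK]] := HF.
have K0 : 0 <= KF by lra.
have qc : fp * (q - c) = - (kap * t) - fp * b by rewrite /q; field; rewrite gt_eqF.
have big (u : R) : `|u| <= `|q - c| + `|t| -> 2 * KF * u ^+ 2 < fp * b.
  move=> h; apply: le_lt_trans small; rewrite ler_wpM2l ?mulr_ge0//.
  by rewrite -real_normK ?num_real// ler_pXn2r ?nnegrE ?addr_ge0.
have Gq : crit <= q.
  apply: Gcrit.
  have := GW q qd; have := T1 c q; have := T1 (- c) (- q).
  have := big (q - c); rewrite lerDl normr_ge0 => /(_ isT).
  rewrite (_ : - q - - c = - (q - c)); last by ring.
  rewrite sqrrN !ler_norml => h /andP[? ?] /andP[? ?] /andP[? ?].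
  have : f (- c) * - (q - c) = - (f (- c) * (q - c)) by ring.
  have : fp * (q - c) = f c * (q - c) + f (- c) * (q - c) by rewrite fpE; ring.
  lra.
apply: (@le_lt_trans _ _ (F (t + q) - F (t - q))).
  by apply: lerB; apply: Fmono; lra.
have := T1 c (t + q); have := T1 (- c) (t - q).
have := big (t + q - c); have := big (t - q - - c).
have n1 : `|t - q - - c| <= `|q - c| + `|t|.
  rewrite (_ : t - q - - c = - (q - c) + t); last by ring.
  by rewrite -[`|q - c|]normrN ler_normD.
have n2 : `|t + q - c| <= `|q - c| + `|t|.
  by rewrite (_ : t + q - c = (q - c) + t) ?ler_normD//; ring.
move=> /(_ n1) h1 /(_ n2) h2.
rewrite !ler_norml => /andP[? ?] /andP[? ?].
have : f c * (t + q - c) - f (- c) * (t - q - - c) = fp * (q - c) + kap * t.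
  by rewrite fpE kapE; ring.
lra.
Qed.

End smooth_cdf.

Section regularity.
Context {R : realType}.

Lemma smooth_cdf_of_derivable (F : R -> R) :
  (forall x, 0 <= F x <= 1) -> {homo F : a b / a <= b} ->
  (forall x, derivable F x 1) -> (forall x, derivable (derive1 F) x 1) ->
  (forall x, 0 < derive1 F x) ->
  has_ubound (range (fun x => `|derive1n 2 F x|)) ->
  exists KF, smooth_cdf F (derive1 F) KF.
Proof.
move=> F01 Fmono dF ddF F'0 [M MF].
pose K : R := `|M|.
have ddK x : `|derive1 (derive1 F) x| <= K.
  apply: (le_trans _ (ler_norm M)); apply: MF; exists x => //.
have is1 (x : R) : is_derive x (1 : R) F (derive1 F x).
  by apply: DeriveDef; [exact: dF|rewrite derive1E].
have is2 (x : R) : is_derive x (1 : R) (derive1 F) (derive1 (derive1 F) x).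
  by apply: DeriveDef; [exact: ddF|rewrite [RHS]derive1E].
have lip a b : `|derive1 F b - derive1 F a| <= K * `|b - a|.
  exact: (lipschitz_of_derive (fun z _ => is2 z) (fun z _ => ddK z)).
have tay a b : `|F b - F a - derive1 F a * (b - a)| <= K * (b - a) ^+ 2.
  rewrite -[(b - a) ^+ 2]real_normK ?num_real//.
  exact: (taylor_order1 (fun z _ => is1 z) (fun z _ => lip a z)).
have bd x : derive1 F x <= 1 + K.
  have := tay x (x + 1); rewrite (_ : x + 1 - x = 1) ?mulr1 ?expr1n ?mulr1; last by ring.
  have /andP[? ?] := F01 x; have /andP[? ?] := F01 (x + 1).
  by rewrite ler_norml => /andP[? ?]; lra.
have K0 : 0 <= K by exact: normr_ge0.
exists (1 + K); split.
- by lra.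
- by move=> a b; apply: (le_trans (tay a b)); have := sqr_ge0 (b - a); nra.
- by move=> a b; apply: (le_trans (lip a b)); rewrite ler_wpM2r//; lra.
- move=> a b; apply: (lipschitz_of_derive (fun z _ => is1 z)) => z _.
  by rewrite gtr0_norm.
- by split => // a; rewrite gtr0_norm.
Qed.

End regularity.

Section matrix_limits.
Context {R : realType}.

Definition entrywise_cvg m n (M : nat -> 'M[R]_(m, n)) (A : 'M[R]_(m, n)) :=
  forall i j, M k i j @[k --> \oo] --> A i j.

Lemma entrywise_cvgP m n (M : nat -> 'M[R]_(m, n)) A :
  M k @[k --> \oo] --> A -> entrywise_cvg M A.
Proof.
move=> MA i j.
have h := @coord_continuous R m n i j A.
exact: (cvg_comp (fun k => M k) (fun B : 'M[R]_(m, n) => B i j) MA h).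
Qed.

Lemma cvg_sumr I (r : seq I) (f : I -> nat -> R) (l : I -> R) :
  (forall i, f i k @[k --> \oo] --> l i) ->
  (\sum_(i <- r) f i k) @[k --> \oo] --> \sum_(i <- r) l i.
Proof.
move=> fl; elim: r => [|i r ih].
  rewrite big_nil; under eq_fun do rewrite big_nil; exact: cvg_cst.
rewrite big_cons; under eq_fun do rewrite big_cons; exact: cvgD.
Qed.

Lemma cvg_prodr I (r : seq I) (f : I -> nat -> R) (l : I -> R) :
  (forall i, f i k @[k --> \oo] --> l i) ->
  (\prod_(i <- r) f i k) @[k --> \oo] --> \prod_(i <- r) l i.
Proof.
move=> fl; elim: r => [|i r ih].
  rewrite big_nil; under eq_fun do rewrite big_nil; exact: cvg_cst.
rewrite big_cons; under eq_fun do rewrite big_cons; exact: cvgM.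
Qed.

Lemma entrywise_cvg_cst m n (A : 'M[R]_(m, n)) : entrywise_cvg (fun=> A) A.
Proof. by move=> i j; exact: cvg_cst. Qed.

Lemma entrywise_cvgM m n q (M : nat -> 'M[R]_(m, n)) (N : nat -> 'M[R]_(n, q)) A B :
  entrywise_cvg M A -> entrywise_cvg N B ->
  entrywise_cvg (fun k => M k *m N k) (A *m B).
Proof.
move=> MA NB i j; rewrite mxE; under eq_fun do rewrite mxE.
by apply: cvg_sumr => k; apply: cvgM.
Qed.

Lemma entrywise_cvg_det n (M : nat -> 'M[R]_n) A :
  entrywise_cvg M A -> \det (M k) @[k --> \oo] --> \det A.
Proof.
move=> MA; apply: cvg_sumr => s; apply: cvgM; first exact: cvg_cst.
by apply: cvg_prodr => i.
Qed.

Lemma entrywise_cvg_inv n (M : nat -> 'M[R]_n) A : A \in unitmx ->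
  (\forall k \near \oo, M k \in unitmx) ->
  entrywise_cvg M A -> entrywise_cvg (fun k => invmx (M k)) (invmx A).
Proof.
move=> Au Mu MA i j.
have dA : \det A != 0 by rewrite -unitfE -unitmxE.
have cdet := entrywise_cvg_det MA.
have cadj : \adj (M k) i j @[k --> \oo] --> \adj A i j.
  rewrite mxE; under eq_fun do rewrite mxE.
  apply: cvgM; first exact: cvg_cst.
  apply: entrywise_cvg_det => a b.
  by rewrite !mxE; under eq_fun do rewrite !mxE; exact: MA.
have E B : B \in unitmx -> invmx B i j = (\det B)^-1 * \adj B i j.
  by move=> Bu; rewrite /invmx Bu mxE.
rewrite E//.
have : ((\det (M k))^-1 * \adj (M k) i j) @[k --> \oo] --> (\det A)^-1 * \adj A i j.
  by apply: cvgM => //; exact: cvgV.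
apply: cvg_trans; apply: near_eq_cvg; near=> k.
by rewrite E//; near: k.
Unshelve. all: by end_near. Qed.

End matrix_limits.

Section design_limits.
Context {R : realType} {p : nat}.
Context (X : forall n, 'M[R]_(n, p)) (xf b : 'cV[R]_p) (A : 'M[R]_p).
Hypothesis p_gt0 : (0 < p)%N.
Hypothesis regX : regular_design X xf A b.

Lemma norm_entry_le (v : 'cV[R]_p) j : `|v j ord0| <= norm2 v.
Proof.
rewrite /norm2 -sqrtr_sqr ler_wsqrtr// (bigD1 j)//= lerDl sumr_ge0// => i _.
exact: sqr_ge0.
Qed.

Lemma dotvC (m : nat) (u v : 'cV[R]_m) : dotv u v = dotv v u.
Proof. by rewrite !dotvE; apply: eq_bigr => j _; rewrite mulrC. Qed.

Lemma dotvZr (m : nat) a (u v : 'cV[R]_m) : dotv u (a *: v) = a * dotv u v.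
Proof. by rewrite dotvC dotvZl dotvC. Qed.

Lemma sum_leverage_sqr n (Y : 'M[R]_(n, p)) : Y^T *m Y \in unitmx ->
  \sum_i leverage Y xf i ^+ 2 = dotv xf (invmx (Y^T *m Y) *m xf).
Proof.
move=> Yu; set V := invmx _.
pose u := V^T *m xf.
have vE i : leverage Y xf i = (Y *m u) i ord0.
  rewrite mul_design_entry /leverage -/V /dotv /u.
  by rewrite -/(dotv xf _) -/(dotv (regressor Y i) _) [RHS]dotvC /dotv trmx_mul trmxK mulmxA.
rewrite (eq_bigr (fun i => (Y *m u) i ord0 * (Y *m u) i ord0)); last first.
  by move=> i _; rewrite vE expr2.
rewrite -dotvE /dotv trmx_mul -mulmxA [Y^T *m (Y *m u)]mulmxA.
rewrite [u^T](_ : _ = xf^T *m V); last by rewrite trmx_mul trmxK.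
rewrite -mulmxA [V *m (_ *m u)]mulmxA mulVmx// mul1mx.
have uT : u^T = xf^T *m V by rewrite trmx_mul trmxK.
by rewrite -[LHS]/(dotv xf u) dotvC /dotv uT mulmxA.
Qed.

Let S n := n%:R^-1 *: ((X n)^T *m X n).

Lemma scaled_gram_inv n : (p <= n)%N ->
  invmx ((X n)^T *m X n) = n%:R^-1 *: invmx (S n).
Proof.
case: regX => Xu _ _ _ _ pn.
have n0 : n%:R != 0 :> R by rewrite pnatr_eq0 -lt0n (leq_trans p_gt0).
have un : n%:R^-1 \is a @GRing.unit R by rewrite unitfE invr_eq0.
rewrite /S invmxZ ?unitmxZ ?Xu// scalerA mulfV ?scale1r// invr_eq0//.
Qed.

Lemma cvg_gram_inv : entrywise_cvg (fun n => invmx (S n)) (invmx A).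
Proof.
case: regX => Xu Au SA _ _.
apply: entrywise_cvg_inv => //; last exact: entrywise_cvgP.
near=> n.
have pn : (p <= n)%N by near: n; exists p.
have n0 : n%:R != 0 :> R by rewrite pnatr_eq0 -lt0n (leq_trans p_gt0).
by rewrite /S unitmxZ ?Xu// unitfE invr_eq0.
Unshelve. all: by end_near. Qed.

Lemma cvg_leverage_sqr :
  n%:R * (\sum_i leverage (X n) xf i ^+ 2) @[n --> \oo] --> dotv xf (invmx A *m xf).
Proof.
have : dotv xf (invmx (S n) *m xf) @[n --> \oo] --> dotv xf (invmx A *m xf).
  apply: (@entrywise_cvgM R _ _ _ (fun=> xf^T) _ xf^T) => //.
    exact: entrywise_cvg_cst.
  by apply: entrywise_cvgM; [exact: cvg_gram_inv|exact: entrywise_cvg_cst].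
apply: cvg_trans; apply: near_eq_cvg; near=> n.
have pn : (p <= n)%N by near: n; exists p.
have n0 : n%:R != 0 :> R by rewrite pnatr_eq0 -lt0n (leq_trans p_gt0).
case: regX => Xu _ _ _ _.
rewrite sum_leverage_sqr ?Xu// scaled_gram_inv// -scalemxAl dotvZr.
by rewrite mulrA divff// mul1r.
Unshelve. all: by end_near. Qed.

Lemma cvg_leverage_sum :
  (\sum_i leverage (X n) xf i) @[n --> \oo] --> dotv xf (invmx A *m b).
Proof.
have : dotv xf (invmx (S n) *m xbar (X n)) @[n --> \oo] --> dotv xf (invmx A *m b).
  apply: (@entrywise_cvgM R _ _ _ (fun=> xf^T) _ xf^T) => //.
    exact: entrywise_cvg_cst.
  apply: entrywise_cvgM; first exact: cvg_gram_inv.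
  by apply: entrywise_cvgP; case: regX.
apply: cvg_trans; apply: near_eq_cvg; near=> n.
have pn : (p <= n)%N by near: n; exists p.
have n0 : n%:R != 0 :> R by rewrite pnatr_eq0 -lt0n (leq_trans p_gt0).
rewrite /xbar -scalemxAr dotvZr /leverage scaled_gram_inv// mulmx_sumr.
rewrite dotvC dotv_suml mulr_sumr; apply: eq_bigr => i _.
by rewrite -scalemxAl dotvZr dotvC.
Unshelve. all: by end_near. Qed.

Lemma design_bounds : exists2 C : R, 1 <= C & \forall n \near \oo,
  [/\ forall i, `|leverage (X n) xf i| <= C / n%:R,
      forall j i, `|estimator_weight (X n) j i| <= C / n%:R &
      forall i j, `|(regressor (X n) i - xbar (X n)) j ord0| <= C].
Proof.
case: (regX) => Xu Au SA xA [M M0 [XM xfM]].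
pose B := 1 + \sum_j \sum_k `|invmx A j k|.
have B1 : 1 <= B by rewrite lerDl; apply: sumr_ge0 => j _; apply: sumr_ge0.
have p1 : 1 <= p%:R :> R by rewrite ler1n.
pose W := p%:R * (B * M).
have W0 : 0 <= W by rewrite !mulr_ge0// ltW// (lt_le_trans _ B1).
pose C := 1 + W + p%:R * (M * W) + 2 * M.
have q0 : 0 <= p%:R * (M * W) by rewrite mulr_ge0// mulr_ge0// ltW.
exists C; first by rewrite /C; lra.
have invB : \forall n \near \oo, forall jk : 'I_p * 'I_p, `|invmx (S n) jk.1 jk.2| <= B.
  apply: filter_forall => -[j k] /=.
  have /cvgrPdist_le /(_ 1 ltr01) := @cvg_gram_inv j k.
  apply: filterS => n h.
  have : `|invmx (S n) j k| <= `|invmx A j k| + 1.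
    rewrite -[invmx (S n) j k](subKr (invmx A j k)).
    by apply: (le_trans (ler_normB _ _)); rewrite lerD2l.
  move/le_trans; apply; rewrite addrC /B lerD2l.
  rewrite (bigD1 j)//= (bigD1 k)//= -addrA lerDl addr_ge0// sumr_ge0// => i _.
  by rewrite sumr_ge0.
near=> n.
have pn : (p <= n)%N by near: n; exists p.
have n0 : 0 < n%:R :> R by rewrite ltr0n (leq_trans p_gt0).
have nB : forall jk : 'I_p * 'I_p, `|invmx (S n) jk.1 jk.2| <= B by near: n.
have xe i j : `|regressor (X n) i j ord0| <= M.
  exact: (le_trans (norm_entry_le _ _) (XM _ _ pn)).
have in0 : 0 < n%:R^-1 :> R by rewrite invr_gt0.
have ew j i : `|estimator_weight (X n) j i| <= W / n%:R.
  rewrite /estimator_weight scaled_gram_inv// -scalemxAl mxE normrM (gtr0_norm in0) mulrC.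
  rewrite ler_pM2r// mxE.
  apply: (le_trans (ler_norm_sum _ _ _)).
  apply: (@le_trans _ _ (\sum_(k < p) B * M)).
    apply: ler_sum => k _; rewrite normrM ler_pM//; exact: (nB (j, k)).
  by rewrite sumr_const card_ord /W -[_ *+ p]mulr_natl.
have WC : W <= C by rewrite /C; lra.
split.
- move=> i; rewrite /leverage dotvE.
  apply: (le_trans (ler_norm_sum _ _ _)).
  apply: (@le_trans _ _ (\sum_(k < p) M * (W / n%:R))).
    apply: ler_sum => k _; rewrite normrM ler_pM//; last exact: ew.
    exact: (le_trans (norm_entry_le _ _) xfM).
  rewrite sumr_const card_ord -[leLHS]mulr_natl.
  rewrite [leLHS](_ : _ = p%:R * (M * W) / n%:R); last by ring.
  by rewrite ler_pM2r// /C; lra.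
- by move=> j i; apply: (le_trans (ew j i)); rewrite ler_pM2r.
- move=> i j; rewrite !mxE.
  have x1 := xe i j; rewrite !mxE in x1.
  apply: (le_trans (ler_normB _ _)).
  rewrite summxE normrM gtr0_norm//.
  have : `|\sum_(i0 < n) regressor (X n) i0 j ord0| <= n%:R * M.
    apply: (le_trans (ler_norm_sum _ _ _)).
    apply: (@le_trans _ _ (\sum_(k < n) M)); first by apply: ler_sum.
    by rewrite sumr_const card_ord -[_ *+ n]mulr_natl.
  rewrite -(ler_pM2l in0) mulKf ?gt_eqF// => x2.
  by apply: (le_trans (lerD x1 x2)); rewrite /C; lra.
Unshelve. all: by end_near. Qed.

End design_limits.

Section score_clt.
Context {R : realType} {d : measure_display} {T : measurableType d}.
Context (P : probability T R) (eps : nat -> {RV P >-> R}).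
Context (F : R -> R) (sigma : R).
Hypothesis iidE : forall n, iid (fun i : 'I_n => eps i) F.
Hypothesis varE : ('V_P[eps 0%N] = (sigma ^+ 2)%R%:E)%E.
Hypothesis meanE : ('E_P[eps 0%N] = 0)%E.
Hypothesis fourthE : ('E_P[fun w => (`|eps 0%N w| ^+ 4)%R] < +oo)%E.
Local Notation H := (trunc_mean eps).

Lemma standardized_summandN g v m3 : standardized_summand eps g v m3 ->
  standardized_summand eps (fun x => - g x) v m3.
Proof.
move=> [q1 q2 q3 [m1 m2 m3']].
have E1 : (fun x => - g x) = (fun x => -1 * g x) by apply/funext => x; rewrite mulN1r.
have E2 : (fun x => (- g x) ^+ 2) = (fun x => g x ^+ 2) by apply/funext => x; rewrite sqrrN.
have E3 : (fun x => `|- g x| ^+ 3) = (fun x => `|g x| ^+ 3) by apply/funext => x; rewrite normrN.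
split.
- by rewrite E1; exact: quartic_growthZ.
- by rewrite E2.
- by rewrite E3.
split; first by rewrite E1 error_meanZ// m1 mulr0.
  by rewrite E2.
by rewrite E3.
Qed.

Context (c kap : R).
Hypothesis c0 : 0 < c.
Let level : R := F c - F (- c).

Definition score (s u x : R) : R :=
  s^-1 * ((x <= c)%R%:R - (x <= - c)%R%:R - (F c - F (- c)) + kap * u * x).

Definition score_var (u : R) : R :=
  level - level ^+ 2 + (kap * u) ^+ 2 * sigma ^+ 2 + 2 * (kap * u) * (H c - H (- c)).

Lemma score_standardized (s u B : R) : 0 < s -> `|kap * u| <= B ->
  standardized_summand eps (score s u) (score_var u / s ^+ 2)
    ((32 + 4 * B ^+ 3 * error_mean eps (fun x => `|x| ^+ 3)) / s ^+ 3).
Proof.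
move=> s0 uB; set be := kap * u in uB *.
pose D (x : R) : R := (x <= c)%R%:R - (x <= - c)%R%:R.
have cc : - c <= c by rewrite (@le_trans _ _ 0)// ?oppr_le0 ltW.
have D01 x : 0 <= D x <= 1.
  rewrite /D; case: (leP x (- c)) => [xc|_]; first by rewrite (le_trans xc cc) subrr lexx ler01.
  by case: (x <= c); rewrite subr0 ?lexx ?ler01.
have D2 x : D x ^+ 2 = D x.
  rewrite /D; case: (leP x (- c)) => [xc|_]; first by rewrite (le_trans xc cc) subrr expr0n.
  by case: (x <= c); rewrite subr0 ?expr1n ?expr0n.
have l01 : 0 <= level <= 1.
  rewrite /level subr_ge0 (cdfF_nondecreasing iidE fourthE cc)/=.
  have := cdfF_ge0 iidE (- c); have := cdfF_le1 iidE fourthE c. lra.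
have qi1 := @quartic_growth_ind R c; have qi2 := @quartic_growth_ind R (- c).
have qD : quartic_growth D.
  rewrite (_ : D = fun x => (x <= c)%R%:R + -1 * (x <= - c)%R%:R); last first.
    by apply/funext => x; rewrite mulN1r.
  by apply: quartic_growthD => //; exact: quartic_growthZ.
have qid : quartic_growth (fun x : R => x) := @quartic_growth_id R.
have qsq := @quartic_growth_sqr R; have qcu := @quartic_growth_cube R.
have qx : quartic_growth (fun x => x * D x).
  apply: (quartic_growth_le _ qid).
    by apply: measurable_funM => //; case: qD.
  by move=> x; rewrite normrM ler_piMr//; have /andP[? ?] := D01 x; rewrite ger0_norm.
have mD : error_mean eps D = level.
  rewrite (_ : D = fun x => 0 + 1 * ((x <= c)%R%:R - (x <= - c)%R%:R)); last first.
    by apply/funext => x; rewrite mul1r add0r.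
  by rewrite (error_mean_diff_ind iidE fourthE) mul1r add0r.
have mxD : error_mean eps (fun x => x * D x) = H c - H (- c).
  rewrite (_ : (fun _ => _) = fun x => x * (x <= c)%R%:R + -1 * (x * (x <= - c)%R%:R)); last first.
    by apply/funext => x; rewrite /D; ring.
  have qa := @quartic_growth_mulind R c; have qb := @quartic_growth_mulind R (- c).
  rewrite error_meanD//; last exact: quartic_growthZ.
  by rewrite error_meanZ// !error_mean_mulind mulN1r.
have gE x : score s u x = s^-1 * (D x + - level) + s^-1 * be * x.
  by rewrite /score -/be /D /level; ring.
have qg : quartic_growth (score s u).
  rewrite (_ : score s u = fun x => s^-1 * (D x + - level) + s^-1 * be * x); last exact/funext.
  apply: quartic_growthD; last exact: quartic_growthZ.
  by apply: quartic_growthZ; apply: quartic_growthD => //; exact: quartic_growth_cst.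
have mg : measurable_fun setT (score s u) by case: qg.
pose G2 (x : R) : R := s^-1 ^+ 2 * level ^+ 2 + ((s^-1 ^+ 2 * (1 - 2 * level)) * D x
   + ((s^-1 ^+ 2 * 2 * be) * (x * D x) + ((- (s^-1 ^+ 2 * 2 * be * level)) * x
   + (s^-1 ^+ 2 * be ^+ 2) * x ^+ 2))).
have g2E : (fun x => score s u x ^+ 2) = G2.
  apply/funext => x; rewrite gE /G2.
  have h := D2 x; rewrite [LHS](_ : _ = s^-1 ^+ 2 * (D x ^+ 2 - 2 * level * D x + level ^+ 2
     + 2 * be * (x * D x) - 2 * be * level * x + be ^+ 2 * x ^+ 2)); last by ring.
  by rewrite h; ring.
have z1 := quartic_growthZ (s^-1 ^+ 2 * be ^+ 2) qsq.
have z2 := quartic_growthZ (- (s^-1 ^+ 2 * 2 * be * level)) qid.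
have z3 := quartic_growthD z2 z1.
have z4 := quartic_growthZ (s^-1 ^+ 2 * 2 * be) qx.
have z5 := quartic_growthD z4 z3.
have z6 := quartic_growthZ (s^-1 ^+ 2 * (1 - 2 * level)) qD.
have z7 := quartic_growthD z6 z5.
have qg2 : quartic_growth (fun x => score s u x ^+ 2).
  by rewrite g2E; apply: quartic_growthD => //; exact: quartic_growth_cst.
pose G3 (x : R) : R := 32 / s ^+ 3 + (4 * B ^+ 3 / s ^+ 3) * `|x| ^+ 3.
have B0 : 0 <= B by exact: le_trans uB.
have qG3 : quartic_growth G3.
  by apply: quartic_growthD; [exact: quartic_growth_cst|exact: quartic_growthZ].
have g3 x : `|score s u x| ^+ 3 <= G3 x.
  have : `|score s u x| <= s^-1 * (2 + B * `|x|).
    rewrite gE -mulrA -mulrDr normrM gtr0_norm ?invr_gt0// ler_pM2l ?invr_gt0//.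
    apply: (le_trans (ler_normD _ _)); apply: lerD.
      by have /andP[? ?] := D01 x; rewrite ler_norml; apply/andP; split; lra.
    by rewrite normrM ler_wpM2r.
  have y0 : 0 <= B * `|x| by rewrite mulr_ge0.
  move=> h; apply: (@le_trans _ _ ((s^-1 * (2 + B * `|x|)) ^+ 3)).
    by rewrite ler_pXn2r ?nnegrE// ?mulr_ge0 ?invr_ge0 ?(ltW s0)//; lra.
  rewrite exprMn /G3 (_ : _ + _ = s^-1 ^+ 3 * (4 * (8 + (B * `|x|) ^+ 3))); last first.
    by rewrite exprVn; field; rewrite gt_eqF.
  rewrite ler_pM2l ?exprn_gt0 ?invr_gt0//.
  set y := B * `|x| in y0 *.
  rewrite -subr_ge0 (_ : _ - _ = 3 * (2 + y) * (2 - y) ^+ 2); last by ring.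
  by rewrite mulr_ge0 ?sqr_ge0//; lra.
split => //.
  apply: quartic_growth_le qG3 _; first by apply: measurable_funX; exact: measurableT_comp.
  move=> x; rewrite ger0_norm ?exprn_ge0//; apply: (le_trans (g3 x)); exact: ler_norm.
have qg3 : quartic_growth (fun x => `|score s u x| ^+ 3).
  apply: quartic_growth_le qG3 _; first by apply: measurable_funX; exact: measurableT_comp.
  move=> x; rewrite ger0_norm ?exprn_ge0//; apply: (le_trans (g3 x)); exact: ler_norm.
split.
- rewrite (_ : score s u = fun x => s^-1 * (D x + - level) + s^-1 * be * x); last exact/funext.
  have qd1 : quartic_growth (fun x => D x + - level).
    by apply: quartic_growthD => //; exact: quartic_growth_cst.
  rewrite error_meanD//; [|exact: quartic_growthZ|exact: quartic_growthZ].
  rewrite !error_meanZ// error_meanD//; last exact: quartic_growth_cst.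
  by rewrite error_mean_cst mD (error_mean_id meanE) subrr !mulr0 addr0.
- rewrite g2E /G2 error_meanD//; last exact: quartic_growth_cst.
  rewrite error_mean_cst error_meanD// error_meanD// error_meanD//.
  rewrite !error_meanZ// mD mxD (error_mean_id meanE) (error_mean_sqr varE meanE).
  by rewrite /score_var -/be; field; rewrite gt_eqF.
- apply: (@le_trans _ _ (error_mean eps G3)).
    exact: (error_mean_le fourthE).
  rewrite /G3 error_meanD//; [|exact: quartic_growth_cst|exact: quartic_growthZ].
  rewrite error_mean_cst error_meanZ//.
  by rewrite le_eqVlt; apply/orP; left; apply/eqP; ring.
Qed.

Definition score_sum (v : nat -> R) n w : R :=
  partial_sum eps (fun k => score (Num.sqrt n%:R) (1 - n%:R * v k)) n w.

Lemma clt_score (v : nat -> nat -> R) (C a b U eta : R) : 0 <= C -> 0 < U ->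
  U = level - level ^+ 2 + kap ^+ 2 * sigma ^+ 2 * (a + 1 - 2 * b)
        - 2 * kap * (H c - H (- c)) * (b - 1) ->
  (\forall n \near \oo, forall k, (k < n)%N -> `|v n k| <= C / n%:R) ->
  (\sum_(k < n) v n k) @[n --> \oo] --> b ->
  (n%:R * \sum_(k < n) v n k ^+ 2) @[n --> \oo] --> a ->
  0 < eta ->
  exists2 a0, 0 < a0 & \forall n \near \oo,
    (P [set w | (- a0 <= score_sum (v n) n w)%R] <= (1 / 2 + eta)%:E)%E /\
    (P [set w | (score_sum (v n) n w <= a0)%R] <= (1 / 2 + eta)%:E)%E.
Proof.
move=> C0 U0 UE vC sv sv2 eta0.
pose B := `|kap| * (1 + C).
have B0 : 0 <= B by rewrite mulr_ge0// addr_ge0.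
pose m3 := error_mean eps (fun x => `|x| ^+ 3).
have m30 : 0 <= m3 by apply: error_mean_ge0 => x; exact: exprn_ge0.
pose C3 := 32 + 4 * B ^+ 3 * m3.
pose C2 := 1 + B ^+ 2 * sigma ^+ 2 + 2 * B * `|H c - H (- c)|.
have B20 : 0 <= B ^+ 2 * sigma ^+ 2 by apply: mulr_ge0; exact: sqr_ge0.
have BH0 : 0 <= 2 * B * `|H c - H (- c)| by apply: mulr_ge0 => //; exact: mulr_ge0.
have B30 : 0 <= 4 * B ^+ 3 * m3.
  by apply: mulr_ge0 => //; apply: mulr_ge0 => //; exact: exprn_ge0.
pose CC := C2 + C3.
have CC0 : 0 < CC by rewrite /CC /C2 /C3; lra.
have C2C : C2 <= CC by rewrite /CC /C2 /C3; lra.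
have C3C : C3 <= CC by rewrite /CC /C2 /C3; lra.
have U20 : 0 < U / 2 by rewrite divr_gt0.
have [a0 a00 [N HN]] := clt_upper iidE fourthE CC0 U20 eta0.
exists a0 => //.
pose S n := n%:R^-1 * \sum_(k < n) score_var (1 - n%:R * v n k).
have SE n : (0 < n)%N -> S n = level - level ^+ 2
   + kap ^+ 2 * sigma ^+ 2 * (1 - 2 * (\sum_(k < n) v n k) + n%:R * \sum_(k < n) v n k ^+ 2)
   + 2 * kap * (H c - H (- c)) * (1 - \sum_(k < n) v n k).
  move=> n0; have nn : n%:R != 0 :> R by rewrite pnatr_eq0 -lt0n.
  pose f1 := level - level ^+ 2 + kap ^+ 2 * sigma ^+ 2 + 2 * kap * (H c - H (- c)).
  pose f2 := - (2 * kap ^+ 2 * sigma ^+ 2 + 2 * kap * (H c - H (- c))) * n%:R.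
  pose f3 := kap ^+ 2 * sigma ^+ 2 * n%:R ^+ 2.
  rewrite /S (eq_bigr (fun k : 'I_n => f1 + (f2 * v n k + f3 * v n k ^+ 2))); last first.
    by move=> k _; rewrite /score_var /f1 /f2 /f3; ring.
  have lin (g1 g2 g3 : R) : \sum_(k < n) (g1 + (g2 * v n k + g3 * v n k ^+ 2)) =
      n%:R * g1 + (g2 * (\sum_(k < n) v n k) + g3 * (\sum_(k < n) v n k ^+ 2)).
    by rewrite big_split/= sumr_const card_ord -[g1 *+ n]mulr_natl big_split/= !mulr_sumr.
  by rewrite lin /f1 /f2 /f3; field.
have Scvg : S n @[n --> \oo] --> U.
  have : (level - level ^+ 2
   + kap ^+ 2 * sigma ^+ 2 * (1 - 2 * (\sum_(k < n) v n k) + n%:R * \sum_(k < n) v n k ^+ 2)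
   + 2 * kap * (H c - H (- c)) * (1 - \sum_(k < n) v n k)) @[n --> \oo] --> level - level ^+ 2
   + kap ^+ 2 * sigma ^+ 2 * (1 - 2 * b + a)
   + 2 * kap * (H c - H (- c)) * (1 - b).
    apply: cvgD; last first.
      by apply: cvgM; [exact: cvg_cst|apply: cvgB => //; exact: cvg_cst].
    apply: cvgD; first exact: cvg_cst.
    apply: cvgM; first exact: cvg_cst.
    apply: cvgD => //; apply: cvgB; first exact: cvg_cst.
    by apply: cvgM => //; exact: cvg_cst.
  rewrite (_ : level - level ^+ 2 + _ * (1 - 2 * b + a) + _ = U); last by rewrite UE; ring.
  apply: cvg_trans; apply: near_eq_cvg; near=> n.
  by rewrite SE//; near: n; exists 1%N.
near=> n.
have n0 : (0 < n)%N by near: n; exists 1%N.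
have np : 0 < n%:R :> R by rewrite ltr0n.
have nN : (N <= n)%N by near: n; exists N.
have vn : forall k, (k < n)%N -> `|v n k| <= C / n%:R by near: n.
have SU : U / 2 <= S n.
  have : `|U - S n| <= U / 2 by near: n; move/cvgrPdist_le : Scvg; exact.
  by move=> /ler_distlBl; lra.
pose s := Num.sqrt n%:R : R.
have s0 : 0 < s by rewrite sqrtr_gt0.
have s2 : s ^+ 2 = n%:R by rewrite sqr_sqrtr// ltW.
have s3 : s ^+ 3 = n%:R * s by rewrite exprSr s2.
have uB k : (k < n)%N -> `|kap * (1 - n%:R * v n k)| <= B.
  move=> kn; rewrite normrM ler_wpM2l//.
  apply: (le_trans (ler_normB _ _)); rewrite normr1 lerD2l normrM gtr0_norm//.
  by rewrite -ler_pdivlMl// mulrC; exact: vn.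
pose vk k := score_var (1 - n%:R * v n k) / s ^+ 2.
have ss k : (k < n)%N -> standardized_summand eps (score s (1 - n%:R * v n k)) (vk k) (CC / (n%:R * s)).
  move=> kn; have [q1 q2 q3 [z1 z2 z3]] := score_standardized s0 (uB k kn).
  split => //; split => //; apply: (le_trans z3); rewrite s3.
  by rewrite ler_pM2r// invr_gt0 mulr_gt0.
have vk0 k : (k < n)%N -> 0 <= vk k <= CC / n%:R.
  move=> kn; have [_ _ _ [_ z2 _]] := ss k kn.
  apply/andP; split; first by rewrite -z2; apply: error_mean_ge0 => x; exact: sqr_ge0.
  rewrite /vk s2 ler_pM2r ?invr_gt0//; apply: le_trans C2C.
  have l01 : 0 <= level <= 1.
    have cc : - c <= c by rewrite (@le_trans _ _ 0)// ?oppr_le0 ltW.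
    rewrite /level subr_ge0 (cdfF_nondecreasing iidE fourthE cc)/=.
    by have := cdfF_ge0 iidE (- c); have := cdfF_le1 iidE fourthE c; lra.
  have b2 := uB k kn; rewrite /score_var /C2.
  set be := kap * _ in b2 *.
  have h1 : level - level ^+ 2 <= 1 by nra.
  have h2 : be ^+ 2 * sigma ^+ 2 <= B ^+ 2 * sigma ^+ 2.
    by rewrite ler_wpM2r ?sqr_ge0// -real_normK ?num_real// ler_pXn2r ?nnegrE.
  have h3 : 2 * be * (H c - H (- c)) <= 2 * B * `|H c - H (- c)|.
    apply: (le_trans (ler_norm _)); rewrite normrM; apply: ler_wpM2r => //.
    by rewrite normrM normr_nat; apply: ler_wpM2l.
  by apply: lerD => //; apply: lerD.
have sumv : U / 2 <= \sum_(k < n) vk k.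
  by apply: (le_trans SU); rewrite /S /vk s2 mulrC mulr_suml.
have msc k : measurable_fun setT (score s (1 - n%:R * v n k)).
  apply: measurable_funM => //; apply: measurable_funD.
    apply: measurable_funB => //; apply: measurable_funB; exact: measurable_ind_le.
  exact: measurable_funM.
split.
  exact: (HN n nN (fun k => score s (1 - n%:R * v n k)) vk).
have := HN n nN (fun k x => - score s (1 - n%:R * v n k) x) vk _ _ vk0 sumv.
rewrite (_ : [set w | - a0 <= _] = [set w | score_sum (v n) n w <= a0]).
  apply; first by move=> k; apply: measurable_funN.
  by move=> k kn; apply: standardized_summandN; exact: ss.
apply/funext => w /=; rewrite (_ : partial_sum _ _ _ _ = - score_sum (v n) n w).
  by rewrite lerN2.
by rewrite /partial_sum sumrN.
Unshelve. all: by end_near. Qed.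

End score_clt.

Section grid.
Context {R : realType}.

Lemma grid_point (s u : R) (L : nat) : 0 < s -> `|u| <= s * L%:R ->
  exists k : 'I_(L.*2.+1), s * (k%:R - L%:R) <= u <= s * (k%:R - L%:R) + s.
Proof.
move=> s0; rewrite ler_norml => /andP[u1 u2].
pose y := (u + s * L%:R) / s.
have y0 : 0 <= y by rewrite divr_ge0 ?(ltW s0)//; lra.
have sy : s * y = u + s * L%:R by rewrite /y mulrCA divff ?mulr1// gt_eqF.
have /andP[k1 k2] := truncn_itv y0.
have yL : y <= L.*2%:R.
  by rewrite ler_pdivrMr// -addnn natrD; lra.
have kL : (Num.truncn y < L.*2.+1)%N.
  by rewrite ltnS -(ler_nat R) (le_trans k1).
exists (Ordinal kL) => /=.
have h1 : s * (Num.truncn y)%:R <= s * y by rewrite ler_pM2l.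
have h2 : s * y <= s * (Num.truncn y).+1%:R by rewrite ler_pM2l// ltW.
rewrite -natr1 mulrDr mulr1 in h2.
by apply/andP; split; lra.
Qed.

End grid.

Section frozen_sample.
Context {R : realType} {p n : nat} (F f : R -> R) (KF : R).
Hypothesis HF : smooth_cdf F f KF.
Context (X : 'M[R]_(n, p)) (xf : 'cV[R]_p) (e : 'cV[R]_n).
Context (C c s delta h : R) (L M : nat).
Hypothesis n0 : (0 < n)%N.
Hypothesis p_gt0 : (0 < p)%N.
Hypothesis Xunit : X^T *m X \in unitmx.
Hypotheses (C1 : 1 <= C) (s0 : 0 < s) (h0 : 0 <= h) (delta0 : 0 < delta).
Hypothesis XC : forall i j, `|(regressor X i - xbar X) j ord0| <= C.

Definition grid_mesh : R := s / (p%:R * C).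

Definition grid_threshold (yc : R) (k : 'I_((L.*2.+4).+1))
    (m : {ffun 'I_p -> 'I_(M.*2.+1)}) (i : 'I_n) : R :=
  yc + s * (k%:R - L.+2%:R) +
  \sum_j grid_mesh * ((m j)%:R - M%:R) * (regressor X i - xbar X) j ord0.

Definition oscillation yc k m : R :=
  \sum_i centered_indicator F yc (grid_threshold yc k m i) (e i ord0).

Lemma pC_gt0 : 0 < p%:R * C.
Proof. by rewrite mulr_gt0 ?ltr0n ?(lt_le_trans ltr01 C1). Qed.

Lemma grid_mesh_gt0 : 0 < grid_mesh.
Proof. by rewrite divr_gt0// pC_gt0. Qed.

Lemma grid_threshold_dist yc k m i :
  `|grid_threshold yc k m i - yc| <= s * L.+2%:R + s * M%:R.
Proof.
rewrite /grid_threshold (_ : _ - yc = s * (k%:R - L.+2%:R) +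
  \sum_j grid_mesh * ((m j)%:R - M%:R) * (regressor X i - xbar X) j ord0); last by ring.
apply: (le_trans (ler_normD _ _)); apply: lerD.
  rewrite normrM gtr0_norm// ler_pM2l// ler_distlC.
  have k0 : 0 <= k%:R :> R by [].
  have : k%:R <= (L.*2.+4)%:R :> R by rewrite ler_nat -ltnS ltn_ord.
  have -> : L.*2.+4%:R = 2 * L%:R + 4 :> R by rewrite -addn4 natrD -addnn natrD; ring.
  have -> : L.+2%:R = L%:R + 2 :> R by rewrite -addn2 natrD.
  move=> kL.
  by apply/andP; split; lra.
apply: (@le_trans _ _ (\sum_(j < p) grid_mesh * M%:R * C)).
  apply: (le_trans (ler_norm_sum _ _ _)); apply: ler_sum => j _.
  rewrite normrM ler_pM//.
  rewrite normrM gtr0_norm ?grid_mesh_gt0// ler_pM2l ?grid_mesh_gt0// ler_distlC.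
  have k0 : 0 <= (m j)%:R :> R by [].
  have : (m j)%:R <= (M.*2)%:R :> R by rewrite ler_nat -ltnS ltn_ord.
  have -> : M.*2%:R = M%:R + M%:R :> R by rewrite -natrD addnn.
  by move=> kL; apply/andP; split; lra.
have C0 : C != 0 by rewrite gt_eqF// (lt_le_trans ltr01 C1).
have pn0 : p%:R != 0 :> R by rewrite pnatr_eq0 -lt0n.
rewrite sumr_const card_ord -[X in X <= _]mulr_natl le_eqVlt /grid_mesh; apply/orP; left; apply/eqP.
by field; rewrite C0 pn0.
Qed.

Hypothesis ebar : `|vmean e| <= h.
Hypothesis theta_h : forall j, `|least_squares X e j ord0| <= h.
Hypothesis t_h : `|dotv xf (least_squares X e)| <= h.
Hypothesis Ls : delta + h <= s * L%:R.
Hypothesis Ms : h <= grid_mesh * M%:R.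
Hypothesis osc_c : forall k m, `|oscillation c k m| <= n%:R * s.
Hypothesis osc_Nc : forall k m, `|oscillation (- c) k m| <= n%:R * s.

Let H2 : R := (1 + p%:R * C) * h.

Lemma perturbation_le i : `|perturbation X e i| <= H2.
Proof.
rewrite /perturbation /H2 mulrDl mul1r.
apply: (le_trans (ler_normD _ _)); apply: lerD => //.
rewrite dotvE; apply: (le_trans (ler_norm_sum _ _ _)).
apply: (@le_trans _ _ (\sum_(j < p) C * h)).
  by apply: ler_sum => j _; rewrite normrM ler_pM.
by rewrite sumr_const card_ord -[X in X <= _]mulr_natl mulrA.
Qed.

Lemma residual_edf (yc z : R) (b : 'I_n -> bool) :
  (forall k m, `|oscillation yc k m| <= n%:R * s) ->
  `|z - yc| <= delta ->
  (forall i, e i ord0 < z + perturbation X e i -> b i) ->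
  (forall i, b i -> e i ord0 <= z + perturbation X e i) ->
  `|avg (fun i => (b i)%:R) - (F z + (avg (fun i => (e i ord0 <= yc)%R%:R) - F yc) + f yc * vmean e)|
    <= KF * (6 * s + H2 ^+ 2 + delta * h).
Proof.
move=> osc zd b1 b2.
have K0 : 0 <= KF by case: HF => ? *; lra.
have np : 0 < n%:R :> R by rewrite ltr0n.
have [k /andP[k1 k2]] : exists k : 'I_(L.*2.+1),
    s * (k%:R - L%:R) <= z + vmean e - yc <= s * (k%:R - L%:R) + s.
  apply: grid_point => //; rewrite addrAC.
  by apply: (le_trans (ler_normD _ _)); move: zd ebar Ls; lra.
have hm j : exists m : 'I_(M.*2.+1),
    grid_mesh * (m%:R - M%:R) <= least_squares X e j ord0
      <= grid_mesh * (m%:R - M%:R) + grid_mesh.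
  by apply: grid_point grid_mesh_gt0 _; apply: le_trans Ms.
have [m0 m0P] := choice hm.
pose m := [ffun j => m0 j].
have mP j : grid_mesh * ((m j)%:R - M%:R) <= least_squares X e j ord0
      <= grid_mesh * ((m j)%:R - M%:R) + grid_mesh.
  by rewrite /m ffunE; exact: m0P.
have klo : (k < (L.*2.+4).+1)%N by have := ltn_ord k; rewrite !ltnS => /leq_trans; apply; rewrite -[X in (X <= _)%N]addn0 -addn4 leq_add2l.
have khi : (k.+4 < (L.*2.+4).+1)%N by have := ltn_ord k; rewrite !ltnS.
pose lin i := \sum_j grid_mesh * ((m j)%:R - M%:R) * (regressor X i - xbar X) j ord0.
have lin_le i : `|dotv (regressor X i - xbar X) (least_squares X e) - lin i| <= s.
  rewrite dotvE -sumrB; apply: (le_trans (ler_norm_sum _ _ _)).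
  apply: (@le_trans _ _ (\sum_(j < p) C * grid_mesh)).
    apply: ler_sum => j _.
    rewrite [grid_mesh * _ * _]mulrC -mulrBr normrM ler_pM//.
    by have /andP[m1 m2] := mP j; rewrite ler_norml; apply/andP; split; [have := grid_mesh_gt0; lra|lra].
  have C0 : C != 0 by rewrite gt_eqF// (lt_le_trans ltr01 C1).
  have p0 : p%:R != 0 :> R by rewrite pnatr_eq0 -lt0n.
  rewrite sumr_const card_ord -[X in X <= _]mulr_natl le_eqVlt /grid_mesh; apply/orP; left; apply/eqP.
  by field; rewrite C0 p0.
pose tlo i := grid_threshold yc (Ordinal klo) m i.
pose thi i := grid_threshold yc (Ordinal khi) m i.
have tloE i : tlo i = yc + s * (k%:R - L%:R) - 2 * s + lin i.
  by rewrite /tlo /grid_threshold -/(lin i)/= -!natr1; ring.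
have thiE i : thi i = yc + s * (k%:R - L%:R) + 2 * s + lin i.
  by rewrite /thi /grid_threshold -/(lin i)/= -!natr1; ring.
have bracket i : tlo i < z + perturbation X e i <= thi i.
  rewrite tloE thiE /perturbation; have := lin_le i; rewrite ler_norml => /andP[l1 l2].
  by move: k1 k2 l1 l2 s0 => ? ? ? ? ?; apply/andP; split; lra.
have near5 i : `|tlo i - (z + perturbation X e i)| <= 5 * s /\
   `|thi i - (z + perturbation X e i)| <= 5 * s.
  rewrite tloE thiE /perturbation; have := lin_le i; rewrite ler_norml => /andP[l1 l2].
  by move: k1 k2 l1 l2 s0 => ? ? ? ? ?; split; rewrite ler_norml; apply/andP; split; lra.
have oscavg (k' : 'I_((L.*2.+4).+1)) : `|avg (fun i => (e i ord0 <= grid_threshold yc k' m i)%R%:R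
     - (e i ord0 <= yc)%R%:R - (F (grid_threshold yc k' m i) - F yc))| <= s.
  have nV : 0 < n%:R^-1 :> R by rewrite invr_gt0.
  rewrite /avg normrM (gtr0_norm nV) mulrC ler_pdivrMr// mulrC.
  exact: osc k' m.
have := edf_expansion HF n0 (ltW s0) (e := fun i => e i ord0) (h := perturbation X e)
  (tlo := tlo) (thi := thi) (b := fun i => (b i)%:R) (x := z) (yc := yc) (m := vmean e)
  (H := H2) (delta := delta).
move=> /(_ _ _ _ _ _ _ perturbation_le zd) hh.
apply: (le_trans (hh _ _ _ _ _ _)) => {hh}.
- move=> i; have /andP[t1 t2] := bracket i; apply/andP; split.
    case: (leP (e i ord0) (tlo i)) => [et|_]; last by rewrite ler0n.
    by rewrite b1//; exact: le_lt_trans et t1.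
  case E : (b i); last by rewrite ler0n.
  by rewrite (le_trans (b2 i _) t2).
- by move=> i; have [] := near5 i.
- by move=> i; have [] := near5 i.
- exact: oscavg.
- exact: oscavg.
- by rewrite /avg mean_perturbation.
- by rewrite ler_wpM2l// lerD2l ler_wpM2l// ltW.
Qed.

End frozen_sample.

Section coverage_dichotomy.
Context {R : realType} {p n : nat} (F f : R -> R) (KF : R).
Hypothesis HF : smooth_cdf F f KF.
Context (X : 'M[R]_(n, p)) (xf beta : 'cV[R]_p) (e : 'cV[R]_n).
Context (C c rho tau h1 K q : R) (L M : nat).
Hypothesis n0 : (0 < n)%N.
Hypothesis p_gt0 : (0 < p)%N.
Hypothesis Xunit : X^T *m X \in unitmx.
Hypothesis nq : n%:R = q ^+ 4.
Hypotheses (C1 : 1 <= C) (rho0 : 0 < rho) (tau0 : 0 < tau) (h10 : 0 <= h1) (K0 : 0 <= K)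
  (c0 : 0 < c) (q1 : 1 <= q).
Hypothesis XC : forall i j, `|(regressor X i - xbar X) j ord0| <= C.
Hypothesis levC : forall i, `|leverage X xf i| <= C / n%:R.
Let s := rho / q ^+ 2.
Let delta := tau / q.
Let h := h1 / q ^+ 2.

Hypothesis ebar : `|vmean e| <= h.
Hypothesis theta_h : forall j, `|least_squares X e j ord0| <= h.
Hypothesis t_h : `|dotv xf (least_squares X e)| <= h.
Hypothesis e2K : \sum_i e i ord0 ^+ 2 <= n%:R * K.
Hypothesis Ls : delta + h <= s * L%:R.
Hypothesis Ms : h <= grid_mesh (p := p) C s * M%:R.
Hypothesis osc_c : forall k m, `|oscillation F X e C s (L := L) (M := M) c k m| <= n%:R * s.
Hypothesis osc_Nc : forall k m, `|oscillation F X e C s (L := L) (M := M) (- c) k m| <= n%:R * s.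

Let kap := f c - f (- c).
Let fp := f c + f (- c).
Let level := F c - F (- c).
Hypothesis fp0 : 0 < fp.
Hypothesis level0 : 0 < level <= 1.

Definition noise_bound : R := (1 + p%:R * C) * h1.
Definition noise_energy : R := C ^+ 2 * (2 * K + 2 * noise_bound ^+ 2).
Let J := `|kap| * h1 / fp + rho.

Hypothesis tau_large : 20 * noise_energy <= rho * tau ^+ 2.
Hypothesis q_c : tau < 2 * c * q.
Hypothesis q_noise : noise_bound ^+ 2 <= rho * q.
Hypothesis q_tau : tau * h1 <= rho * q.
Hypothesis q_h : 2 * KF * h1 <= 1 * q.
Hypothesis q_energy : 2 * KF * noise_energy <= rho * q.
Hypothesis q_J : J <= tau / 2 * q.
Hypothesis q_fp : 2 * KF * (J + h1) ^+ 2 < fp * rho * q.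

Let t := dotv xf (least_squares X e).
Let y := X *m beta + e.
Let crit := boot_critical X xf y level.
Let D z := avg (fun i => (e i ord0 <= z)%R%:R) - F z.

Lemma coverage_dichotomy :
  let Z := q ^+ 2 * (D c - D (- c) + kap * vmean e - kap * t) in
  let a0 := (16 * KF + 2 + 2 * fp) * rho in
  (Z < - a0 -> level <= F (t + crit) - F (t - crit)) /\
  (a0 < Z -> F (t + crit) - F (t - crit) < level).
Proof.
move=> Z a0.
have [KF1 T1 T2 T3 [F01 Fmono fK]] := HF.
have KF0 : 0 <= KF by lra.
have q0 : 0 < q by exact: lt_le_trans ltr01 q1.
have q20 : 0 < q ^+ 2 by rewrite exprn_gt0.
have q2q : q <= q ^+ 2 by rewrite expr2 ler_peMl ?(ltW q0).
have q4E : q ^+ 4 = q ^+ 2 * q ^+ 2 by rewrite -exprD.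
have np : 0 < n%:R :> R by rewrite ltr0n.
have s0 : 0 < s by rewrite divr_gt0.
have d0 : 0 < delta by rewrite divr_gt0.
have hh0 : 0 <= h by rewrite divr_ge0// ltW.
have sq (a b : R) : 0 <= a -> a <= b * q -> a / q ^+ 2 <= b.
  move=> a0' ab; rewrite ler_pdivrMr//.
  have b0 : 0 <= b by rewrite -(pmulr_lge0 _ q0) (le_trans a0').
  by apply: (le_trans ab); rewrite ler_wpM2l.
have dv (a b : R) : a <= b -> a / q ^+ 2 <= b / q ^+ 2.
  by move=> ab; rewrite ler_pM2r// invr_gt0.
pose H2 := (1 + p%:R * C) * h.
have H2E : H2 = noise_bound / q ^+ 2 by rewrite /H2 /noise_bound /h mulrA.
have pC0 : 0 < p%:R * C := pC_gt0 p_gt0 C1.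
have nb0 : 0 <= noise_bound by rewrite /noise_bound mulr_ge0// addr_ge0// ltW.
have H20 : 0 <= H2 by rewrite H2E divr_ge0// ltW.
have nr : q ^+ 2 != 0 by rewrite gt_eqF.
have H2s : H2 ^+ 2 <= s.
  rewrite H2E expr_div_n (expr2 (q ^+ 2)) invfM mulrA; apply: dv; exact: sq (sqr_ge0 _) q_noise.
have dhs : delta * h <= s.
  rewrite (_ : delta * h = (tau * h1 / q) / q ^+ 2); last by rewrite /delta /h; ring.
  by apply: dv; rewrite ler_pdivrMr.
pose err := 8 * KF * s.
have err0 : 0 <= err by rewrite mulr_ge0 ?(ltW s0)// mulr_ge0.
have errB : KF * (6 * s + H2 ^+ 2 + delta * h) <= err.
  rewrite /err (_ : 8 * KF * s = KF * (8 * s)); last by ring.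
  by rewrite ler_wpM2l//; move: H2s dhs; lra.
pose r i := residual X y i.
have rE i : r i = e i ord0 - perturbation X e i by exact: residual_model.
have E1 z : `|z - c| <= delta ->
    `|avg (fun k => (r k <= z)%R%:R) - (F z + (D c + f c * vmean e))| <= err.
  move=> zc; rewrite addrA; apply: le_trans errB.
  apply: (residual_edf HF n0 p_gt0 C1 s0 d0 XC ebar theta_h Ls Ms
    (b := fun i => r i <= z) osc_c zc).
  - by move=> i; rewrite rE lerBlDr => /ltW.
  - by move=> i; rewrite rE lerBlDr.
have E2 z : `|z + c| <= delta ->
    `|avg (fun k => (r k < z)%R%:R) - (F z + (D (- c) + f (- c) * vmean e))| <= err.
  rewrite -{1}[c]opprK => zc; rewrite addrA; apply: le_trans errB.
  apply: (residual_edf HF n0 p_gt0 C1 s0 d0 XC ebar theta_h Ls Ms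
    (b := fun i => r i < z) osc_Nc zc).
  - by move=> i; rewrite rE ltrBlDr.
  - by move=> i; rewrite rE ltrBlDr => /ltW.
pose W1 := D c + f c * vmean e; pose W2 := D (- c) + f (- c) * vmean e.
have hq : 2 * KF * h <= 1.
  rewrite /h mulrA; apply: sq q_h; by rewrite mulr_ge0// mulr_ge0.
have D1 z : `|D z| <= 1.
  have /andP[? ?] := F01 z.
  have a1 : 0 <= avg (fun i => (e i ord0 <= z)%R%:R : R).
    by rewrite /avg; apply: mulr_ge0; [rewrite invr_ge0|exact: sumr_ge0].
  have a2 : avg (fun i => (e i ord0 <= z)%R%:R : R) <= 1.
    rewrite -[leRHS](avg_cst 1 n0); apply: avg_le => i; by case: (e i ord0 <= z).
  by rewrite ler_norml; apply/andP; split; rewrite /D; lra.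
have W3 : `|W1 - W2| <= 3.
  have fe x : `|f x * vmean e| <= KF * h.
    by rewrite normrM ler_pM.
  have := fe c; have := fe (- c); have := D1 c; have := D1 (- c).
  rewrite /W1 /W2 !ler_norml => /andP[? ?] /andP[? ?] /andP[? ?] /andP[? ?].
  by apply/andP; split; lra.
have r0 : \sum_i r i = 0 by exact: sum_residual.
pose E := 2 * err + (20 / delta ^+ 2 + 2 * KF) * ((\sum_i leverage X xf i ^+ 2) * (n%:R^-1 * \sum_i r i ^+ 2)).
have GW x : `|x - c| <= delta / 2 ->
    `|boot_dist X xf y x - (F x - F (- x) + (W1 - W2))| <= E.
  move=> xc; rewrite /E -(resample_mean_noise_sqr n0 (leverage X xf) r0) boot_dist_model//.
  apply: (boot_expansion HF _ n0 r0 _ d0 xc err0 W3 E1 E2).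
  have d2c : delta < 2 * c by rewrite ltr_pdivrMr.
  by move: xc; rewrite ler_norml => /andP[]; lra.
have pert i : `|perturbation X e i| <= H2.
  exact: perturbation_le XC ebar theta_h i.
have A1 : n%:R^-1 * (\sum_i r i ^+ 2) <= 2 * K + 2 * noise_bound ^+ 2.
  rewrite mulrC ler_pdivrMr//.
  apply: (@le_trans _ _ (\sum_(i < n) (2 * e i ord0 ^+ 2 + 2 * noise_bound ^+ 2))).
    apply: ler_sum => i _; rewrite rE.
    have : perturbation X e i ^+ 2 <= noise_bound ^+ 2.
      rewrite -real_normK ?num_real// ler_pXn2r ?nnegrE//.
      apply: (le_trans (pert i)); rewrite H2E ler_pdivrMr// ler_peMr//.
      exact: le_trans q2q.
    have := sqr_ge0 (e i ord0 + perturbation X e i); nra.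
  rewrite big_split/= -mulr_sumr sumr_const card_ord -[X in _ + X <= _]mulr_natr.
  by move: e2K; lra.
have A2 : \sum_i leverage X xf i ^+ 2 <= C ^+ 2 / q ^+ 4.
  apply: (@le_trans _ _ (\sum_(i < n) (C / n%:R) ^+ 2)).
    apply: ler_sum => i _; rewrite -real_normK ?num_real// ler_pXn2r ?nnegrE//.
    by rewrite divr_ge0// ltW// (lt_le_trans ltr01 C1).
  rewrite sumr_const card_ord -[X in X <= _]mulr_natl -nq le_eqVlt; apply/orP; left; apply/eqP.
  by field; rewrite gt_eqF.
pose A := (\sum_i leverage X xf i ^+ 2) * (n%:R^-1 * \sum_i r i ^+ 2).
have AA : A <= noise_energy / q ^+ 4.
  rewrite /noise_energy mulrAC; apply: ler_pM => //.
    by apply: sumr_ge0 => i _; exact: sqr_ge0.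
  by rewrite mulr_ge0 ?invr_ge0// sumr_ge0// => i _; exact: sqr_ge0.
have ne0 : 0 <= noise_energy.
  by rewrite mulr_ge0 ?sqr_ge0// addr_ge0// mulr_ge0// sqr_ge0.
have EB : E <= (16 * KF + 2) * s.
  have t1 : 20 / delta ^+ 2 * A <= s.
    apply: (@le_trans _ _ (20 / delta ^+ 2 * (noise_energy / q ^+ 4))).
      by rewrite ler_wpM2l// divr_ge0// sqr_ge0.
    have -> : 20 / delta ^+ 2 * (noise_energy / q ^+ 4) = (20 * noise_energy / tau ^+ 2) / q ^+ 2.
      have id1 (N a : R) : a != 0 -> 20 / (a / q) ^+ 2 * (N / q ^+ 4) = 20 * N / a ^+ 2 / q ^+ 2.
        by move=> a0'; field; rewrite a0' gt_eqF.
      by rewrite /delta id1// gt_eqF.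
    by apply: dv; rewrite ler_pdivrMr// exprn_gt0.
  have t2 : 2 * KF * A <= s.
    apply: (@le_trans _ _ (2 * KF * (noise_energy / q ^+ 4))).
      by rewrite ler_wpM2l// mulr_ge0.
    have -> : 2 * KF * (noise_energy / q ^+ 4) = (2 * KF * noise_energy / q ^+ 2) / q ^+ 2.
      by rewrite q4E; field; rewrite gt_eqF.
    by apply: dv; apply: sq q_energy; rewrite mulr_ge0// mulr_ge0.
  by rewrite /E -/A [(_ + _) * A]mulrDl /err; lra.
pose b := s.
have J0 : 0 <= J by rewrite addr_ge0 ?(ltW rho0)// divr_ge0 ?(ltW fp0)// mulr_ge0.
have kt : `|kap * t / fp| <= `|kap| * h1 / fp / q ^+ 2.
  rewrite normrM normrM normfV (gtr0_norm fp0).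
  rewrite (_ : _ * h1 / fp / _ = `|kap| * h / fp); last by rewrite /h; ring.
  by rewrite ler_pM2r ?invr_gt0// ler_wpM2l.
have JE : J / q ^+ 2 = `|kap| * h1 / fp / q ^+ 2 + s by rewrite /J /s mulrDl.
have Jd : J / q ^+ 2 <= delta / 2.
  rewrite (_ : delta / 2 = (tau / 2 * q) / q ^+ 2); last by rewrite /delta; field; rewrite gt_eqF.
  exact: dv.
have small (u : R) : `|u| <= J / q ^+ 2 -> 2 * KF * (`|u| + `|t|) ^+ 2 < fp * s.
  move=> uJ; apply: (@le_lt_trans _ _ (2 * KF * ((J + h1) / q ^+ 2) ^+ 2)).
    have p1 : 0 <= `|u| + `|t| by exact: addr_ge0.
    have p2 : 0 <= (J + h1) / q ^+ 2 by apply: divr_ge0; [exact: addr_ge0|exact: ltW].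
    have p3 : `|u| + `|t| <= (J + h1) / q ^+ 2 by rewrite mulrDl lerD.
    by rewrite ler_wpM2l ?mulr_ge0// ler_pXn2r.
  have -> : 2 * KF * ((J + h1) / q ^+ 2) ^+ 2 = (2 * KF * (J + h1) ^+ 2 / q ^+ 2) / q ^+ 2.
    by rewrite expr_div_n (expr2 (q ^+ 2)) invfM !mulrA.
  rewrite /s mulrA ltr_pM2r ?invr_gt0// ltr_pdivrMr//.
  apply: (lt_le_trans q_fp); rewrite ler_wpM2l// mulr_ge0 ?ltW//.
have ZE : Z = q ^+ 2 * ((W1 - W2) - kap * t).
  by rewrite /Z /W1 /W2 /kap; ring.
have a0E : a0 = q ^+ 2 * ((16 * KF + 2) * s + 2 * (fp * s)).
  by rewrite /a0 /s; field; rewrite gt_eqF.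
have lev01 := andP level0.
split.
- rewrite ZE a0E -[- (q ^+ 2 * _)]mulrN ltr_pM2l// => Zlt.
  have qc : `|c - kap * t / fp + s - c| <= J / q ^+ 2.
    rewrite (_ : _ - c = - (kap * t / fp) + s); last by ring.
    rewrite JE; apply: (le_trans (ler_normD _ _)); rewrite normrN lerD//.
    by rewrite gtr0_norm.
  apply: (coverage_above HF (G := boot_dist X xf y) (b := s) (delta := delta / 2) (E := E)
    (W := W1 - W2) (fp := fp) (kap := kap)) => //.
  + by move=> x; apply: boot_critical_ge => //; case: lev01.
  + exact: le_trans Jd.
  + exact/ltW/small.
  + by apply: (lt_le_trans Zlt); rewrite lerN2 lerD2r.
- rewrite ZE a0E ltr_pM2l// => Zgt.
  have qc : `|c - kap * t / fp - s - c| <= J / q ^+ 2.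
    rewrite (_ : _ - c = - (kap * t / fp) - s); last by ring.
    rewrite JE; apply: (le_trans (ler_normB _ _)); rewrite normrN lerD//.
    by rewrite gtr0_norm.
  apply: (coverage_below HF (G := boot_dist X xf y) (b := s) (delta := delta / 2) (E := E)
    (W := W1 - W2) (fp := fp) (kap := kap)) => //.
  + by move=> x; apply: boot_critical_le => //; case: lev01.
  + exact: le_trans Jd.
  + exact: small.
  + by apply: le_lt_trans Zgt; rewrite lerD2r.
Qed.

End coverage_dichotomy.

Section bad_events.
Context {R : realType} {d : measure_display} {T : measurableType d}.
Context (P : probability T R).

Lemma finite_union_bound (I : finType) (A : I -> set T) (r : R) :
  (forall i, measurable (A i)) -> (forall i, (P (A i) <= r%:E)%E) ->
  measurable [set w | exists i, A i w] /\
  (P [set w | exists i, A i w] <= (#|I|%:R * r)%:E)%E.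
Proof.
move=> mA Ar.
have H (s : seq I) : measurable [set w | exists2 i, i \in s & A i w] /\
    (P [set w | exists2 i, i \in s & A i w] <= ((size s)%:R * r)%:E)%E.
  elim: s => [|i s [mS Ps]].
    rewrite (_ : [set w | _] = set0); last by apply/seteqP; split => // w [].
    by rewrite measure0 mul0r.
  rewrite (_ : [set w | _] = A i `|` [set w | exists2 i, i \in s & A i w]); last first.
    apply/seteqP; split => w.
      by move=> [j]; rewrite inE => /orP[/eqP -> ?|? ?]; [left|right; exists j].
    by move=> [Ai|[j js Aj]]; [exists i; rewrite ?mem_head|exists j; rewrite // inE js orbT].
  split; first exact: measurableU.
  apply: (le_trans (measureU2 _ _ _)) => //=.
  by rewrite -natr1 mulrDl mul1r addrC EFinD; exact: leeD.
have := H (enum I); rewrite -cardE.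
rewrite (_ : [set w | _] = [set w | exists i, A i w])//.
by apply/seteqP; split => w [i]; [exists i|exists i; rewrite ?mem_enum].
Qed.

Context (eps : nat -> {RV P >-> R}).
Context (F : R -> R) (sigma : R).
Hypothesis iidE : forall n, iid (fun i : 'I_n => eps i) F.
Hypothesis varE : ('V_P[eps 0%N] = (sigma ^+ 2)%R%:E)%E.
Hypothesis meanE : ('E_P[eps 0%N] = 0)%E.
Hypothesis fourthE : ('E_P[fun w => (`|eps 0%N w| ^+ 4)%R] < +oo)%E.

Definition extend n (x0 : R) (g : 'I_n -> R) (k : nat) : R := oapp g x0 (insub k).

Lemma extendE n x0 (g : 'I_n -> R) (i : 'I_n) : extend x0 g i = g i.
Proof. by rewrite /extend valK. Qed.

Lemma extend_lt n x0 (g : 'I_n -> R) k (kn : (k < n)%N) : extend x0 g k = g (Ordinal kn).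
Proof. by rewrite /extend insubT. Qed.

Lemma partial_sum_extend n x0 (g : R -> R -> R) (a : 'I_n -> R) w :
  partial_sum eps (fun k => g (extend x0 a k)) n w =
  \sum_i g (a i) (error_vec eps n w i ord0).
Proof. by apply: eq_bigr => i _; rewrite extendE mxE. Qed.

Lemma linear_form_tail n (g : 'I_n -> R) (a t : R) : (0 < n)%N -> 0 < t ->
  (forall i, `|g i| <= a / n%:R) ->
  let A := [set w | t <= `|\sum_i g i * error_vec eps n w i ord0|] in
  measurable A /\ (P A <= (a ^+ 2 * sigma ^+ 2 / (n%:R * t ^+ 2))%:E)%E.
Proof.
move=> n0 t0 ga A.
have nn : n%:R != 0 :> R by rewrite pnatr_eq0 -lt0n.
have AE : A = [set w | t <= `|partial_sum eps (fun k x => extend 0 g k * x) n w|].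
  by apply/seteqP; split => w; rewrite /A/= (partial_sum_extend 0 *%R).
have mS : measurable_fun setT (partial_sum eps (fun k x => extend 0 g k * x) n).
  by apply: measurable_partial_sumT => k; exact: measurable_funM.
rewrite AE; split.
  by apply: measurable_set_le => //; exact: measurableT_comp.
have a0 : 0 <= a / n%:R by apply: le_trans (ga (Ordinal n0)).
apply: (le_trans (@weighted_sum_tail _ _ _ P eps F sigma iidE varE meanE fourthE n _ ((a / n%:R) ^+ 2) t t0 _)).
  move=> k kn; rewrite (extend_lt _ _ kn) -real_normK ?num_real// ler_pXn2r ?nnegrE//.
rewrite lee_fin le_eqVlt; apply/orP; left; apply/eqP; field.
by rewrite nn gt_eqF.
Qed.

Context {p n : nat} (X : 'M[R]_(n, p)) (C s v yc : R) (L M : nat).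
Hypothesis n0 : (0 < n)%N.
Hypothesis s0 : 0 < s.
Hypothesis v0 : 0 <= v.
Hypothesis Fv : forall k m i,
  `|F (grid_threshold X C s yc (L := L) (M := M) k m i) - F yc| <= v.

Lemma oscillation_tail :
  let A := [set w | exists km, n%:R * s <=
    `|oscillation F X (error_vec eps n w) C s yc (L := L) (M := M) km.1 km.2|] in
  measurable A /\
  (P A <= ((L.*2.+4.+1 * M.*2.+1 ^ p)%N%:R *
    (n%:R * (3 * v + 8 * n%:R * v ^+ 2) / (n%:R * s) ^+ 4))%:E)%E.
Proof.
move=> A.
have -> : (L.*2.+4.+1 * M.*2.+1 ^ p)%N = #|{: 'I_(L.*2.+4.+1) * {ffun 'I_p -> 'I_(M.*2.+1)}}|.
  by rewrite card_prod card_ffun !card_ord.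
pose B (km : 'I_(L.*2.+4.+1) * {ffun 'I_p -> 'I_(M.*2.+1)}) := [set w | n%:R * s <=
   `|partial_sum eps (fun k => centered_indicator F yc
      (extend yc (grid_threshold X C s yc km.1 km.2) k)) n w|].
have AE : A = [set w | exists km, B km w].
  by apply/seteqP; split => w [km H0]; exists km; move: H0; rewrite /B/= (partial_sum_extend yc (centered_indicator F yc)).
rewrite AE; apply: finite_union_bound => km.
  apply: measurable_set_le => //; apply: measurableT_comp => //.
  by apply: measurable_partial_sumT => k; case: (@quartic_growth_centered R F yc
       (extend yc (grid_threshold X C s yc km.1 km.2) k)).
have ns0 : 0 < n%:R * s by rewrite mulr_gt0 ?ltr0n.
apply: (bernoulli_sum_tail iidE fourthE ns0 v0) => k kn.
by rewrite (extend_lt _ _ kn).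
Qed.

End bad_events.

Section bad_event.
Context {R : realType} {d : measure_display} {T : measurableType d}.
Context (P : probability T R) (eps : nat -> {RV P >-> R}).
Context (F : R -> R) (sigma : R).
Hypothesis iidE : forall n, iid (fun i : 'I_n => eps i) F.
Hypothesis varE : ('V_P[eps 0%N] = (sigma ^+ 2)%R%:E)%E.
Hypothesis meanE : ('E_P[eps 0%N] = 0)%E.
Hypothesis fourthE : ('E_P[fun w => (`|eps 0%N w| ^+ 4)%R] < +oo)%E.

Definition rare (A : set T) (r : R) := measurable A /\ (P A <= r%:E)%E.

Lemma rareU A B a b : rare A a -> rare B b -> rare (A `|` B) (a + b).
Proof.
move=> [mA Pa] [mB Pb]; split; first exact: measurableU.
by apply: (le_trans (measureU2 _ _ _)) => //; rewrite EFinD; exact: leeD.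
Qed.

Context {p n : nat} (X : 'M[R]_(n, p)) (xf : 'cV[R]_p) (C c s h v K : R) (L M : nat).
Hypotheses (n0 : (0 < n)%N) (C1 : 1 <= C) (s0 : 0 < s) (h0 : 0 < h) (v0 : 0 <= v) (K0 : 0 < K).
Hypothesis levC : forall i, `|leverage X xf i| <= C / n%:R.
Hypothesis ewC : forall j i, `|estimator_weight X j i| <= C / n%:R.
Hypothesis Fv : forall yc, yc = c \/ yc = - c -> forall k m i,
  `|F (grid_threshold X C s yc (L := L) (M := M) k m i) - F yc| <= v.

Definition regular_sample (e : 'cV[R]_n) : Prop :=
  [/\ `|vmean e| <= h, forall j, `|least_squares X e j ord0| <= h,
      `|dotv xf (least_squares X e)| <= h, \sum_i e i ord0 ^+ 2 <= n%:R * K &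
      forall yc, yc = c \/ yc = - c -> forall k m,
        `|oscillation F X e C s (L := L) (M := M) yc k m| <= n%:R * s].

Lemma regular_sample_rare : exists2 Bad : set T,
  rare Bad (p.+2%:R * (C ^+ 2 * sigma ^+ 2 / (n%:R * h ^+ 2)) + sigma ^+ 2 / K +
    2 * ((L.*2.+4.+1 * M.*2.+1 ^ p)%N%:R *
    (n%:R * (3 * v + 8 * n%:R * v ^+ 2) / (n%:R * s) ^+ 4))) &
  forall w, ~ Bad w -> regular_sample (error_vec eps n w).
Proof.
have np : 0 < n%:R :> R by rewrite ltr0n.
set lin := C ^+ 2 * sigma ^+ 2 / _; set osc := _ * (_ / _ ^+ 4).
have lt := linear_form_tail iidE varE meanE fourthE n0 h0.
have r1 : rare _ _ := lt (fun=> n%:R^-1) C _.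
have r3 : rare _ _ := lt (leverage X xf) C levC.
have r2 : rare _ _ := finite_union_bound (fun j => (lt _ C (ewC j)).1) (fun j => (lt _ C (ewC j)).2).
have mq : rare [set w | n%:R * K <= partial_sum eps (fun _ x => x ^+ 2) n w] (sigma ^+ 2 / K).
  split.
    apply: measurable_set_le => //; apply: measurable_partial_sumT => _; exact: measurable_funX.
  apply: (le_trans (mean_square_tail iidE varE meanE fourthE _ _)); first exact: mulr_gt0.
  rewrite lee_fin le_eqVlt; apply/orP; left; apply/eqP; field.
  by rewrite !gt_eqF.
have r5 : rare _ _ := oscillation_tail iidE fourthE n0 s0 v0 (Fv (or_introl erefl)).
have r6 : rare _ _ := oscillation_tail iidE fourthE n0 s0 v0 (Fv (or_intror erefl)).
have := rareU (rareU (rareU (rareU (rareU (r1 _) r2) r3) mq) r5) r6.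
rewrite card_ord -/lin -/osc => /(_ _) [].
  by move=> i; rewrite gtr0_norm ?invr_gt0// ler_peMl// invr_ge0 ltW.
set Bad := _ `|` _ => mB PB; exists Bad.
  split => //; apply: (le_trans PB); rewrite lee_fin le_eqVlt; apply/orP; left; apply/eqP.
  by rewrite -!natr1; ring.
move=> w nB; split.
- rewrite leNgt; apply/negP => hw; apply: nB; do 5 left.
  by rewrite /= -mulr_sumr; exact: ltW.
- move=> j; rewrite leNgt; apply/negP => hw; apply: nB; do 4 left; right.
  by exists j; rewrite /= -least_squares_sum; exact: ltW.
- rewrite leNgt; apply/negP => hw; apply: nB; do 3 left; right.
  by rewrite /= -dotv_least_squares; exact: ltW.
- rewrite leNgt; apply/negP => hw; apply: nB; do 2 left; right.
  by move: hw; rewrite /= /partial_sum; under eq_bigr do rewrite mxE; exact: ltW.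
move=> yc [->|->] k m; rewrite leNgt; apply/negP => hw; apply: nB.
- by left; right; exists (k, m); exact: ltW.
- by right; exists (k, m); exact: ltW.
Qed.

End bad_event.

Section coverage.
Context {R : realType} {p : nat} (F : R -> R).

Definition coverage n (X : 'M[R]_(n, p)) (xf beta : 'cV[R]_p) (level : R) (y : 'cV[R]_n) : R :=
  let t := dotv xf (least_squares X y - beta) in
  let c := boot_critical X xf y level in
  F (t + c) - F (t - c).

Lemma coverage_model n (X : 'M[R]_(n, p)) xf beta level e : X^T *m X \in unitmx ->
  let t := dotv xf (least_squares X e) in
  let c := boot_critical X xf (X *m beta + e) level in
  coverage X xf beta level (X *m beta + e) = F (t + c) - F (t - c).
Proof. by move=> Xu; rewrite /coverage least_squares_model// addrAC subrr add0r. Qed.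

Lemma measurable_coverage {d : measure_display} {T : measurableType d} n
    (X : T -> 'M[R]_(n, p)) (xf : T -> 'cV[R]_p) beta level (y : T -> 'cV[R]_n) :
  measurable_fun setT F -> random_mx X -> random_mx xf -> random_mx y ->
  (0 < n)%N -> 0 < level <= 1 ->
  measurable_fun setT (fun w => coverage (X w) (xf w) beta level (y w)).
Proof.
move=> mF mX mxf my n0 l01.
have mt : measurable_fun setT (fun w => dotv (xf w) (least_squares (X w) (y w) - beta)).
  apply: random_mx_dotv => //; apply: random_mxB; first exact: random_mx_least_squares.
  exact: random_mx_cst.
have mc : measurable_fun setT (fun w => boot_critical (X w) (xf w) (y w) level).
  exact: measurable_boot_critical.
apply: measurable_funB; apply: (measurableT_comp mF).
  exact: measurable_funD.
exact: measurable_funB.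
Qed.

End coverage.

Section central_quantile.
Context {R : realType} {d : measure_display} {T : measurableType d}.
Context (P : probability T R) (eps0 : {RV P >-> R}) (F : R -> R).
Hypothesis cdfE : forall x, cdf eps0 x = (F x)%:E.
Hypothesis Fmono : {homo F : a b / a <= b}.
Hypothesis contF : continuous F.

Lemma central_quantile (level : R) : 0 < level < 1 ->
  exists2 c, 0 < c & F c - F (- c) = level.
Proof.
move=> /andP[l0 l1].
have FE : fine \o cdf eps0 = F by apply/funext => x /=; rewrite cdfE.
have Fy : F x @[x --> +oo] --> (1 : R) by rewrite -FE; exact/fine_cvg/cvg_cdfy1.
have FN : F x @[x --> -oo] --> (0 : R) by rewrite -FE; exact/fine_cvg/cvg_cdfNy0.
have e1 : 1 - (1 - level) / 2 < 1 by lra.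
have e0 : 0 < (1 - level) / 2 by lra.
have [x1 x10 Fx1] := pinfty_ex_gt (num_real 0) (cvgr_gt _ Fy _ e1).
have [x2 [_ Fx2]] := cvgr_lt _ FN _ e0.
pose x := Num.max x1 (1 - x2).
have xx1 : x1 <= x by rewrite le_max lexx.
have xx2 : - x < x2.
  have : 1 - x2 <= x by rewrite le_max lexx orbT.
  lra.
have x0 : 0 < x by exact: lt_le_trans xx1.
have Gx : level < F x - F (- x).
  have h1 : F x1 <= F x := Fmono xx1.
  by have h2 : F (- x) < (1 - level) / 2 := Fx2 _ xx2; move: Fx1 h1 h2; lra.
have contG : continuous (fun z : R => F z - F (- z)).
  move=> z; apply: cvgB; first exact: contF.
  by apply: (@continuous_comp _ _ _ -%R F); [exact: opp_continuous|exact: contF].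
have := @IVT R (fun z => F z - F (- z)) 0 x level (ltW x0).
rewrite oppr0 subrr min_l ?max_r ?(ltW (lt_trans l0 Gx))// (ltW l0) (ltW Gx).
move=> /(_ _ isT)[|c]; first by apply: continuous_subspaceT => z; exact: contG.
rewrite in_itv/= => /andP[c0 cx] Gc; exists c => //.
rewrite lt_neqAle c0 andbT; apply/eqP => c00.
by move: Gc l0; rewrite -c00 oppr0 subrr => <-; rewrite ltxx.
Qed.

End central_quantile.

Section coverage_limit.
Context {R : realType} {d : measure_display} {T : measurableType d}.
Context (P : probability T R) (eps : nat -> {RV P >-> R}).
Context (F : R -> R) (sigma alpha : R).
Hypothesis iidE : forall n, iid (fun i : 'I_n => eps i) F.
Hypothesis varE : ('V_P[eps 0%N] = (sigma ^+ 2)%R%:E)%E.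
Hypothesis meanE : ('E_P[eps 0%N] = 0)%E.
Hypothesis regE : error_regularity eps F.
Hypothesis F'0 : forall x, 0 < derive1 F x.
Hypothesis alpha01 : 0 < alpha < 1.

Let fourthE : ('E_P[fun w => (`|eps 0%N w| ^+ 4)%R] < +oo)%E.
Proof. by case: regE. Qed.

Lemma error_cdf x : cdf (eps 0%N) x = (F x)%:E.
Proof. by have [_ /(_ ord0)] := iidE 1%N; exact. Qed.

Lemma F_mono : {homo F : a b / a <= b}.
Proof. exact: cdfF_nondecreasing iidE fourthE. Qed.

Lemma F_continuous : continuous F.
Proof.
move=> x; have [[_ dF _ _ _] _] := regE.
by apply: differentiable_continuous; apply/derivable1_diffP.
Qed.

Lemma F_measurable : measurable_fun setT F.
Proof. by apply: continuous_measurable_fun; exact: F_continuous. Qed.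

Lemma F_smooth : exists KF, smooth_cdf F (derive1 F) KF.
Proof.
have [[_ dF ddF _ bF] _] := regE.
apply: smooth_cdf_of_derivable => //.
  by move=> x; rewrite (cdfF_ge0 iidE) (cdfF_le1 iidE fourthE).
exact: F_mono.
Qed.

Context {p : nat}.

Lemma calU_score (A : 'M[R]_p) (b xf : 'cV[R]_p) c : 0 < c ->
  let kap := derive1 F c - derive1 F (- c) in
  let level := F c - F (- c) in
  let H := trunc_mean eps in
  calU F H sigma A b xf c = level - level ^+ 2
    + kap ^+ 2 * sigma ^+ 2 * (dotv xf (invmx A *m xf) + 1 - 2 * dotv xf (invmx A *m b))
    - 2 * kap * (H c - H (- c)) * (dotv xf (invmx A *m b) - 1).
Proof.
move=> c0 kap level H.
rewrite /calU /calV !minxx min_r; last by rewrite (@le_trans _ _ 0)// ?oppr_le0 ltW.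
rewrite /kap /level; ring.
Qed.

Lemma score_sumE n (X : 'M[R]_(n, p)) (xf : 'cV[R]_p) (c kap q : R) w :
  (0 < n)%N -> 0 < q -> n%:R = q ^+ 4 -> X^T *m X \in unitmx ->
  let e := error_vec eps n w in
  let D z := avg (fun i => (e i ord0 <= z)%R%:R) - F z in
  score_sum eps F c kap (extend 0 (leverage X xf)) n w =
  q ^+ 2 * (D c - D (- c) + kap * vmean e - kap * dotv xf (least_squares X e)).
Proof.
move=> n0 q0 nq Xu e D.
have q2 : Num.sqrt n%:R = q ^+ 2 :> R.
  by rewrite nq (exprM q 2 2) sqrtr_sqr ger0_norm// exprn_ge0// ltW.
have qn : q != 0 by rewrite gt_eqF.
pose u i : R := (e i ord0 <= c)%R%:R; pose l i : R := (e i ord0 <= - c)%R%:R.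
rewrite /score_sum /partial_sum.
rewrite (eq_bigr (fun i => q ^- 2 * (u i - l i - (F c - F (- c)) + kap * e i ord0 -
    kap * n%:R * (leverage X xf i * e i ord0)))); last first.
  by move=> i _; rewrite extendE /score q2 /u /l /e mxE; ring.
rewrite -mulr_sumr !big_split/= !sumrN sumr_const card_ord -!mulr_sumr -dotv_least_squares.
rewrite -[(F c - F (- c)) *+ n]mulr_natl /D /avg /vmean -/e.
rewrite nq; field.
exact: qn.
Qed.

Definition q4root n : R := Num.sqrt (Num.sqrt n%:R).

Lemma q4rootE n : (q4root n) ^+ 4 = n%:R.
Proof. by rewrite (exprM _ 2 2) !sqr_sqrtr// sqrtr_ge0. Qed.

Lemma near_q4root (a b : R) : 0 < b -> \forall n \near \oo, a < b * q4root n.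
Proof.
move=> b0; near=> n.
pose r := `|a| / b + 1.
have r0 : 0 <= r by rewrite addr_ge0// divr_ge0// ltW.
have rn : r ^+ 4 <= n%:R by near: n; exact: nbhs_infty_ger.
have rq : r <= q4root n.
  rewrite /q4root -[leLHS]ger0_norm// -sqrtr_sqr ler_sqrt ?sqrtr_ge0//.
  rewrite -[leLHS]ger0_norm ?sqr_ge0// -sqrtr_sqr ler_sqrt//.
  by rewrite -exprM.
apply: (@lt_le_trans _ _ (b * r)); last by rewrite ler_pM2l.
have -> : b * r = `|a| + b by rewrite /r; field; rewrite gt_eqF.
have := ler_norm a; lra.
Unshelve. all: by end_near. Qed.

End coverage_limit.

Lemma oscillation_total {R : realType} (q rho V w : R) (L M p : nat) :
  1 <= q -> 0 < rho -> 0 <= V -> 0 <= w -> L%:R <= w * q / rho + 1 ->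
  2 * ((L.*2.+4.+1 * M.*2.+1 ^ p)%N%:R *
    (q ^+ 4 * (3 * (V / q) + 8 * q ^+ 4 * (V / q) ^+ 2) / (q ^+ 4 * (rho / q ^+ 2)) ^+ 4))
  <= 2 * ((2 * (w / rho) + 7) * (M.*2.+1 ^ p)%N%:R * ((3 * V + 8 * V ^+ 2) / rho ^+ 4)) / q.
Proof.
move=> q1 rho0 V0 w0 Lw.
have q0 : 0 < q by exact: lt_le_trans q1.
have qn : q != 0 by rewrite gt_eqF.
have rn : rho != 0 by rewrite gt_eqF.
set Mp := (M.*2.+1 ^ p)%N%:R; set Bc := (3 * V + 8 * V ^+ 2) / rho ^+ 4.
have Mp0 : 0 <= Mp :> R by rewrite /Mp.
have V20 : 0 <= V ^+ 2 by exact: sqr_ge0.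
have Bc0 : 0 <= Bc by apply: divr_ge0; [lra|rewrite exprn_ge0// ltW].
set B := q ^+ 4 * _ / _.
have BE : B = (3 * V / q ^+ 3 + 8 * V ^+ 2) / rho ^+ 4 / q ^+ 2.
  by rewrite /B; field; rewrite qn rn.
have BB : B <= Bc / q ^+ 2.
  rewrite BE ler_pM2r ?invr_gt0 ?exprn_gt0// ler_pM2r ?invr_gt0 ?exprn_gt0// lerD2r.
  by rewrite ler_pdivrMr ?exprn_gt0// ler_peMr ?exprn_ege1//; lra.
have B0 : 0 <= B.
  rewrite BE; apply: divr_ge0; last by rewrite exprn_ge0// ltW.
  apply: divr_ge0; last by rewrite exprn_ge0// ltW.
  apply: addr_ge0; last by lra.
  by apply: divr_ge0; [lra|rewrite exprn_ge0// ltW].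
have LN : (L.*2.+4.+1)%:R <= (2 * (w / rho) + 7) * q.
  have -> : (L.*2.+4.+1)%:R = 2 * L%:R + 5 :> R.
    by rewrite -natr1 -addn4 natrD -addnn natrD; ring.
  have : w * q / rho = w / rho * q by ring.
  lra.
rewrite natrM -/Mp -!mulrA ler_pM2l//.
apply: (@le_trans _ _ ((2 * (w / rho) + 7) * q * (Mp * (Bc / q ^+ 2)))).
  apply: ler_pM => //; first by rewrite mulr_ge0.
  exact: ler_wpM2l.
have idn (a m b : R) : a * q * (m * (b / q ^+ 2)) = a * (m * (b / q)) by field.
by rewrite idn /Bc -!mulrA.
Qed.

Section coverage_limit.
Context {R : realType} {d : measure_display} {T : measurableType d}.
Context (P : probability T R) (eps : nat -> {RV P >-> R}).
Context (F : R -> R) (sigma alpha : R).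
Hypothesis iidE : forall n, iid (fun i : 'I_n => eps i) F.
Hypothesis varE : ('V_P[eps 0%N] = (sigma ^+ 2)%R%:E)%E.
Hypothesis meanE : ('E_P[eps 0%N] = 0)%E.
Hypothesis regE : error_regularity eps F.
Hypothesis F'0 : forall x, 0 < derive1 F x.
Hypothesis alpha01 : 0 < alpha < 1.

Let fourthE : ('E_P[fun w => (`|eps 0%N w| ^+ 4)%R] < +oo)%E.
Proof. by case: regE. Qed.

Context {p : nat} (X : forall n, 'M[R]_(n, p)) (xf beta b : 'cV[R]_p) (A : 'M[R]_p).
Hypothesis p_gt0 : (0 < p)%N.
Hypothesis regX : regular_design X xf A b.
Hypothesis U0 : forall x, 0 < x -> 0 < calU F (trunc_mean eps) sigma A b xf x.

Let level := 1 - alpha.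
Let good n := [set w | level <= coverage F (X n) xf beta level (response eps (X n) beta w)].

Lemma measurable_good n : (0 < n)%N -> measurable (good n).
Proof.
move=> n0; apply: measurable_set_le => //.
have l01 : 0 < level <= 1 by move: alpha01; rewrite /level; lra.
have my : random_mx (response eps (X n) beta).
  by apply: random_mxD; [exact: random_mx_cst|exact: random_error_vec].
exact: (measurable_coverage beta (F_measurable regE) (random_mx_cst (X n)) (random_mx_cst xf)
  my n0 l01).
Qed.

Lemma coverage_eventually zeta : 0 < zeta -> \forall n \near \oo,
  (P (good n) <= (1 / 2 + zeta)%:E)%E /\ (P (~` good n) <= (1 / 2 + zeta)%:E)%E.
Proof.
move=> z0.
have [KF HF] := F_smooth iidE regE F'0.
have [KF1 _ _ _ _] := HF.
have KF0 : 0 < KF by exact: lt_le_trans KF1.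
have lin (a1 a2 a3 r u z : R) : a1 * a2 <= u + a1 -> a1 <= r -> a3 <= z ->
  a1 * (a2 + 2) + a3 <= u + 3 * r + z by lra.
have l01 : 0 < level < 1 by move: alpha01; rewrite /level; lra.
have [c c0 Fc] := central_quantile (error_cdf iidE) (F_mono iidE regE) (F_continuous regE) l01.
set f := derive1 F in HF.
pose kap := f c - f (- c); pose fp := f c + f (- c).
have fp0 : 0 < fp by rewrite addr_gt0// /f.
have [C C1 dB] := design_bounds p_gt0 regX.
have C0 : 0 < C by exact: lt_le_trans C1.
pose v n := extend 0 (leverage (X n) xf).
pose eta := zeta / 4.
have eta0 : 0 < eta by rewrite divr_gt0.
have vC : \forall n \near \oo, forall k, (k < n)%N -> `|v n k| <= C / n%:R.
  near=> n => k kn; rewrite /v (extend_lt _ _ kn).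
  by have [lev _ _] : [/\ forall i, `|leverage (X n) xf i| <= C / n%:R,
      forall j i, `|estimator_weight (X n) j i| <= C / n%:R &
      forall i j, `|(regressor (X n) i - xbar (X n)) j ord0| <= C] by near: n.
have sv : (\sum_(k < n) v n k) @[n --> \oo] --> dotv xf (invmx A *m b).
  rewrite (_ : (fun n => _) = fun n => \sum_i leverage (X n) xf i); first exact: cvg_leverage_sum.
  by apply/funext => n; apply: eq_bigr => i _; rewrite /v extendE.
have sv2 : (n%:R * \sum_(k < n) v n k ^+ 2) @[n --> \oo] --> dotv xf (invmx A *m xf).
  have := cvg_leverage_sqr p_gt0 regX; apply: cvg_trans; apply: near_eq_cvg; near=> n.
  by congr (_ * _); apply: eq_bigr => i _; rewrite /v extendE.
have UE := @calU_score _ _ _ P eps F sigma p A b xf c c0.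
have [a0 a00 clt] := clt_score iidE varE meanE fourthE c0 (ltW C0) (U0 c0) UE vC sv sv2 eta0.
pose rho := a0 / (16 * KF + 2 + 2 * fp).
have den0 : 0 < 16 * KF + 2 + 2 * fp by lra.
have rho0 : 0 < rho by rewrite divr_gt0.
have a0E : (16 * KF + 2 + 2 * fp) * rho = a0 by rewrite /rho mulrC divfK// gt_eqF.
pose h1 := 1 + p.+2%:R * (C ^+ 2 * sigma ^+ 2) / eta.
have var0 : 0 <= p.+2%:R * (C ^+ 2 * sigma ^+ 2) by apply: mulr_ge0 => //; apply: mulr_ge0; exact: sqr_ge0.
have h11 : 1 <= h1 by rewrite lerDl divr_ge0// ltW.
have h10 : 0 < h1 by exact: lt_le_trans h11.
pose K := 1 + sigma ^+ 2 / eta.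
have K0 : 0 < K by apply: ltr_pwDl => //; apply: divr_ge0; [exact: sqr_ge0|exact: ltW].
pose ne := noise_energy (p := p) C h1 K; pose nb := noise_bound (p := p) C h1.
have nb20 : 0 <= nb ^+ 2 by exact: sqr_ge0.
have ne0 : 0 <= ne.
  by apply: mulr_ge0; [exact: sqr_ge0|move: nb20 K0; rewrite /nb; lra].
pose tau := 1 + 20 * ne / rho.
have tau1 : 1 <= tau by rewrite lerDl divr_ge0 ?(ltW rho0)//; lra.
have tau0 : 0 < tau by exact: lt_le_trans tau1.
have tau_large : 20 * ne <= rho * tau ^+ 2.
  apply: (@le_trans _ _ (rho * tau)); last by rewrite ler_pM2l// expr2 ler_peMl// ltW.
  have -> : rho * tau = rho + 20 * ne by rewrite /tau; field; rewrite gt_eqF.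
  by rewrite lerDr ltW.
have pC : 0 < p%:R * C := pC_gt0 p_gt0 C1.
pose M := (Num.truncn (h1 * (p%:R * C) / rho)).+1.
have MM : h1 * (p%:R * C) / rho <= M%:R by exact/ltW/truncnS_gt.
pose V := KF * (tau + h1 + rho * (3 + M%:R)).
have V0 : 0 <= V.
  apply: mulr_ge0; first lra.
  by apply: addr_ge0; [lra|rewrite mulr_ge0 ?(ltW rho0)// addr_ge0].
pose G := 2 * ((2 * ((tau + h1) / rho) + 7) * (M.*2.+1 ^ p)%N%:R * ((3 * V + 8 * V ^+ 2) / rho ^+ 4)).
pose J := `|kap| * h1 / fp + rho.
have c20 : 0 < 2 * c by rewrite mulr_gt0.
have t20 : 0 < tau / 2 by rewrite divr_gt0.
have fr0 : 0 < fp * rho by rewrite mulr_gt0.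
near=> n.
have pn : (p <= n)%N by near: n; exists p.
have n0 : (0 < n)%N by exact: leq_trans pn.
pose q := q4root n : R.
have nq : n%:R = q ^+ 4 by rewrite q4rootE.
have q1' : 1 < 1 * q4root n :> R by near: n; apply: near_q4root.
have q1 : 1 <= q by move: q1'; rewrite mul1r => /ltW.
have q0 : 0 < q by exact: lt_le_trans q1.
have q20 : 0 < q ^+ 2 by exact: exprn_gt0.
have q2q : q <= q ^+ 2 by rewrite expr2 ler_peMl ?(ltW q0).
have qG : G < eta * q4root n :> R by near: n; apply: near_q4root.
have q_c : tau < 2 * c * q4root n :> R by near: n; apply: near_q4root.
have q_noise : nb ^+ 2 < rho * q4root n :> R by near: n; apply: near_q4root.
have q_tau : tau * h1 < rho * q4root n :> R by near: n; apply: near_q4root.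
have q_h : 2 * KF * h1 < 1 * q4root n :> R by near: n; apply: near_q4root.
have q_energy : 2 * KF * ne < rho * q4root n :> R by near: n; apply: near_q4root.
have q_J : J < tau / 2 * q4root n :> R by near: n; apply: near_q4root.
have q_fp : 2 * KF * (J + h1) ^+ 2 < fp * rho * q4root n :> R by near: n; apply: near_q4root.
have [levC ewC XC] : [/\ forall i, `|leverage (X n) xf i| <= C / n%:R,
      forall j i, `|estimator_weight (X n) j i| <= C / n%:R &
      forall i j, `|(regressor (X n) i - xbar (X n)) j ord0| <= C] by near: n.
have [clt1 clt2] : (P [set w | (- a0 <= score_sum eps F c kap (v n) n w)%R] <= (1 / 2 + eta)%:E)%E /\
    (P [set w | (score_sum eps F c kap (v n) n w <= a0)%R] <= (1 / 2 + eta)%:E)%E by near: n.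
pose L := (Num.truncn ((tau + h1) * q / rho)).+1.
have w0 : 0 <= tau + h1 by rewrite addr_ge0// ltW.
have L1 : (tau + h1) * q / rho <= L%:R by exact/ltW/truncnS_gt.
have L2 : L%:R <= (tau + h1) * q / rho + 1.
  have x0 : 0 <= (tau + h1) * q / rho.
    by apply: divr_ge0; [apply: mulr_ge0 => //; exact: ltW|exact: ltW].
  by rewrite /L -natr1 lerD2r; have /andP[] := truncn_itv x0.
pose s := rho / q ^+ 2; pose h := h1 / q ^+ 2.
have s0 : 0 < s by exact: divr_gt0.
have h0 : 0 < h by exact: divr_gt0.
have sL : s * L%:R <= (tau + h1) / q + s.
  apply: (@le_trans _ _ (s * ((tau + h1) * q / rho + 1))); first by rewrite ler_pM2l.
  by rewrite le_eqVlt; apply/orP; left; apply/eqP; rewrite /s; field; rewrite !gt_eqF.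
have sq : s <= rho / q by rewrite /s ler_pM2l// lef_pV2.
have Fv yc : yc = c \/ yc = - c -> forall k m i,
    `|F (grid_threshold (X n) C s yc (L := L) (M := M) k m i) - F yc| <= V / q.
  move=> _ k m i; have [_ _ _ T3 _] := HF; apply: (le_trans (T3 _ _)).
  rewrite /V -mulrA ler_pM2l//.
  apply: (le_trans (grid_threshold_dist p_gt0 C1 s0 XC _ _ _ _)).
  have -> : L.+2%:R = L%:R + 2 :> R by rewrite -addn2 natrD.
  have sM : s * M%:R <= rho / q * M%:R by exact: ler_wpM2r.
  have -> : (tau + h1 + rho * (3 + M%:R)) / q = (tau + h1) / q + 3 * (rho / q) + rho / q * M%:R by ring.
  exact: lin.
have Vq0 : 0 <= V / q by rewrite divr_ge0// ltW.
have [Bad [mBad PBad] nBad] := regular_sample_rare iidE varE meanE fourthE n0 C1 s0 h0 Vq0 K0 levC ewC Fv.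
have PB : (P Bad <= (3 * eta)%:E)%E.
  apply: (le_trans PBad); rewrite lee_fin.
  have b1 : p.+2%:R * (C ^+ 2 * sigma ^+ 2 / (n%:R * h ^+ 2)) <= eta.
    have -> : n%:R * h ^+ 2 = h1 ^+ 2 by rewrite nq /h; field; rewrite gt_eqF.
    rewrite mulrA ler_pdivrMr ?exprn_gt0//.
    apply: (@le_trans _ _ (eta * h1)); last by rewrite ler_pM2l// expr2 ler_peMl// ltW.
    have -> : eta * h1 = eta + p.+2%:R * (C ^+ 2 * sigma ^+ 2) by rewrite /h1; field; rewrite gt_eqF.
    by rewrite lerDr ltW.
  have b2 : sigma ^+ 2 / K <= eta.
    rewrite ler_pdivrMr//.
    have -> : eta * K = eta + sigma ^+ 2 by rewrite /K; field; rewrite gt_eqF.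
    by rewrite lerDr ltW.
  have b3 := @oscillation_total R q rho V (tau + h1) L M p q1 rho0 V0 w0 L2.
  have b4 : G / q <= eta by rewrite ler_pdivrMr// ltW.
  rewrite -nq -/s in b3.
  have -> : 3 * eta = eta + eta + eta by ring.
  by rewrite lerD ?lerD// (le_trans b3).
have Fcc : F c - F (- c) = level by exact: Fc.
have dich w : ~ Bad w -> ((score_sum eps F c kap (v n) n w < - a0 -> good n w) /\
   (a0 < score_sum eps F c kap (v n) n w -> ~ good n w)).
  move=> /nBad [ebar theta_h t_h e2K osc].
  have Xu : (X n)^T *m X n \in unitmx by case: regX => h' *; exact: h'.
  have Ls : tau / q + h1 / q ^+ 2 <= rho / q ^+ 2 * L%:R.
    apply: (@le_trans _ _ ((tau + h1) / q)).
      have -> : (tau + h1) / q = tau / q + h1 / q by ring.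
      by rewrite lerD2l ler_pM2l// lef_pV2.
    have -> : (tau + h1) / q = rho / q ^+ 2 * ((tau + h1) * q / rho) by field; rewrite !gt_eqF.
    by rewrite ler_pM2l.
  have Ms : h1 / q ^+ 2 <= grid_mesh (p := p) C (rho / q ^+ 2) * M%:R.
    have -> : h1 / q ^+ 2 = grid_mesh (p := p) C (rho / q ^+ 2) * (h1 * (p%:R * C) / rho).
      have pn0 : p%:R != 0 :> R by rewrite pnatr_eq0 -lt0n.
      by rewrite /grid_mesh; field; rewrite pn0 !gt_eqF.
    by rewrite ler_pM2l// grid_mesh_gt0.
  have lev1 : 0 < F c - F (- c) <= 1 by rewrite Fcc; lra.
  have [] := coverage_dichotomy HF beta n0 p_gt0 Xu nq C1 rho0 tau0 (ltW h10) (ltW K0) q1 XC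
    levC ebar theta_h t_h e2K Ls Ms (osc _ (or_introl erefl)) (osc _ (or_intror erefl)) fp0
    lev1 tau_large q_c (ltW q_noise) (ltW q_tau) (ltW q_h) (ltW q_energy) (ltW q_J) q_fp.
  rewrite Fcc a0E -(score_sumE eps F xf c kap w n0 q0 nq Xu) => d1 d2.
  rewrite /good/= /response coverage_model//; split; first exact: d1.
  by move=> Z; apply/negP; rewrite -ltNge; exact: d2.
have mS : measurable_fun setT (score_sum eps F c kap (v n) n).
  apply: measurable_partial_sumT => k.
  apply: measurable_funM => //; apply: measurable_funD.
    apply: measurable_funB => //; apply: measurable_funB; exact: measurable_ind_le.
  exact: measurable_funM.
have mg := measurable_good n0.
have cover (A1 S : set T) : measurable A1 -> measurable S -> (P S <= (1 / 2 + eta)%:E)%E ->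
    A1 `<=` S `|` Bad -> (P A1 <= (1 / 2 + zeta)%:E)%E.
  move=> mA mS' PS sub; apply: (@le_trans _ _ (P (S `|` Bad))).
    by apply: le_measure => //; rewrite inE//; exact: measurableU.
  apply: (le_trans (measureU2 _ _ _)) => //.
  have -> : (1 / 2 + zeta)%:E = ((1 / 2 + eta)%:E + (3 * eta)%:E)%E.
    by rewrite -EFinD; congr (_%:E); rewrite /eta; field.
  exact: leeD.
split.
  apply: cover clt2 _ => //; first exact: measurable_set_le.
  move=> w gw; have [Bw|/dich[_ d2]] := pselect (Bad w); first by right.
  by left; rewrite /= leNgt; apply/negP => /d2; exact.
apply: cover clt1 _; [exact: measurableC|exact: measurable_set_le|].
move=> w gw; have [Bw|/dich[d1 _]] := pselect (Bad w); first by right.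
by left; rewrite /= leNgt; apply/negP => /d1; exact.
Unshelve. all: by end_near. Qed.

Lemma coverage_limit : fine (P (good n)) @[n --> \oo] --> (2^-1 : R).
Proof.
apply/cvgrPdist_le => zeta z0; near=> n.
have n0 : (0 < n)%N by near: n; exists 1%N.
have [u1 u2] : (P (good n) <= (1 / 2 + zeta)%:E)%E /\ (P (~` good n) <= (1 / 2 + zeta)%:E)%E.
  by near: n; exact: coverage_eventually.
have mg := measurable_good n0.
have fg : P (good n) \is a fin_num by exact: fin_num_measure.
rewrite probability_setC// in u2.
rewrite -(fineK fg) -?EFinB !lee_fin in u1 u2.
by rewrite ler_norml; apply/andP; split; lra.
Unshelve. all: by end_near. Qed.

End coverage_limit.

Section future_error.
Context {R : realType} {d : measure_display} {T : measurableType d}.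
Context (P : probability T R) (eps : nat -> {RV P >-> R}) (epsf : {RV P >-> R}).
Context (F : R -> R).
Hypothesis cdf0 : forall x, cdf (eps 0%N) x = (F x)%:E.
Hypothesis cdff : forall x, cdf epsf x = (F x)%:E.
Hypothesis acE : distribution P (eps 0%N) `<< lebesgue_measure.

Lemma future_error_distribution B : measurable B ->
  P (epsf @^-1` B) = P (eps 0%N @^-1` B).
Proof.
apply: (@measure_unique_cdf _ (distribution P epsf) (distribution P (eps 0%N))).
- by apply: (@le_lt_trans _ _ 1%E); [exact: probability_le1|exact: ltry].
- by transitivity (1%E : \bar R); [|symmetry]; exact: probability_setT.
- by move=> x; exact: etrans (cdff x) (esym (cdf0 x)).
Qed.

Lemma future_error_atomless a : P (epsf @^-1` [set a]) = 0%E.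
Proof.
rewrite future_error_distribution//.
have ma : measurable [set a] by exact: measurable_set1.
have nl : lebesgue_measure.-null_set [set a].
  by apply/measure0_null_setP => //; exact: lebesgue_measure_set1.
exact: (measure0_null_setP _ ma).1 (acE nl).
Qed.

Lemma future_error_interval t c : 0 <= c ->
  fine (P [set w | `|epsf w - t| <= c]) = F (t + c) - F (t - c).
Proof.
move=> c0.
pose A := epsf @^-1` `]-oo, (t - c)%R]; pose B := epsf @^-1` `]-oo, (t + c)%R].
pose D := epsf @^-1` `](t - c)%R, (t + c)%R].
have mI (I : interval R) : measurable (epsf @^-1` [set` I]).
  by rewrite -[X in measurable X]setTI; exact: measurable_funP.
have BE : B = A `|` D.
  rewrite /A /B /D -preimage_setU; congr (_ @^-1` _).
  apply/seteqP; split => x /=; rewrite !in_itv/= => h.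
    by case: (leP x (t - c)) => h'; [left|right; rewrite h].
  by case: h => [|/andP[]//]; lra.
have AD : A `&` D = set0.
  apply/seteqP; split => w //; rewrite /A /D/= !in_itv/= => -[h /andP[h' _]].
  by move: h; rewrite leNgt h'.
have PB : P B = (P A + P D)%E by rewrite BE (measureU _ (mI _) (mI _) AD).
have ED : [set w | `|epsf w - t| <= c] = epsf @^-1` [set (t - c)] `|` D.
  apply/seteqP; split => w; rewrite /D/= in_itv/= ler_distl.
    move=> /andP[h1 h2]; have [->|ne] := eqVneq (epsf w) (t - c); first by left.
    by right; rewrite h2 andbT lt_neqAle eq_sym ne.
  by case=> [->|/andP[/ltW -> ->]//]; rewrite lexx/=; lra.
have mN : measurable (epsf @^-1` [set (t - c)]).
  by rewrite -[X in measurable X]setTI; exact: measurable_funP.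
have mD : measurable D by exact: mI.
have PE : P [set w | `|epsf w - t| <= c] = P D.
  rewrite ED; apply/eqP; rewrite eq_le; apply/andP; split.
    apply: (@le_trans _ _ (P (epsf @^-1` [set (t - c)%R]) + P D)%E); first exact: measureU2.
    by rewrite future_error_atomless add0e.
  apply: le_measure; [by rewrite inE|by rewrite inE; exact: measurableU|exact: subsetUr].
have PA : P A = (F (t - c))%:E by rewrite -cdff.
have PBF : P B = (F (t + c))%:E by rewrite -cdff.
rewrite PE; have fD : P D \is a fin_num by exact: fin_num_measure.
move: PB; rewrite PA PBF -(fineK fD) -EFinD => -[->]; ring.
Qed.

End future_error.

Section almost_everywhere.
Context {R : realType} {d : measure_display} {T : measurableType d}.
Context (P : probability T R).

Lemma sigma_gen_sub (G H : set_system T) : G `<=` <<s H >> -> <<s G >> `<=` <<s H >>.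
Proof. by move=> GH; apply: smallest_sub => //; exact: smallest_sigma_algebra. Qed.

Lemma sigma_genI (G : set_system T) A B : <<s G >> A -> <<s G >> B -> <<s G >> (A `&` B).
Proof. exact: (@measurableI _ (g_sigma_algebraType G)). Qed.

Lemma probability_ae_le (A B : set T) : measurable A -> measurable B ->
  {ae P, forall w, A w -> B w} -> (P A <= P B)%E.
Proof.
move=> mA mB [N [mN N0 sub]].
apply: (@le_trans _ _ (P (B `|` N))).
  apply: le_measure; rewrite ?inE//; first exact: measurableU.
  move=> w Aw; have [Bw|nB] := pselect (B w); [by left|right].
  by apply: sub => /= /(_ Aw).
apply: (@le_trans _ _ (P B + P N)%E); first exact: measureU2.
by rewrite N0 adde0.
Qed.

Lemma probability_ae_eq (f g : T -> R) (l : R) (C : set T) :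
  measurable_fun setT f -> measurable_fun setT g -> measurable C ->
  {ae P, forall w, f w = g w} ->
  P ([set w | l <= f w] `&` C) = P ([set w | l <= g w] `&` C).
Proof.
move=> mf mg mC fg.
have mA h : measurable_fun setT h -> measurable ([set w | l <= h w] `&` C).
  by move=> mh; apply: measurableI => //; exact: measurable_set_le.
apply/eqP; rewrite eq_le; apply/andP; split; apply: probability_ae_le; try exact: mA.
  by apply: filterS fg => w /= -> .
by apply: filterS fg => w /= <- .
Qed.

Lemma measurable_cond_prob (G : set_system T) E g : G `<=` measurable ->
  cond_prob_version P G E g -> measurable_fun setT (cond_prob P G E).
Proof.
move=> GM vg; have [mc _ _] := cond_probP vg.
by move=> _ B mB; rewrite setTI; apply: (g_sigma_measurable GM); exact: mc.
Qed.

End almost_everywhere.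

Section conditional_coverage.
Context {R : realType} {d : measure_display} {T : measurableType d}.
Context (P : probability T R) (eps : nat -> {RV P >-> R}) (epsf : {RV P >-> R}).
Context (F : R -> R).
Hypothesis cdf0 : forall x, cdf (eps 0%N) x = (F x)%:E.
Hypothesis cdff : forall x, cdf epsf x = (F x)%:E.
Hypothesis regE : error_regularity eps F.

Context {p n : nat} (n0 : (0 < n)%N) (G : set_system T).
Context (X : T -> 'M[R]_(n, p)) (xf : T -> 'cV[R]_p) (y : T -> 'cV[R]_n) (beta : 'cV[R]_p).
Context (level : R).
Hypothesis level01 : 0 < level <= 1.
Hypothesis GM : G `<=` measurable.
Hypothesis mX : random_mx (X : g_sigma_algebraType G -> _).
Hypothesis mxf : random_mx (xf : g_sigma_algebraType G -> _).
Hypothesis my : random_mx (y : g_sigma_algebraType G -> _).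
Hypothesis ind : independent P G (rv_events epsf).

Lemma future_centered (z b : 'cV[R]_p) w :
  future epsf z beta w - dotv z b = epsf w - dotv z (b - beta).
Proof. by rewrite /future [dotv z (b - beta)]dotvC dotvBl !(dotvC _ z); ring. Qed.

Lemma cond_coverage_version : cond_prob_version P G
  [set w | `|future epsf (xf w) beta w - dotv (xf w) (least_squares (X w) (y w))|
           <= boot_critical (X w) (xf w) (y w) level]
  (fun w => coverage F (X w) (xf w) beta level (y w)).
Proof.
pose t w := dotv (xf w) (least_squares (X w) (y w) - beta).
pose c w := boot_critical (X w) (xf w) (y w) level.
pose b (w w' : T) := `|epsf w' - t w| <= c w.
have mf : rv_events epsf `<=` measurable by apply: rv_events_measurable; exact: measurable_funP.
have mt : measurable_fun setT (t : g_sigma_algebraType G -> R).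
  apply: random_mx_dotv => //; apply: random_mxB; first exact: random_mx_least_squares.
  exact: random_mx_cst.
have mc : measurable_fun setT (c : g_sigma_algebraType G -> R).
  exact: measurable_boot_critical.
have me : measurable_fun setT (epsf : g_sigma_algebraType (rv_events epsf) -> R).
  by move=> _ B mB; rewrite setTI; apply: sub_gen_smallest; exists B => //; rewrite setTI.
have mb : measurable_fun setT
    (fun z : g_sigma_algebraType G * g_sigma_algebraType (rv_events epsf) => b z.1 z.2).
  apply: measurable_fun_ler; last exact: (measurableT_comp mc).
  apply: measurableT_comp => //; apply: measurable_funB; first exact: (measurableT_comp me).
  exact: (measurableT_comp mt).
have E1 : [set w | `|future epsf (xf w) beta w - dotv (xf w) (least_squares (X w) (y w))|
     <= boot_critical (X w) (xf w) (y w) level] = [set w | b w w].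
  by apply/funext => w /=; rewrite future_centered.
have E2 : (fun w => coverage F (X w) (xf w) beta level (y w)) =
    (fun w => fine (P [set w' | b w w'])).
  apply/funext => w; rewrite /coverage -/(t w) -/(c w); symmetry.
  apply: (future_error_interval cdf0 cdff); first by case: regE => -[].
  exact: boot_critical_ge0.
have V := cond_prob_version_frozen GM mf ind mb.
by rewrite E1 E2; exact: V.
Qed.

Lemma cond_coverage_ae :
  let E := [set w | `|future epsf (xf w) beta w - dotv (xf w) (least_squares (X w) (y w))|
           <= boot_critical (X w) (xf w) (y w) level] in
  measurable_fun setT (cond_prob P G E) /\
  {ae P, forall w, cond_prob P G E w = coverage F (X w) (xf w) beta level (y w)}.
Proof.
by split; [exact: measurable_cond_prob GM cond_coverage_version|
  exact: cond_prob_ae GM _ _ cond_coverage_version].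
Qed.

End conditional_coverage.

Section fixed_design.
Context {R : realType} {p : nat} {d : measure_display} {T : measurableType d}.
Context (P : probability T R) (eps : nat -> {RV P >-> R}) (epsf : {RV P >-> R}).
Context (F : R -> R) (sigma alpha : R) (beta : 'cV[R]_p).
Hypothesis p_gt0 : (0 < p)%N.
Hypothesis model : error_model eps epsf F sigma.
Hypothesis regE : error_regularity eps F.
Hypothesis F'0 : forall x : R, 0 < derive1 F x.
Hypothesis alpha01 : 0 < alpha < 1.
Let level := 1 - alpha.
Let iidE : forall n, iid (fun i : 'I_n => eps i) F. Proof. by case: model. Qed.
Let cdff : forall x, cdf epsf x = (F x)%:E. Proof. by case: model. Qed.
Let indE : forall n, independent P (rv_events epsf) (mx_events (error_vec eps n)).
Proof. by case: model. Qed.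
Let level01 : 0 < level <= 1. Proof. by move: alpha01; rewrite /level; lra. Qed.
Let rv_epsf_measurable : rv_events epsf `<=` measurable.
Proof. by apply: rv_events_measurable; exact: measurable_funP. Qed.

Section one_sample.
Context (n : nat) (n0 : (0 < n)%N).
Let E_ := mx_events (error_vec eps n).
Let EM : E_ `<=` measurable.
Proof. by apply: mx_events_measurable; exact: random_error_vec. Qed.

Lemma fixed_cond_coverage (X : 'M[R]_(n, p)) (xf : 'cV[R]_p) (y := response eps X beta) :
  let E := [set w | `|future epsf xf beta w - dotv xf (least_squares X (y w))|
                    <= boot_critical X xf (y w) level] in
  measurable_fun setT (cond_prob P (mx_events y) E) /\
  {ae P, forall w, cond_prob P (mx_events y) E w = coverage F X xf beta level (y w)}.
Proof.
have mye : random_mx (y : g_sigma_algebraType E_ -> _).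
  apply: random_mxD; first exact: random_mx_cst.
  by apply: random_mx_events; exact: sub_gen_smallest.
have yE : mx_events y `<=` <<s E_ >> by exact: mx_events_sub.
have GM : mx_events y `<=` measurable.
  by move=> A /yE; exact: g_sigma_measurable.
have my : random_mx (y : g_sigma_algebraType (mx_events y) -> _).
  by apply: random_mx_events; exact: sub_gen_smallest.
have ind : independent P (mx_events y) (rv_events epsf).
  by apply: independent_sub (independentC (@indE n)); [|exact: sub_gen_smallest].
exact: (cond_coverage_ae (error_cdf iidE) cdff regE n0 beta level01 GM
  (random_mx_cst X) (random_mx_cst xf) my ind).
Qed.

Context (X : T -> 'M[R]_(n, p)) (xf : T -> 'cV[R]_p).
Hypothesis mX : random_mx X.
Hypothesis mxf : random_mx xf.
Hypothesis indxf : independent P (mx_events xf) (mx_events (error_vec eps n) `|` rv_events epsf).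
Hypothesis indX : independent P (mx_events X)
  (mx_events (error_vec eps n) `|` rv_events epsf `|` mx_events xf).
Let y w := response eps (X w) beta w.

Let XM : mx_events X `<=` measurable := mx_events_measurable mX.
Let xfM : mx_events xf `<=` measurable := mx_events_measurable mxf.

Lemma design_errors_independent_future :
  independent P ((E_ `|` mx_events xf) `|` mx_events X) (rv_events epsf).
Proof.
have sgm (G : set_system T) : G `<=` <<s G >> by exact: sub_gen_smallest.
apply: independent_setU => //.
  by move=> A [/EM|/xfM].
move=> A B C sA sB sC.
have sAC : <<s E_ `|` rv_events epsf `|` mx_events xf >> (A `&` C).
  apply: sigma_genI.
    by apply: sigma_gen_sub sA => Z [?|?]; apply: sgm; [left; left|right].
  by apply: sigma_gen_sub sC => Z ?; apply: sgm; left; right.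
have sA' : <<s E_ `|` rv_events epsf `|` mx_events xf >> A.
  by apply: sigma_gen_sub sA => Z [?|?]; apply: sgm; [left; left|right].
have PAC : P (A `&` C) = (P A * P C)%E.
  have ind : independent P (E_ `|` mx_events xf) (rv_events epsf).
    apply: independent_setU => // A1 B1 C1 sA1 sB1 sC1.
    have sA1' : <<s E_ `|` rv_events epsf >> A1.
      by apply: sigma_gen_sub sA1 => Z ?; apply: sgm; left.
    have sC1' : <<s E_ `|` rv_events epsf >> C1.
      by apply: sigma_gen_sub sC1 => Z ?; apply: sgm; right.
    have e1 := indxf sB1 (sigma_genI sA1' sC1'); have e2 := indxf sB1 sA1'.
    have e3 : P (A1 `&` C1) = (P A1 * P C1)%E := independentC (@indE n) sA1 sC1.
    by rewrite [A1 `&` B1]setIC -setIA e1 e2 e3 muleA.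
  exact: ind.
have e1 := indX sB sAC; have e2 := indX sB sA'.
by rewrite [A `&` B]setIC -setIA e1 e2 PAC muleA.
Qed.

Lemma random_cond_coverage :
  let E := [set w | `|future epsf (xf w) beta w - dotv (xf w) (least_squares (X w) (y w))|
                    <= boot_critical (X w) (xf w) (y w) level] in
  let G := mx_events y `|` mx_events X `|` mx_events xf in
  measurable_fun setT (cond_prob P G E) /\
  {ae P, forall w, cond_prob P G E w = coverage F (X w) (xf w) beta level (y w)}.
Proof.
move=> E G.
pose H := (E_ `|` mx_events xf) `|` mx_events X.
have sgm (G' : set_system T) : G' `<=` <<s G' >> by exact: sub_gen_smallest.
have HM : H `<=` measurable by move=> A [[/EM|/xfM]|/XM].
have myH : random_mx (y : g_sigma_algebraType H -> _).
  apply: random_mxD; last first.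
    by apply: random_mx_events => Z ?; apply: sgm; left; left.
  apply: random_mxM; last exact: random_mx_cst.
  by apply: random_mx_events => Z ?; apply: sgm; right.
have GH : G `<=` <<s H >>.
  move=> Z [[|]|]; first exact: mx_events_sub.
    by move=> ?; apply: sgm; right.
  by move=> ?; apply: sgm; left; right.
have GM : G `<=` measurable by move=> A /GH; exact: g_sigma_measurable.
have myG : random_mx (y : g_sigma_algebraType G -> _).
  by apply: random_mx_events => Z ?; apply: sgm; left; left.
have mXG : random_mx (X : g_sigma_algebraType G -> _).
  by apply: random_mx_events => Z ?; apply: sgm; left; right.
have mxfG : random_mx (xf : g_sigma_algebraType G -> _).
  by apply: random_mx_events => Z ?; apply: sgm; right.
have ind : independent P G (rv_events epsf).
  by apply: independent_sub design_errors_independent_future.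
exact: (cond_coverage_ae (error_cdf iidE) cdff regE n0 beta level01 GM mXG mxfG myG ind).
Qed.

Lemma random_cond_guarantee :
  let E := [set w | `|future epsf (xf w) beta w - dotv (xf w) (least_squares (X w) (y w))|
                    <= boot_critical (X w) (xf w) (y w) level] in
  let G := mx_events y `|` mx_events X `|` mx_events xf in
  {ae P, forall w, cond_prob P (mx_events X `|` mx_events xf)
      [set w1 | level <= cond_prob P G E w1] w =
    fine (P [set w' | level <= coverage F (X w) (xf w) beta level (response eps (X w) beta w')])}.
Proof.
move=> E G.
have sgm (G' : set_system T) : G' `<=` <<s G' >> by exact: sub_gen_smallest.
pose D := mx_events X `|` mx_events xf.
have DM : D `<=` measurable by move=> A [/XM|/xfM].
have mF := F_measurable regE.
pose b w w' := level <= coverage F (X w) (xf w) beta level (X w *m beta + error_vec eps n w').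
have indD : independent P D E_.
  apply: independent_setU => // A B C sA sB sC.
  have sB' : <<s E_ `|` rv_events epsf `|` mx_events xf >> B.
    by apply: sigma_gen_sub sB => Z ?; apply: sgm; right.
  have sC' : <<s E_ `|` rv_events epsf `|` mx_events xf >> C.
    by apply: sigma_gen_sub sC => Z ?; apply: sgm; left; left.
  have sC2 : <<s E_ `|` rv_events epsf >> C.
    by apply: sigma_gen_sub sC => Z ?; apply: sgm; left.
  have e1 := indX sA (sigma_genI sB' sC'); have e2 := indX sA sB'; have e3 := indxf sB sC2.
  by rewrite -setIA e1 e2 e3 muleA.
have mb : measurable_fun setT
    (fun z : g_sigma_algebraType D * g_sigma_algebraType E_ => b z.1 z.2).
  apply: measurable_fun_ler => //.
  have mX1 : random_mx (fun z : g_sigma_algebraType D * g_sigma_algebraType E_ => X z.1).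
    move=> i j; apply: (@measurableT_comp _ _ _ _ _ _ (fun w : g_sigma_algebraType D => X w i j)) => //.
    by apply: random_mx_events => Z ?; apply: sgm; left.
  have mxf1 : random_mx (fun z : g_sigma_algebraType D * g_sigma_algebraType E_ => xf z.1).
    move=> i j; apply: (@measurableT_comp _ _ _ _ _ _ (fun w : g_sigma_algebraType D => xf w i j)) => //.
    by apply: random_mx_events => Z ?; apply: sgm; right.
  have me2 : random_mx (fun z : g_sigma_algebraType D * g_sigma_algebraType E_ => error_vec eps n z.2).
    move=> i j; apply: (@measurableT_comp _ _ _ _ _ _
      (fun w : g_sigma_algebraType E_ => error_vec eps n w i j)) => //.
    by apply: random_mx_events; exact: sgm.
  apply: (measurable_coverage beta mF mX1 mxf1 _ n0 level01).
  by apply: random_mxD => //; apply: random_mxM => //; exact: random_mx_cst.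
have vb := cond_prob_version_frozen DM EM indD mb.
have [mc aec] := random_cond_coverage.
have mcov : measurable_fun setT (fun w => coverage F (X w) (xf w) beta level (y w)).
  apply: measurable_coverage => //.
  apply: random_mxD; last exact: random_error_vec.
  by apply: random_mxM => //; exact: random_mx_cst.
have v : cond_prob_version P D [set w1 | level <= cond_prob P G E w1]
    (fun w => fine (P [set w' | b w w'])).
  apply: cond_prob_version_congr vb => // C sC; symmetry.
  by apply: probability_ae_eq => //; exact: (g_sigma_measurable DM).
exact: (cond_prob_ae DM v).
Qed.

End one_sample.
End fixed_design.

Theorem corollary1 (R : realType) (p : nat) (p_gt0 : (0 < p)%N)
    (d : measure_display) (T : measurableType d) (P : probability T R)
    (eps : nat -> {RV P >-> R}) (epsf : {RV P >-> R})
    (F : R -> R) (sigma : R) (beta : 'cV[R]_p) (alpha : R)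
    (hmodel : error_model eps epsf F sigma)
    (hreg : error_regularity eps F)
    (hF' : forall x : R, 0 < derive1 F x)
    (halpha : 0 < alpha < 1)
    (dS : measure_display) (S : nat -> T -> measurableType dS)
    (Q : forall n (w : T), probability (S n w) R)
    (es : forall n (w : T), 'I_n -> {RV (Q n w) >-> R})
    (esf : forall n (w : T), {RV (Q n w) >-> R}) :
  (forall (X : forall n, 'M[R]_(n, p)) (xf : 'cV[R]_p)
      (A : 'M[R]_p) (b : 'cV[R]_p),
    let y n w := response eps (X n) beta w in
    let yf w := future epsf xf beta w in
    let c n w := boot_quantile (es n w) (esf n w) (X n) (y n w) xf (1 - alpha) in
    regular_design X xf A b ->
    (forall x, 0 < x -> 0 < calU F (trunc_mean eps) sigma A b xf x) ->
    (forall n w, (p <= n)%N ->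
      bootstrap_errors (es n w) (esf n w) (X n) (y n w)) ->
    P [set w | 1 - alpha <=
        cond_prob P (mx_events (y n))
          [set w' | `|yf w' - dotv xf (least_squares (X n) (y n w'))| <= c n w'] w]
      @[n --> \oo] --> (2^-1)%:E)
  /\
  (forall (X : forall n, T -> 'M[R]_(n, p)) (xf : T -> 'cV[R]_p),
    let y n w := response eps (X n w) beta w in
    let yf w := future epsf (xf w) beta w in
    let c n w :=
      boot_quantile (es n w) (esf n w) (X n w) (y n w) (xf w) (1 - alpha) in
    random_design eps epsf X xf ->
    {ae P, forall w, exists A b,
      regular_design (fun n => X n w) (xf w) A b /\
      forall x, 0 < x -> 0 < calU F (trunc_mean eps) sigma A b (xf w) x} ->
    (forall n w, (p <= n)%N ->
      bootstrap_errors (es n w) (esf n w) (X n w) (y n w)) ->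
    {ae P, forall w,
      cond_prob P (mx_events (X n) `|` mx_events xf)
        [set w1 | 1 - alpha <=
          cond_prob P (mx_events (y n) `|` mx_events (X n) `|` mx_events xf)
            [set w2 | `|yf w2 - dotv (xf w2) (least_squares (X n w2) (y n w2))|
                      <= c n w2] w1] w
        @[n --> \oo] --> (2^-1 : R)}).
Proof.
have [iidE cdff indE varE meanE] := hmodel.
have level01 : 0 < 1 - alpha <= 1 by move: halpha; lra.
split.
- move=> X xf A b y yf c regX U0 hboot.
  have lim := coverage_limit iidE varE meanE hreg hF' halpha beta p_gt0 regX U0.
  suff : (fine (P [set w | 1 - alpha <= coverage F (X n) xf beta (1 - alpha) (y n w)]))%:E
      @[n --> \oo] --> (2^-1)%:E.
    apply: cvg_trans; apply: near_eq_cvg; near=> n.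
    have pn : (p <= n)%N by near: n; exists p.
    have n0 : (0 < n)%N by exact: leq_trans pn.
    have [mc aec] := fixed_cond_coverage beta hmodel hreg halpha n0 (X n) xf.
    have my : random_mx (y n).
      by apply: random_mxD; [exact: random_mx_cst|exact: random_error_vec].
    have mcov : measurable_fun setT (fun w => coverage F (X n) xf beta (1 - alpha) (y n w)).
      exact: (measurable_coverage beta (F_measurable hreg) (random_mx_cst (X n))
        (random_mx_cst xf) my n0 level01).
    rewrite fineK; last by apply: fin_num_measure; exact: measurable_set_le.
    rewrite (_ : [set w' | _ <= c n w'] = [set w' | `|yf w' - dotv xf (least_squares (X n) (y n w'))|
        <= boot_critical (X n) xf (y n w') (1 - alpha)]); last first.
      by apply/funext => w /=; rewrite /c boot_quantileE//; exact: hboot.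
    have := probability_ae_eq (1 - alpha) mc mcov measurableT aec.
    by rewrite !setIT => ->.
  exact: cvg_comp lim _.
move=> X xf y yf c [mX mxf indxf indX] regae hboot.
have eqae : {ae P, forall w, forall n, (p <= n)%N ->
    cond_prob P (mx_events (X n) `|` mx_events xf)
      [set w1 | 1 - alpha <=
        cond_prob P (mx_events (y n) `|` mx_events (X n) `|` mx_events xf)
          [set w2 | `|yf w2 - dotv (xf w2) (least_squares (X n w2) (y n w2))| <= c n w2] w1] w =
    fine (P [set w' | 1 - alpha <= coverage F (X n w) (xf w) beta (1 - alpha)
      (response eps (X n w) beta w')])}.
  apply/ae_foralln => n.
  have [pn|np] := leqP p n; last by apply: nearW => w.
  have n0 : (0 < n)%N by exact: leq_trans pn.
  rewrite (_ : [set w2 | _ <= c n w2] = [set w2 | `|yf w2 - dotv (xf w2) (least_squares (X n w2) (y n w2))|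
      <= boot_critical (X n w2) (xf w2) (y n w2) (1 - alpha)]); last first.
    by apply/funext => w /=; rewrite /c boot_quantileE//; exact: hboot.
  have := random_cond_guarantee beta hmodel hreg halpha n0 (mX n) mxf (indxf n) (indX n).
  by apply: filterS => w ->.
apply: filterS2 eqae regae => w eqw [A [b [regX U0]]].
have lim := coverage_limit iidE varE meanE hreg hF' halpha beta p_gt0 regX U0.
apply: cvg_trans lim; apply: near_eq_cvg; near=> n.
by rewrite eqw//; near: n; exists p.
Unshelve. all: by end_near. Qed.
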